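(* Let $\Gamma$ be a splice diagram with $n$ leaves satisfying the edge determinant and semigroup conditions, let $\mathcal{S}(\Gamma)$ be a splice type system associated to $\Gamma$, and let $(X,0)\hookrightarrow(\mathbb{C}^n,0)$ be the germ it defines. Then the local tropicalization of $(X,0)$ (i.e. of the ideal of $\mathcal{O}$ generated by $\mathcal{S}(\Gamma)$) equals the splice fan $\mathbb{R}_{\ge0}\,\rho(\Gamma)$.
   Context: A splice diagram is a finite tree $\Gamma$ with at least one vertex of valency $\geq3$ and no vertex of valency $2$; vertices of valency $1$ are leaves, others nodes; $\delta_v$ is the valency of $v$. For each node $v$ and edge $e$ at $v$ a positive integer weight $d_{v,e}$ is given; $d_v=\prod_{e\ni v}d_{v,e}$; $d_{v,u}$ is the weight at $v$ of the edge toward $u$. For distinct vertices $u,v$, $\ell_{u,v}$ is the product of all $d_{w,e}$ with $w$ a node on the geodesic $[u,v]$ and $e$ an edge at $w$ not in $[u,v]$; $\ell_{v,v}=d_v$. Edge determinant condition: $d_{u,v}d_{v,u}>\ell_{u,v}$ for every edge between nodes. Semigroup condition: for each node $v$ and edge $e$ at $v$, $d_v\in\sum_{\lambda\in L(v,e)}\mathbb{N}\ell_{v,\lambda}$, $L(v,e)$ the set of leaves $\lambda$ with $e\subseteq[v,\lambda]$. Variables $z_\lambda$ and standard basis vectors $w_\lambda$ of $\mathbb{R}^n$ are indexed by leaves; $w_u=\sum_\lambda\ell_{u,\lambda}w_\lambda$ for nodes $u$. Fix $\alpha_{v,e,\lambda}\in\mathbb{N}$ with $d_v=\sum_{\lambda\in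 L(v,e)}\alpha_{v,e,\lambda}\ell_{v,\lambda}$ and set $z^{m_{v,e}}=\prod_\lambda z_\lambda^{\alpha_{v,e,\lambda}}$, $m_{v,e}=\sum\alpha_{v,e,\lambda}w_\lambda$. A splice type system is a family $F_{v,i}=f_{v,i}+g_{v,i}\in\mathcal{O}:=\mathbb{C}\{z_\lambda\}$ ($v$ node, $1\le i\le\delta_v-2$), $f_{v,i}=\sum_{e\ni v}c_{v,e,i}z^{m_{v,e}}$ with all maximal minors of $(c_{v,e,i})_{e,i}$ nonzero, and $g_{v,i}$ convergent with every exponent $m$ satisfying $w_v\cdot m>d_v$ and $w_u\cdot m>\ell_{u,v}$ for all nodes $u\ne v$. For $w\in\mathbb{R}^n_{\ge0}$, $\mathrm{in}_w(f)$ is the sum of the terms of $f$ of minimal $w$-weight, and $\mathrm{in}_w(I)$ is the ideal of $\mathcal{O}$ generated by $\mathrm{in}_w(f)$, $f\in I$. The local tropicalization of an ideal $I$ is $\{w\in\mathbb{R}^n_{\ge0}:\mathrm{in}_w(I)\text{ contains no monomial}\}$. The map $\rho:\Gamma\to\mathbb{R}^n$ sends each vertex $u$ to $w_u/|w_u|$ ($1$-norm) and is affine on each edge; the splice fan is the cone $\mathbb{R}_{\ge0}\rho(\Gamma)$, with two-dimensional cones $\mathbb{R}_{\ge0}\rho([u,v])$ for edges $[u,v]$. *)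

(* Defs.v *)
From HB Require Import structures.
From mathcomp Require Import all_boot all_order all_algebra complex.
From mathcomp Require Import boolp reals Rstruct.
Set Implicit Arguments. Unset Strict Implicit. Unset Printing Implicit Defensive.
Import Order.TTheory GRing.Theory Num.Theory.
Local Open Scope ring_scope.
Local Open Scope complex_scope.

Definition RR : realType := Rdefinitions.R.
Definition CC := (RR[i])%type.

Section Graph.
Variables (V : finType) (e : rel V).

Definition valency (x : V) : nat := #|[set y | e x y]|.
Definition is_leaf (x : V) : bool := valency x == 1%N.
Definition is_node (x : V) : bool := (3 <= valency x)%N.

Definition is_tree : Prop :=
  [/\ forall x y, e x y = e y x,
      forall x, ~~ e x x,
      forall x y, connect e x y &
      forall c : seq V, uniq c -> (3 <= size c)%N -> ~~ cycle e c].

Definition splice_tree : Prop :=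
  [/\ is_tree, exists x, is_node x & forall x, valency x != 2%N].

Definition on_geod (u v x : V) : Prop :=
  exists p : seq V, [/\ path e u p, last u p = v, uniq (u :: p) & x \in u :: p].

Definition edge_on_geod (u v x y : V) : Prop :=
  exists p : seq V, [/\ path e u p, last u p = v, uniq (u :: p) &
    exists p1 p2, u :: p = p1 ++ [:: x; y] ++ p2 \/ u :: p = p1 ++ [:: y; x] ++ p2].

Definition leaf_t := {x : V | is_leaf x}.

Variable d : V -> V -> nat.  (* d v u = weight at node v of the edge towards u *)

Definition dv (v : V) : nat := (\prod_(u | e v u) d v u)%N.

Definition ell (u v : V) : nat :=
  if u == v then dv v else
  (\prod_(w | is_node w && `[< on_geod u v w >])
     \prod_(y | e w y && ~~ `[< edge_on_geod u v w y >]) d w y)%N.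

Definition beyond (v u : V) (l : leaf_t) : Prop := edge_on_geod v (val l) v u.

Definition edge_determinant_cond : Prop :=
  forall u v, e u v -> is_node u -> is_node v -> (ell u v < d u v * d v u)%N.

Definition semigroup_cond : Prop :=
  forall v u, is_node v -> e v u ->
    exists a : leaf_t -> nat, (forall l, a l <> 0%N -> beyond v u l) /\
      dv v = (\sum_l a l * ell v (val l))%N.

Definition mindex := {ffun leaf_t -> nat}.
Definition series := mindex -> CC.

Definition msize (m : mindex) : nat := (\sum_l m l)%N.

Definition convergent (f : series) : Prop :=
  exists r M : RR, 0 < r /\ forall m, `|f m| * (r%:C) ^+ msize m <= M%:C.

Definition smul (f g : series) : series := fun m =>
  \sum_(a : {ffun leaf_t -> 'I_(msize m).+1} | [forall l, (a l <= m l)%N])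
     f [ffun l => nat_of_ord (a l)] * g [ffun l => (m l - a l)%N].

Definition monomial (m : mindex) : series := fun a => if a == m then 1 else 0.

Definition in_ideal_gen (P : series -> Prop) (f : series) : Prop :=
  exists k (h g : 'I_k -> series),
    (forall j, convergent (h j) /\ P (g j)) /\
    forall m, f m = \sum_(j < k) smul (h j) (g j) m.

Definition wdot (w : leaf_t -> RR) (m : mindex) : RR := \sum_l w l * (m l)%:R.

Definition initial_form (w : leaf_t -> RR) (f : series) : series := fun m =>
  if `[< forall m', f m' != 0 -> wdot w m <= wdot w m' >] then f m else 0.

Definition local_trop (P : series -> Prop) : (leaf_t -> RR) -> Prop :=
  fun w => (forall l, 0 <= w l) /\
     ~ exists m, in_ideal_gen
         (fun g => exists f, in_ideal_gen P f /\ forall a, g a = initial_form w f a)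
         (monomial m).

Definition wvec (u : V) : leaf_t -> RR := fun l =>
  if is_leaf u then (if val l == u then 1 else 0) else (ell u (val l))%:R.

Definition rho (u : V) : leaf_t -> RR := fun l =>
  wvec u l / (\sum_l' `|wvec u l'|).

(* R_{>=0} rho(Gamma) = union over edges [u,v] of the cones over the
   segments rho([u,v]) (rho affine on each edge) *)
Definition splice_fan : (leaf_t -> RR) -> Prop :=
  fun w => exists u v, e u v /\ exists s t : RR,
     [/\ 0 <= s, 0 <= t, t <= 1 &
         forall l, w l = s * ((1 - t) * rho u l + t * rho v l)].

End Graph.

Section SpliceType.
Variables (V : finType) (e : rel V) (d : V -> V -> nat).
Local Notation leaf_t := (leaf_t e).
Local Notation series := (series e).

Definition admissible_alpha (alpha : V -> V -> leaf_t -> nat) : Prop :=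
  forall v u, is_node e v -> e v u ->
    (forall l, alpha v u l <> 0%N -> beyond v u l) /\
    dv e d v = (\sum_l alpha v u l * ell e d v (val l))%N.

Definition m_exp (alpha : V -> V -> leaf_t -> nat) (v u : V) : mindex e :=
  [ffun l => alpha v u l].

Definition f_lead (alpha : V -> V -> leaf_t -> nat) (c : V -> V -> nat -> CC)
  (v : V) (i : nat) : series :=
  fun m => \sum_(u | e v u && (m_exp alpha v u == m)) c v u i.

Definition minors_cond (c : V -> V -> nat -> CC) : Prop :=
  forall v, is_node e v ->
    forall s : 'I_(valency e v - 2) -> V, injective s -> (forall a, e v (s a)) ->
      \det (\matrix_(a, b) c v (s a) (nat_of_ord b)) != 0.

Definition wnat (u : V) (m : mindex e) : nat := (\sum_l ell e d u (val l) * m l)%N.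

Definition g_cond (g : V -> nat -> series) : Prop :=
  forall v i, is_node e v -> (i < valency e v - 2)%N ->
    convergent (g v i) /\
    forall m, g v i m != 0 ->
      (dv e d v < wnat v m)%N /\
      forall u, is_node e u -> u != v -> (ell e d u v < wnat u m)%N.

Definition F_sys (alpha : V -> V -> leaf_t -> nat) (c : V -> V -> nat -> CC)
  (g : V -> nat -> series) (v : V) (i : nat) : series :=
  fun m => f_lead alpha c v i m + g v i m.

Definition splice_gens (alpha : V -> V -> leaf_t -> nat) (c : V -> V -> nat -> CC)
  (g : V -> nat -> series) : series -> Prop :=
  fun F => exists v i, [/\ is_node e v, (i < valency e v - 2)%N &
                          forall m, F m = F_sys alpha c g v i m].

End SpliceType.

Arguments admissible_alpha {V} e d alpha.
Arguments minors_cond {V} e c.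
Arguments g_cond {V} e d g.
Arguments splice_gens {V} e alpha c g _.
Arguments local_trop {V} e P _.
Arguments splice_fan {V} e d _.
Arguments edge_determinant_cond {V} e d.
Arguments semigroup_cond {V} e d.

(* Main.v *)
Require Import Defs.
From HB Require Import structures.
From mathcomp Require Import all_boot all_order all_algebra complex.
From mathcomp Require Import boolp reals Rstruct.
From mathcomp Require Import zify ring lra.

(** A positive weight [w] in the interior of the cone of an edge [x y] is reached by arcs: in
    every equation of a node [v] the monomial pointing towards the edge has larger weight and
    drops out of the initial form, as does the tail.  The remaining binomial-like system is
    solved in the torus recursively along the two subtrees, its logarithmic Jacobian is onto
    for the same reason, and Newton's method lifts the solution to arcs
    [z_l = X^(w_l) * (unit)] on the germ, modulo any power of [X].  A monomial initial form
    would not vanish on such an arc.  Real points of the fan are approximated from above by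
    such rational weights without changing the initial monomial.

    Conversely let [w] be positive and let [a w_u] be the largest multiple of [w_u] below [w].
    If [b = w - a w_u] is neither zero nor positive on a branch, then at some node of this
    branch a combination of the equations with three leading terms has a monomial initial
    form; so [b] is positive on at most one branch at [u], which gives a direction at every
    node.  Two adjacent nodes with opposite directions exist unless the direction leads to a
    leaf, and then [w] lies in the cone of that edge.  If [w] has a zero and at least two
    positive coordinates, the leading forms show that modulo the ideal and the variables of
    positive weight every variable is nilpotent up to higher order terms, and Nakayama's lemma
    produces a monomial. *)

Set Implicit Arguments. Unset Strict Implicit. Unset Printing Implicit Defensive.
Import Order.TTheory GRing.Theory Num.Theory.

(** * Sides of an edge in a tree *)

Section Tree.
Variables (V : finType) (e : rel V).
Hypothesis tree : is_tree e.

(** Both inclusions rest on one dichotomy. The product [ell u v * ell v t] equals [ell u t * dv v]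
    when [v] lies between [u] and [t], and the edge determinant condition makes it strictly smaller
    when a node [u] and a leaf [t] lie behind the same edge at [v]. Hence the leading monomials at
    [v] have equal [w_u]-weight, except for the one pointing to [u], which is heavier. Without it,
    the equations at [v] have one monomial more than their number and a one-dimensional kernel
    without zero coordinates, so these monomials are prescribed only up to a common factor. This
    freedom lets the branches be solved independently, for points and for tangent vectors alike.
    Arcs of finite order suffice: the weight of the suspected monomial is known beforehand, so
    polynomials replace convergent arcs. Rounding up makes both edge coefficients positive: on the
    ray of a node that node would keep all its leading monomials, and on the ray of a leaf
    coordinates vanish. It raises the weight of the given monomial by a bounded amount and lowers no
    other weight. *)

Definition cut (x y : V) : rel V :=
  [rel a b | [&& e a b, (a, b) != (x, y) & (a, b) != (y, x)]].

(** The branch of the tree at [x] through the edge to [y]: the component of [y] once that edge is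
    deleted. Later arguments use it in place of geodesics. *)
Definition side (x y t : V) : bool := connect (cut x y) y t.

Definition sep (x y u v : V) : bool := side x y u != side x y v.

Lemma tree_sym x y : e x y = e y x.
Proof. by case: tree => H _ _ _; apply: H. Qed.

Lemma tree_irr x : e x x = false.
Proof. by case: tree => _ H _ _; apply/negbTE. Qed.

Lemma edge_neq x y : e x y -> x != y.
Proof. by apply: contraTneq => ->; rewrite tree_irr. Qed.

Lemma cut_sym x y : symmetric (cut x y).
Proof.
move=> a b; rewrite /cut /= tree_sym !xpair_eqE.
by rewrite [(a == x) && _]andbC [(a == y) && _]andbC [X in _ && X]andbC.
Qed.

Lemma cutC x y : cut x y =2 cut y x.
Proof. by move=> a b; rewrite /cut /= [X in _ && X]andbC. Qed.

Lemma side_refl x y : side x y y.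
Proof. exact: connect0. Qed.

Lemma cut_side x y a b : cut x y a b -> side x y a = side x y b.
Proof.
move=> ab; have csym := sym_connect_sym (cut_sym x y).
by rewrite /side; apply: (same_connect_r csym); apply: connect1.
Qed.

(** A path from [y] back to [x] avoiding the edge would, once shortened, close up with it to a cycle
    of length at least three. *)
Lemma side_bridge x y : e x y -> side x y x = false.
Proof.
move=> exy; apply/negP => /connectP[p0 pth0 lst0].
case: (shortenP pth0) lst0 => p pth unq _ lst.
case: tree => _ _ _ acyc.
have sub : path e y p by apply: sub_path pth => a b /and3P[].
case: p pth unq lst sub => [|a [|b p]] pth unq lst sub.
- by move: (edge_neq exy); rewrite lst /= eqxx.
- by move: pth; rewrite /= in lst; rewrite /= -lst /cut /= eqxx !andbF.
- have /negP[] := acyc (y :: a :: b :: p) unq isT.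
  by rewrite (cycle_path y) /= -[last b p]/(last y [:: a, b & p]) -lst exy.
Qed.

Lemma side_cover x y t : e x y -> side x y t || side y x t.
Proof.
move=> exy; case: tree => _ _ conn _.
have cl : closed e [pred s | side x y s || side y x s].
  apply: intro_closed; first exact: (sym_connect_sym tree_sym).
  move=> a b eab; rewrite !inE.
  have [ca|] := boolP (cut x y a b).
    by rewrite (cut_side ca) -(cut_side (x := y) (y := x) (a := a) (b := b)) // -cutC.
  rewrite /cut /= eab /= negb_and !negbK => /orP[] /eqP[_ ->];
  by rewrite side_refl ?orbT.
by have := closed_connect cl (conn y t); rewrite !inE side_refl => <-.
Qed.

Lemma sideN x y t : e x y -> side x y t = ~~ side y x t.
Proof.
move=> exy; have := side_cover t exy.
case s1 : (side x y t); case s2 : (side y x t) => //= _.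
have csym := sym_connect_sym (cut_sym x y).
have := side_bridge exy; rewrite /side in s1 s2 *.
rewrite (eq_connect (cutC y x)) csym in s2.
by rewrite (connect_trans s1 s2).
Qed.

Lemma side_step x y a b : e a b ->
  (a, b) != (x, y) -> (a, b) != (y, x) -> side x y a = side x y b.
Proof. by move=> eab n1 n2; apply: cut_side; rewrite /cut /= eab n1. Qed.

(* Along a path inside [side x z] the function [side y z'] can only change
   at the edge [y z'], and that edge is not inside [side x z]. *)
Lemma side_const x z y z' s : e x z -> ~~ (side x z y && side x z z') -> 
  side x z s -> side y z' s = side y z' z.
Proof.
move=> exz nxz.
pose a := [pred s | side x z s ==> (side y z' s == side y z' z)].
have cl : closed (cut x z) a.
  apply: intro_closed; first exact: (sym_connect_sym (cut_sym x z)).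
  move=> p q cpq; rewrite !inE -(cut_side cpq).
  case sp : (side x z p) => //= /eqP <-; apply/eqP/esym.
  have sq : side x z q by rewrite -(cut_side cpq).
  case/and3P: (cpq) => epq _ _; apply: side_step => //.
    by apply: contra nxz => /eqP[<- <-]; rewrite sp sq.
  by apply: contra nxz => /eqP[<- <-]; rewrite sp sq.
move=> szs; have := closed_connect cl szs.
by rewrite !inE side_refl eqxx szs /= => /esym/eqP.
Qed.

(** The branches at [x] are disjoint: neither a walk from [t] to [z] inside the branch of [z] nor
    the step from [z] to [x] uses the edge to another neighbour [z']. *)
Lemma side_uniq x z z' t : e x z -> e x z' -> side x z t ->
  side x z' t = (z' == z).
Proof.
move=> exz exz' szt; case: eqVneq => [-> //|nz].
rewrite (side_const (x := x) (z := z)) //; last by rewrite side_bridge.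
rewrite -(side_bridge exz'); apply: side_step; first by rewrite tree_sym.
  by apply/eqP => -[ezx _]; move: (edge_neq exz); rewrite ezx eqxx.
by rewrite xpair_eqE eq_sym (negbTE nz).
Qed.

Lemma path_cut x y u p : path e u p -> x \notin u :: p -> path (cut x y) u p.
Proof.
elim: p u => //= a p IH u /andP[eua pth].
rewrite !inE !negb_or => /and3P[xu xa xp].
rewrite IH ?inE ?negb_or ?xa // andbT /cut /= eua !xpair_eqE.
by rewrite eq_sym (negbTE xu) /= [a == x]eq_sym (negbTE xa) andbF.
Qed.

Lemma uniq_path u v : exists p, [/\ path e u p, last u p = v & uniq (u :: p)].
Proof.
case: tree => _ _ conn _; have /connectP[p0 pth0 ->] := conn u v.
by case: (shortenP pth0) => p pth unq _; exists p.
Qed.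

Lemma side_exists x t : t != x -> exists2 z, e x z & side x z t.
Proof.
move=> ntx; have [[|z p] [pth lst unq]] := uniq_path x t.
  by rewrite -lst eqxx in ntx.
move: pth unq => /= /andP[exz pth] /andP[xp _]; exists z => //.
by apply/connectP; exists p => //; apply: path_cut.
Qed.

Lemma path_cross x y u p : path e u p -> sep x y u (last u p) ->
  exists p1 p2, u :: p = p1 ++ [:: x; y] ++ p2 \/ u :: p = p1 ++ [:: y; x] ++ p2.
Proof.
rewrite /sep; elim: p u => [|a p IH] u /=; first by rewrite eqxx.
move=> /andP[eua pth].
have [/eqP[-> ->]|n1] := boolP ((u, a) == (x, y)); first by exists [::], p; left.
have [/eqP[-> ->]|n2] := boolP ((u, a) == (y, x)); first by exists [::], p; right.
rewrite (side_step eua n1 n2) => /(IH _ pth)[p1 [p2 [] ->]].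
  by exists (u :: p1), p2; left.
by exists (u :: p1), p2; right.
Qed.

Lemma cross_sep x y u p p1 p2 : path e u p -> uniq (u :: p) ->
  u :: p = p1 ++ [:: x; y] ++ p2 -> e x y && sep x y u (last u p).
Proof.
elim: p1 u p => [|b p1 IH] u p pth unq /=.
  case=> ux py; subst; move: pth unq => /= /andP[exy pth] /andP[xp _].
  rewrite exy /sep side_bridge //=; suff -> : side x y (last y p2) by [].
  by apply/connectP; exists p2 => //; apply: path_cut.
case=> _ pE; case: p pE pth unq => [|a p]; first by case: p1 {IH}.
move=> pE /=; move=> /andP[eua pth] /andP[ua unq].
have /andP[exy] := IH a p pth unq pE; rewrite exy /sep.
rewrite -(side_step (x := x) (y := y) eua) //.
- apply: contraNneq ua => -[-> _]; rewrite pE.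
  by rewrite mem_cat !inE eqxx orbT.
- apply: contraNneq ua => -[-> _]; rewrite pE.
  by rewrite mem_cat !inE eqxx !orbT.
Qed.

Lemma sepC x y u v : e x y -> sep x y u v = sep y x u v.
Proof. by move=> exy; rewrite /sep !(sideN _ exy); do 2! case: (side y x _). Qed.

Lemma sep_sym x y u v : sep x y u v = sep x y v u.
Proof. by rewrite /sep eq_sym. Qed.

(** Only the edge [x y] itself changes the value of [side x y], so a path between different sides
    must use it; conversely a simple path crosses it once and never returns. *)
Lemma edge_on_geodE u v x y :
  `[< edge_on_geod e u v x y >] = e x y && sep x y u v.
Proof.
apply/asboolP/idP => [[p [pth <- unq [p1 [p2 [E|E]]]]]|/andP[exy sxy]].
- exact: (cross_sep pth unq E).
- by have /andP[eyx] := cross_sep pth unq E; rewrite tree_sym eyx sepC.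
- have [p [pth lst unq]] := uniq_path u v; exists p; split => //.
  by apply: path_cross => //; rewrite lst.
Qed.

Lemma on_geodE u v x : u != v ->
  `[< on_geod e u v x >] = [exists y, e x y && sep x y u v].
Proof.
move=> nuv; apply/asboolP/existsP => [[p [pth lst unq xp]]|[y]]; last first.
  rewrite -edge_on_geodE => /asboolP[p [pth lst unq [p1 [p2 E]]]].
  exists p; split => //; case: E => ->; by rewrite mem_cat !inE eqxx !orbT.
have [p1 [p2 E]] : exists p1 p2, u :: p = p1 ++ x :: p2.
  by case/splitPr: xp => p1 p2; exists p1, p2.
case: p2 E => [|y p2] E; last first.
  exists y; rewrite -lst; exact: (cross_sep pth unq E).
case/lastP: p1 E => [|p1 y] E.
  by case: E lst => _ -> /= uv; rewrite uv eqxx in nuv.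
exists y; rewrite -cats1 -catA /= in E.
have /andP[eyx] := cross_sep pth unq E.
by rewrite tree_sym eyx lst sepC.
Qed.

Lemma sep_adj x y w z : e x y -> e w z ->
  sep w z x y = ((w, z) == (x, y)) || ((w, z) == (y, x)).
Proof.
move=> exy ewz; case: eqVneq => [[-> ->]|n1] /=.
  by rewrite /sep side_bridge // side_refl.
case: eqVneq => [[-> ->]|n2] /=.
  by rewrite /sep side_bridge 1?tree_sym // side_refl.
by apply/negbTE; rewrite negbK; apply/eqP/side_step => //; rewrite eq_sym //
  xpair_eqE andbC -xpair_eqE.
Qed.

Lemma side_sub x y z t : e x y -> e y z -> z != x -> side y z t -> side x y t.
Proof.
move=> exy eyz nzx syz; rewrite sideN //.
by rewrite (side_uniq eyz) 1?tree_sym // eq_sym.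
Qed.

Lemma side_inv x y t : e x y -> side x y t -> t != y ->
  exists z, [/\ e y z, z != x & side y z t].
Proof.
move=> exy sxy /side_exists[z eyz syz]; exists z; split=> //.
by apply: contraTneq sxy => zx; rewrite sideN // -zx syz.
Qed.

Lemma card_side x y z : e x y -> e y z -> z != x ->
  (#|side y z| < #|side x y|)%N.
Proof.
move=> exy eyz nzx; apply: proper_card; apply/properP; split.
  by apply/subsetP => t; rewrite !unfold_in; apply: side_sub.
exists y; first exact: side_refl.
by have := side_bridge eyz; rewrite /in_mem /= => ->.
Qed.

(** The complement of the branch at [w] containing [y] is connected, contains [w] and avoids [y].
    The edge [y z2] is therefore not inside it, and all of it lies on the side of [w]. *)
Lemma side_nest w z1 y z2 s : e w z1 -> e y z2 -> side w z1 y -> side y z2 w ->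
  ~~ side w z1 s -> side y z2 s.
Proof.
move=> ew ey s1 s2; rewrite sideN // negbK => s3.
by rewrite (side_const (x := z1) (z := w)) // 1?tree_sym //
  [X in ~~ (X && _)]sideN 1?tree_sym // s1.
Qed.

End Tree.

(** * Linking numbers *)

Section Ell.
Variables (V : finType) (e : rel V) (d : V -> V -> nat).
Hypothesis tree : is_tree e.

(** The factor of the node [w] in [ell u v]. A separating edge at [w] exists exactly when [w] is on
    the geodesic; otherwise the factor is 1, so that products run over all nodes and are compared
    factor by factor. *)
Definition ell_at (w u v : V) : nat :=
  if [exists y, e w y && sep e w y u v]
  then (\prod_(y | e w y && ~~ sep e w y u v) d w y)%N else 1%N.

Lemma ell_prod u v : u != v ->
  ell e d u v = (\prod_(w | is_node e w) ell_at w u v)%N.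
Proof.
move=> nuv; rewrite /ell (negbTE nuv).
rewrite [RHS](bigID (fun w => `[< on_geod e u v w >])) /=.
rewrite [X in _ = (_ * X)%N]big1 ?muln1 => [|w /andP[_]]; last first.
  by rewrite on_geodE // /ell_at => /negbTE ->.
apply: eq_bigr => w /andP[_]; rewrite on_geodE // /ell_at => ->.
by apply: eq_bigl => y; rewrite edge_on_geodE //; case: (e w y).
Qed.

Lemma eq_ell_at w u v u' v' :
  (forall y, e w y -> sep e w y u v = sep e w y u' v') ->
  ell_at w u v = ell_at w u' v'.
Proof.
move=> E; rewrite /ell_at.
rewrite (eq_existsb (P2 := fun y => e w y && sep e w y u' v')) => [|y].
  by congr (if _ then _ else _); apply: eq_bigl => y; case: (boolP (e w y)) => // /E ->.
by case: (boolP (e w y)) => // /E ->.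
Qed.

Lemma ell_at1 w u v : (forall y, e w y -> sep e w y u v = false) ->
  ell_at w u v = 1%N.
Proof.
move=> E; rewrite /ell_at; case: existsP => // -[y /andP[/E ->]] //.
Qed.

Lemma ell_atC w u v : ell_at w u v = ell_at w v u.
Proof. by apply: eq_ell_at => y _; rewrite sep_sym. Qed.

Lemma ell_sym u v : ell e d u v = ell e d v u.
Proof.
have [-> //|nuv] := eqVneq u v.
rewrite !ell_prod // 1?eq_sym //; apply: eq_bigr => w _; exact: ell_atC.
Qed.

Lemma ell_diag v : ell e d v v = dv e d v.
Proof. by rewrite /ell eqxx. Qed.

Lemma ell_at_end y z u : e y z -> side e y z u ->
  ell_at y u y = (\prod_(x | e y x && (x != z)) d y x)%N.
Proof.
move=> eyz szu.
have E x : e y x -> sep e y x u y = (x == z).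
  by move=> eyx; rewrite /sep (side_bridge tree eyx) (side_uniq tree eyz eyx szu); case: (x == z).
rewrite /ell_at ifT; last first.
  by apply/existsP; exists z; rewrite eyz E // eqxx.
by apply: eq_bigl => x; case: (boolP (e y x)) => //= /E ->.
Qed.

Lemma ell_at_mid y z z' u t : e y z -> side e y z u -> e y z' -> side e y z' t ->
  z != z' ->
  ell_at y u t = (\prod_(x | [&& e y x, x != z & x != z']) d y x)%N.
Proof.
move=> eyz szu eyz' szt nz.
have E x : e y x -> sep e y x u t = (x == z) || (x == z').
  move=> eyx; rewrite /sep (side_uniq tree eyz eyx szu) (side_uniq tree eyz' eyx szt).
  by case: (eqVneq x z) => [->|_]; [rewrite (negbTE nz) | case: (x == z')].
rewrite /ell_at ifT; last first.
  by apply/existsP; exists z; rewrite eyz E // eqxx.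
by apply: eq_bigl => x; case: (boolP (e y x)) => //= /E ->; rewrite negb_or.
Qed.

(* Compare local factors node by node: away from [y], one of the two on the right is 1. *)
Lemma ell_split u t y : is_node e y ->
  (forall z, e y z -> ~~ (side e y z u && side e y z t)) ->
  (ell e d u t * dv e d y = ell e d u y * ell e d y t)%N.
Proof.
move=> ny Hsep.
have [->|nuy] := eqVneq u y; first by rewrite ell_diag mulnC.
have [->|nty] := eqVneq t y; first by rewrite ell_diag.
have [zu eu su] := side_exists tree nuy.
have [zt et st] := side_exists tree nty.
have nut : u != t by apply/eqP => ut; have := Hsep _ eu; rewrite -ut su.
have nz : zu != zt by apply/eqP => E; have := Hsep _ eu; rewrite su E st.
rewrite !ell_prod // 1?eq_sym //.
rewrite (bigD1 y) //= [X in (_ = X * _)%N](bigD1 y) //= [X in (_ = _ * X)%N](bigD1 y) //=.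
have -> : (\prod_(i | is_node e i && (i != y)) ell_at i u t =
  (\prod_(i | is_node e i && (i != y)) ell_at i u y) *
  (\prod_(i | is_node e i && (i != y)) ell_at i y t))%N.
  rewrite -big_split /=; apply: eq_bigr => w /andP[_ nwy].
  have nyw : y != w by rewrite eq_sym.
  have [z1 e1 s1] := side_exists tree nyw.
  have [sz1|nsz1] := boolP (side e w z1 u).
    have E z : e w z -> side e w z u = side e w z y.
      by move=> ewz; rewrite (side_uniq tree e1 ewz sz1) (side_uniq tree e1 ewz s1).
    rewrite (ell_at1 (u := u) (v := y)) ?mul1n => [|z /E]; last by rewrite /sep => ->; rewrite eqxx.
    by apply: eq_ell_at => z /E; rewrite /sep => ->.
  have [sz2|nsz2] := boolP (side e w z1 t).
    have E z : e w z -> side e w z t = side e w z y.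
      by move=> ewz; rewrite (side_uniq tree e1 ewz sz2) (side_uniq tree e1 ewz s1).
    rewrite (ell_at1 (u := y) (v := t)) ?muln1 => [|z /E]; last by rewrite /sep => ->; rewrite eqxx.
    by apply: eq_ell_at => z /E; rewrite /sep => ->.
  have [z2 e2 s2] := side_exists tree nwy.
  have := Hsep _ e2.
  by rewrite (side_nest tree e1 e2 s1 s2 nsz1) (side_nest tree e1 e2 s1 s2 nsz2).
rewrite (ell_at_mid eu su et st nz) (ell_at_end eu su) ell_atC (ell_at_end et st).
have D z : e y z -> dv e d y = (d y z * \prod_(x | e y x && (x != z)) d y x)%N.
  by move=> ez; rewrite /dv (bigD1 z).
have -> : (\prod_(x | e y x && (x != zu)) d y x =
   d y zt * \prod_(x | [&& e y x, x != zu & x != zt]) d y x)%N.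
  rewrite (bigD1 zt) /=; last by rewrite et eq_sym.
  by congr (_ * _)%N; apply: eq_bigl => x; rewrite andbA.
rewrite (D zt) //; lia.
Qed.

Lemma ell_adj x y : e x y -> is_node e x -> is_node e y ->
  (ell e d x y * (d x y * d y x) = dv e d x * dv e d y)%N.
Proof.
move=> exy nx ny; have nxy := edge_neq tree exy.
have eyx : e y x by rewrite tree_sym.
rewrite ell_prod // (bigD1 x) //= (bigD1 y) /=; last by rewrite ny eq_sym.
rewrite big1 ?muln1 => [|w /andP[/andP[_ nwx] nwy]]; last first.
  apply: ell_at1 => z ewz; rewrite (sep_adj tree) // !xpair_eqE.
  by rewrite (negbTE nwx) (negbTE nwy).
rewrite (ell_at_end (u := x) eyx (side_refl _ _ _)) ell_atC.
rewrite (ell_at_end (u := y) exy (side_refl _ _ _)).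
have -> : dv e d x = (d x y * \prod_(z | e x z && (z != y)) d x z)%N by rewrite /dv (bigD1 y).
have -> : dv e d y = (d y x * \prod_(z | e y z && (z != x)) d y z)%N by rewrite /dv (bigD1 x).
lia.
Qed.

Hypothesis dpos : forall v u, is_node e v -> e v u -> (0 < d v u)%N.

Lemma dv_gt0 v : is_node e v -> (0 < dv e d v)%N.
Proof. by move=> nv; apply: prodn_cond_gt0 => u; apply: dpos. Qed.

Lemma ell_gt0 u v : is_node e u -> (0 < ell e d u v)%N.
Proof.
move=> nu; have [<-|nuv] := eqVneq u v; first by rewrite ell_diag dv_gt0.
rewrite ell_prod //; apply: prodn_cond_gt0 => w nw; rewrite /ell_at.
by case: ifP => // _; apply: prodn_cond_gt0 => y /andP[ewy _]; apply: dpos.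
Qed.

Hypothesis edc : edge_determinant_cond e d.

(** The edge determinant condition multiplied by [ell e d x y]. In this form it is the positivity of
    the determinant of the linear system that later expresses a weight through [w_x] and [w_y]. *)
Lemma ell_adj_lt x y : e x y -> is_node e x -> is_node e y ->
  (ell e d x y * ell e d x y < dv e d x * dv e d y)%N.
Proof.
move=> exy nx ny; rewrite -(ell_adj exy nx ny) ltn_pmul2l ?ell_gt0 //.
exact: edc.
Qed.

Hypothesis val2 : forall x, valency e x != 2%N.
Hypothesis node_ex : exists x, is_node e x.

Lemma has_edge x : exists y, e x y.
Proof.
have [u nu] := node_ex; have [<-|nux] := eqVneq u x.
  have /card_gt0P[y] : (0 < #|[set y | e u y]|)%N by apply: leq_trans nu.
  by rewrite inE => euy; exists y.
by have [z exz _] := side_exists tree nux; exists z.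
Qed.

Lemma leaf_node x : is_leaf e x = ~~ is_node e x.
Proof.
have [y exy] := has_edge x.
have : (0 < valency e x)%N by apply/card_gt0P; exists y; rewrite inE.
have := val2 x; rewrite /is_leaf /is_node; lia.
Qed.

Lemma leaf_edge x y z : is_leaf e x -> e x y -> e x z -> y = z.
Proof.
move=> /cards1P[a E] exy exz.
have: y \in [set y | e x y] by rewrite inE.
have: z \in [set y | e x y] by rewrite inE.
by rewrite E !inE => /eqP -> /eqP ->.
Qed.

Lemma side_leaf x y t : e x y -> is_leaf e y -> side e x y t = (t == y).
Proof.
move=> exy ly; apply/idP/eqP => [st|->]; last exact: side_refl.
apply: contraTeq st => /(side_exists tree)[z eyz syz].
rewrite (sideN tree t exy) negbK (leaf_edge (y := x) (z := z) ly) //.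
by rewrite tree_sym.
Qed.

Lemma leaf_edge_node x y : is_leaf e x -> e x y -> is_node e y.
Proof.
move=> lx exy; rewrite -[is_node e y]negbK -leaf_node; apply/negP => ly.
have [u nu] := node_ex.
have A t : t = x \/ t = y.
  have := sideN tree t exy; rewrite !side_leaf // 1?(tree_sym tree) //.
  by case: (eqVneq t y) => [->|_]; [right | case: (eqVneq t x) => [->|_] //; left].
by case: (A u) nu => ->; apply/negP; rewrite -leaf_node.
Qed.

Lemma ell_mult u v z t : is_node e v -> e v z -> ~~ side e v z u -> side e v z t ->
  (ell e d u t * dv e d v = ell e d u v * ell e d v t)%N.
Proof.
move=> nv evz su st; apply: ell_split => // z' evz'; apply/negP => /andP[su' st'].
by rewrite (side_uniq tree evz' evz st') in st; rewrite (eqP st) su' in su.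
Qed.

(* Compare along the geodesic starting at [v]: moving to the next node [z], either
   [z] is the branching point of [u], [v], [t], or the claim at [z] applies; both
   times the squares of the [ell]'s of adjacent nodes give the strictness. *)
Lemma ell_strict v z u t : is_node e v -> e v z -> is_node e u -> side e v z u ->
  side e v z t -> t != u -> (ell e d u v * ell e d v t < ell e d u t * dv e d v)%N.
Proof.
move: {2}#|side e v z| (leqnn #|side e v z|) => n.
elim: n v z => [|n IH] v z.
  by rewrite leqn0 => /eqP/card0_eq/(_ z); rewrite [_ \in _]side_refl.
move=> cn nv evz nu su st ntu.
have nz : is_node e z.
  rewrite -[is_node e z]negbK -leaf_node; apply/negP => lz.
  move: ntu; rewrite side_leaf // in su; rewrite side_leaf // in st.
  by rewrite (eqP su) (eqP st) eqxx.
have ezv : e z v by rewrite tree_sym.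
have szv := side_refl e z v.
have nsv x : side e v z x -> ~~ side e z v x by move=> sx; rewrite -sideN.
have Eu : (ell e d u v * dv e d z = ell e d u z * ell e d z v)%N.
  by apply: (ell_mult nz ezv (nsv _ su) szv).
have Et : (ell e d v t * dv e d z = ell e d z v * ell e d z t)%N.
  rewrite ell_sym [ell e d z t]ell_sym [RHS]mulnC.
  by apply: (ell_mult nz ezv (nsv _ st) szv).
have Lt := ell_adj_lt ezv nz nv.
have Le : (ell e d u z * ell e d z t <= ell e d u t * dv e d z)%N.
  have [/existsP[z' /and3P[ezz' su' st']]|/existsPn N] :=
    boolP [exists z', [&& e z z', side e z z' u & side e z z' t]].
    have nz'v : z' != v by apply: contraTneq su' => ->; exact: nsv.
    apply/ltnW/(IH z z') => //; rewrite -ltnS; apply: leq_trans cn.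
    exact: (card_side tree evz ezz' nz'v).
  rewrite -(@ell_split u t z) // => z' ezz'; have := N z'; by rewrite ezz'.
have dz := dv_gt0 nz; have dvv := dv_gt0 nv.
rewrite -(ltn_pmul2r dz) -(ltn_pmul2r dz).
have P1 : (0 < ell e d u t * dv e d z)%N by rewrite muln_gt0 ell_gt0 ?dv_gt0.
apply: (@leq_ltn_trans (ell e d u t * dv e d z * (ell e d z v * ell e d z v))%N).
  have -> : (ell e d u v * ell e d v t * dv e d z * dv e d z =
     (ell e d u v * dv e d z) * (ell e d v t * dv e d z))%N by lia.
  rewrite Eu Et.
  have -> : (ell e d u z * ell e d z v * (ell e d z v * ell e d z t) =
    (ell e d u z * ell e d z t) * (ell e d z v * ell e d z v))%N by lia.
  by rewrite leq_mul2r Le orbT.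
have -> : (ell e d u t * dv e d v * dv e d z * dv e d z =
  ell e d u t * dv e d z * (dv e d z * dv e d v))%N by lia.
by rewrite ltn_pmul2l.
Qed.

End Ell.

Local Open Scope ring_scope.

(** * Convergent power series *)

Section Exponents.
Variable L : finType.
Implicit Types a b m : {ffun L -> nat}.

Definition deg m : nat := (\sum_l m l)%N.
Definition mle a m := [forall l, (a l <= m l)%N].
Definition msub m a : {ffun L -> nat} := [ffun l => (m l - a l)%N].
Definition ofbox n (a : {ffun L -> 'I_n}) : {ffun L -> nat} :=
  [ffun l => nat_of_ord (a l)].

Lemma maddE a b l : (a + b) l = (a l + b l)%N.
Proof. by rewrite ffunE. Qed.

Lemma mzeroE l : (0 : {ffun L -> nat}) l = 0%N.
Proof. by rewrite ffunE. Qed.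

Lemma mleP a m : reflect (forall l, (a l <= m l)%N) (mle a m).
Proof. exact: forallP. Qed.

Lemma mle_refl m : mle m m.
Proof. by apply/mleP => l. Qed.

Lemma mle_trans b a m : mle a b -> mle b m -> mle a m.
Proof. by move=> /mleP ab /mleP bm; apply/mleP => l; apply: leq_trans (bm l). Qed.

Lemma mle_addl a b : mle a (a + b).
Proof. by apply/mleP => l; rewrite maddE leq_addr. Qed.

Lemma mle_addr a b : mle b (a + b).
Proof. by rewrite addrC mle_addl. Qed.

Lemma msubK m a : mle a m -> msub m a + a = m.
Proof. by move=> /mleP am; apply/ffunP => l; rewrite maddE ffunE subnK. Qed.

Lemma maddK m a : msub (m + a) a = m.
Proof. by apply/ffunP => l; rewrite ffunE maddE addnK. Qed.

Lemma mle_sub m a : mle (msub m a) m.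
Proof. by apply/mleP => l; rewrite ffunE leq_subr. Qed.

Lemma msub_sub m a : mle a m -> msub m (msub m a) = a.
Proof. by move=> /mleP am; apply/ffunP => l; rewrite !ffunE subKn. Qed.

Lemma degD a b : deg (a + b) = (deg a + deg b)%N.
Proof. by rewrite /deg -big_split; apply: eq_bigr => l _; rewrite maddE. Qed.

Lemma deg0 : deg 0 = 0%N.
Proof. by rewrite /deg big1 // => l _; rewrite ffunE. Qed.

Lemma deg_eq0 m : (deg m == 0%N) = (m == 0).
Proof.
apply/eqP/eqP => [|->]; last exact: deg0.
move=> /eqP; rewrite sum_nat_eq0 => /forall_inP H.
by apply/ffunP => l; rewrite ffunE; apply/eqP/H.
Qed.

Lemma leq_deg m l : (m l <= deg m)%N.
Proof. by rewrite /deg (bigD1 l) //= leq_addr. Qed.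

Lemma mle_deg a m : mle a m -> (deg a <= deg m)%N.
Proof. by move=> /mleP am; apply: leq_sum. Qed.

Lemma ofbox_inj n : injective (@ofbox n).
Proof.
by move=> a b /ffunP ab; apply/ffunP => l; apply: val_inj; have := ab l; rewrite !ffunE.
Qed.

Lemma ofboxP n m : (forall l, (m l < n)%N) -> exists a : {ffun L -> 'I_n}, m = ofbox a.
Proof.
move=> H; exists [ffun l => Ordinal (H l)].
by apply/ffunP => l; rewrite !ffunE.
Qed.

(** Multi-indices are not a finite type, so those below [m] are enumerated through a box of side
    [deg m + 1]; a list allows Cauchy products to be reindexed by permutations. *)
Definition lower m : seq {ffun L -> nat} :=
  [seq ofbox x | x <- enum [pred x : {ffun L -> 'I_(deg m).+1} | mle (ofbox x) m]].

Lemma lower_uniq m : uniq (lower m).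
Proof. by rewrite map_inj_uniq ?enum_uniq //; apply: ofbox_inj. Qed.

Lemma mem_lower m a : (a \in lower m) = mle a m.
Proof.
apply/mapP/idP => [[b + ->]|am]; first by rewrite mem_enum.
have [|b E] := @ofboxP (deg m).+1 a.
  by move=> l; rewrite ltnS (leq_trans (leq_deg _ _)) ?mle_deg.
by exists b => //; rewrite mem_enum inE -E.
Qed.

Lemma lower_perm s m : uniq s -> (forall a, (a \in s) = mle a m) ->
  perm_eq (lower m) s.
Proof. by move=> us H; apply: uniq_perm => // [|a]; rewrite ?lower_uniq // mem_lower H. Qed.

Lemma lower0 : perm_eq (lower 0) [:: 0].
Proof.
apply: lower_perm => // a; rewrite inE; apply/eqP/mleP => [-> //|H].
by apply/ffunP => l; have := H l; rewrite ffunE leqn0 => /eqP.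
Qed.

End Exponents.

(** The ring structure is put on all formal series. Convergence is a predicate preserved by the
    operations, and ideals are only required to absorb convergent multipliers. *)
Definition fps (L : finType) : Type := {ffun L -> nat} -> CC.

Section Series.
Variable L : finType.
Implicit Types (f g h : fps L) (a b m : {ffun L -> nat}).

Definition fps_add f g : fps L := fun m => f m + g m.
Definition fps_opp f : fps L := fun m => - f m.
Definition fps_zero : fps L := fun=> 0.
Definition fps_one : fps L := fun m => (m == 0)%:R.
Definition fps_mul f g : fps L := fun m =>
  \sum_(a <- lower m) f a * g (msub m a).

Lemma fps_addA : associative fps_add.
Proof. by move=> f g h; apply: funext => m; apply: addrA. Qed.
Lemma fps_addC : commutative fps_add.
Proof. by move=> f g; apply: funext => m; apply: addrC. Qed.
Lemma fps_add0 : left_id fps_zero fps_add.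
Proof. by move=> f; apply: funext => m; apply: add0r. Qed.
Lemma fps_addN : left_inverse fps_zero fps_opp fps_add.
Proof. by move=> f; apply: funext => m; apply: addNr. Qed.

Lemma fps_mulC : commutative fps_mul.
Proof.
move=> f g; apply: funext => m; rewrite /fps_mul.
rewrite (perm_big [seq msub m a | a <- lower m]) /=; last first.
  apply: lower_perm => [|a].
    rewrite map_inj_in_uniq ?lower_uniq // => a b.
    by rewrite !mem_lower => am bm E; rewrite -(msub_sub am) E msub_sub.
  apply/mapP/idP => [[b _ ->]|am]; first exact: mle_sub.
  by exists (msub m a); rewrite ?mem_lower ?mle_sub // msub_sub.
rewrite big_map big_seq [RHS]big_seq; apply: eq_bigr => a.
by rewrite mem_lower => am; rewrite msub_sub // mulrC.
Qed.

Lemma lower_filter m a : mle a m ->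
  perm_eq (lower a) [seq b <- lower m | mle b a].
Proof.
move=> am; apply: lower_perm => [|b]; first by rewrite filter_uniq ?lower_uniq.
rewrite mem_filter mem_lower; case: (boolP (mle b a)) => //= ba.
exact: mle_trans am.
Qed.

Lemma fps_mulA : associative fps_mul.
Proof.
move=> f g h; apply: funext => m; rewrite /fps_mul; apply: esym.
transitivity (\sum_(a <- lower m) \sum_(b <- lower m | mle b a)
   f b * (g (msub a b) * h (msub m a))).
  rewrite big_seq [RHS]big_seq; apply: eq_bigr => a; rewrite mem_lower => am.
  rewrite big_distrl /= (perm_big _ (lower_filter am)) big_filter.
  by apply: eq_bigr => b _; rewrite mulrA.
rewrite (exchange_big_dep predT) //= big_seq [RHS]big_seq.
apply: eq_bigr => b; rewrite mem_lower => bm.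
rewrite -big_distrr /= -[X in _ * X]big_filter; congr (_ * _).
rewrite (perm_big [seq c + b | c <- lower (msub m b)]) /=; last first.
  apply: uniq_perm; rewrite ?filter_uniq ?lower_uniq //.
    by rewrite map_inj_uniq ?lower_uniq // => x y E; rewrite -(maddK x b) -(maddK y b) E.
  move=> a; rewrite mem_filter mem_lower; apply/andP/mapP => [[ba am]|[c]].
    exists (msub a b); rewrite ?msubK // mem_lower; apply/mleP => l.
    by rewrite !ffunE leq_sub2r //; move/mleP: am.
  rewrite mem_lower => cm ->; rewrite mle_addr; split=> //.
  by rewrite -(msubK bm); apply/mleP => l; rewrite !maddE leq_add2r; move/mleP: cm.
rewrite big_map; apply: eq_bigr => c _; rewrite maddK; congr (_ * h _).
by apply/ffunP => l; rewrite !ffunE [GRing.add _ _]addnC subnDA.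
Qed.

Lemma fps_mul1 : left_id fps_one fps_mul.
Proof.
move=> f; apply: funext => m; rewrite /fps_mul (bigD1_seq 0) ?lower_uniq //=; last first.
  by rewrite mem_lower; apply/mleP => l; rewrite mzeroE.
rewrite big1_seq /fps_one => [|a /andP[/negbTE -> _]]; last by rewrite mul0r.
by rewrite eqxx mul1r addr0; congr f; apply/ffunP => l; rewrite !ffunE subn0.
Qed.

Lemma fps_mulD : left_distributive fps_mul fps_add.
Proof.
move=> f g h; apply: funext => m; rewrite /fps_mul /fps_add -big_split /=.
by apply: eq_bigr => a _; rewrite mulrDl.
Qed.

Lemma fps_1neq0 : fps_one != fps_zero :> fps L.
Proof.
by apply/eqP => /(congr1 (@^~ 0)) /eqP; rewrite /fps_one eqxx /fps_zero oner_eq0.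
Qed.
End Series.

HB.instance Definition _ (L : finType) := gen_eqMixin (fps L).
HB.instance Definition _ (L : finType) := gen_choiceMixin (fps L).
HB.instance Definition _ (L : finType) := GRing.isZmodule.Build (fps L)
  (@fps_addA L) (@fps_addC L) (@fps_add0 L) (@fps_addN L).
HB.instance Definition _ (L : finType) := GRing.Zmodule_isComNzRing.Build (fps L)
  (@fps_mulA L) (@fps_mulC L) (@fps_mul1 L) (@fps_mulD L) (@fps_1neq0 L).


Section SeriesTheory.
Variable L : finType.
Implicit Types (f g h : fps L) (a b m : {ffun L -> nat}).

Lemma fpsDE f g m : (f + g) m = f m + g m. Proof. by []. Qed.
Lemma fpsNE f m : (- f) m = - f m. Proof. by []. Qed.
Lemma fpsBE f g m : (f - g) m = f m - g m. Proof. by []. Qed.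
Lemma fps1E m : (1 : fps L) m = (m == 0)%:R. Proof. by []. Qed.
Lemma fpsME f g m : (f * g) m = \sum_(a <- lower m) f a * g (msub m a).
Proof. by []. Qed.

Lemma fps_sumE (I : Type) (r : seq I) (P : pred I) (F : I -> fps L) m :
  (\sum_(i <- r | P i) F i) m = \sum_(i <- r | P i) F i m.
Proof. by elim/big_rec2: _ => [|i x y _ <-]. Qed.

Definition fmon b : fps L := fun m => (m == b)%:R.
Definition fcst (c : CC) : fps L := fun m => if m == 0 then c else 0.

Lemma fmonME b f m : (fmon b * f) m = if mle b m then f (msub m b) else 0.
Proof.
rewrite fpsME; case: ifP => bm.
  rewrite (bigD1_seq b) ?lower_uniq ?mem_lower //= big1 /fmon => [|a /negbTE ->].
    by rewrite eqxx mul1r addr0.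
  by rewrite mul0r.
rewrite big1_seq // => a /andP[_]; rewrite mem_lower /fmon.
by case: eqVneq => [->|_ _]; rewrite ?bm // mul0r.
Qed.

Lemma fcstME c f m : (fcst c * f) m = c * f m.
Proof.
rewrite fpsME (bigD1_seq 0) ?lower_uniq ?mem_lower //=; last first.
  by apply/mleP => l; rewrite mzeroE.
rewrite big1 /fcst => [|a /negbTE ->]; last by rewrite mul0r.
by rewrite eqxx addr0; congr (_ * f _); apply/ffunP => l; rewrite !ffunE subn0.
Qed.

Lemma fmonM a b : fmon a * fmon b = fmon (a + b).
Proof.
apply: funext => m; rewrite fmonME /fmon; case: ifP => am.
  congr (_ %:R); congr (nat_of_bool _); apply/eqP/eqP => [<-|->].
    by rewrite addrC msubK.
  by rewrite addrC maddK.
by case: eqVneq am => // ->; rewrite mle_addl.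
Qed.

Lemma fcst1 : fcst 1 = 1.
Proof. by apply: funext => m; rewrite /fcst fps1E; case: eqP. Qed.
Lemma fcst0 : fcst 0 = 0.
Proof. by apply: funext => m; rewrite /fcst; case: eqP. Qed.
Lemma fcstN c : fcst (- c) = - fcst c.
Proof. by apply: funext => m; rewrite /fcst fpsNE; case: eqP; rewrite ?oppr0. Qed.
Lemma fcstM c c' : fcst c * fcst c' = fcst (c * c').
Proof. by apply: funext => m; rewrite fcstME /fcst; case: eqP; rewrite ?mulr0. Qed.

Lemma lower_prod (R : comNzRingType) (F : L -> nat -> R) m :
  \sum_(a <- lower m) \prod_l F l (a l) = \prod_l \sum_(k < (m l).+1) F l k.
Proof.
transitivity (\prod_l \sum_(k < (deg m).+1 | (k <= m l)%N) F l k); last first.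
  apply: eq_bigr => l _; rewrite [RHS](big_ord_widen (deg m).+1) ?ltnS ?leq_deg //.
rewrite (bigA_distr_big_dep _ (fun l (k : 'I_(deg m).+1) => F l k)) big_map big_enum /=.
apply: eq_big => [x|x _]; last by apply: eq_bigr => l _; rewrite ffunE.
by rewrite inE; apply/mleP/familyP => H l; have := H l; rewrite ffunE.
Qed.

(** The norm on [CC] takes values in [CC]; this is the same number in the ordered field [RR]. *)
Definition cn (z : CC) : RR := complex.Re `|z|.

Lemma cnE z : (cn z)%:C%C = `|z|.
Proof. by rewrite /cn RRe_real // normr_real. Qed.
Lemma cn_ge0 z : 0 <= cn z.
Proof. by rewrite -lecR cnE normr_ge0. Qed.
Lemma cn0 : cn 0 = 0. Proof. by apply: complexI; rewrite cnE normr0. Qed.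
Lemma cn1 : cn 1 = 1. Proof. by apply: complexI; rewrite cnE normr1. Qed.
Lemma cnN z : cn (- z) = cn z. Proof. by apply: complexI; rewrite !cnE normrN. Qed.
Lemma cnM z t : cn (z * t) = cn z * cn t.
Proof. by apply: complexI; rewrite rmorphM /= !cnE normrM. Qed.
Lemma cnD z t : cn (z + t) <= cn z + cn t.
Proof. by rewrite -lecR rmorphD /= !cnE ler_normD. Qed.
Lemma cn_sum (I : Type) (r : seq I) (P : pred I) (F : I -> CC) :
  cn (\sum_(i <- r | P i) F i) <= \sum_(i <- r | P i) cn (F i).
Proof.
elim/big_rec2: _ => [|i x y _ H]; first by rewrite cn0.
by apply: le_trans (cnD _ _) _; rewrite lerD2l.
Qed.

(** * Coefficient bounds, products and inverses of convergent series *)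

Definition bounded f (r M : RR) := forall m, cn (f m) * r ^+ deg m <= M.
Definition conv f := exists r M : RR, 0 < r /\ bounded f r M.

Lemma bounded_ge0 f r M : bounded f r M -> 0 <= M.
Proof.
by move=> /(_ 0); rewrite deg0 expr0 mulr1; apply: le_trans; apply: cn_ge0.
Qed.

Lemma bounded_le f r r' M : 0 <= r' -> r' <= r -> bounded f r M -> bounded f r' M.
Proof.
move=> r0 rr B m; apply: le_trans (B m); apply: ler_wpM2l; first exact: cn_ge0.
by apply: lerXn2r => //; rewrite nnegrE // (le_trans r0 rr).
Qed.

Lemma conv2 f g : conv f -> conv g ->
  exists r M N, [/\ 0 < r, bounded f r M & bounded g r N].
Proof.
move=> [r [M [r0 B]]] [s [N [s0 C]]]; exists (Num.min r s), M, N.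
have m0 : 0 < Num.min r s by rewrite lt_min r0 s0.
by split=> //; [apply: (bounded_le _ _ B) | apply: (bounded_le _ _ C)];
  rewrite ?(ltW m0) // ge_min lexx ?orbT.
Qed.

Lemma convD f g : conv f -> conv g -> conv (f + g).
Proof.
move=> cf cg; have [r [M [N [r0 B C]]]] := conv2 cf cg.
exists r, (M + N); split=> // m; apply: le_trans (lerD (B m) (C m)).
rewrite -mulrDl; apply: ler_wpM2r; first by rewrite exprn_ge0 // ltW.
exact: cnD.
Qed.

Lemma conv_dom f g : conv f -> (forall m, cn (g m) <= cn (f m)) -> conv g.
Proof.
move=> [r [M [r0 B]]] H; exists r, M; split => // m; apply: le_trans (B m).
by apply: ler_wpM2r; rewrite ?exprn_ge0 // ltW.
Qed.

Lemma convN f : conv f -> conv (- f).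
Proof. by move=> /conv_dom; apply=> m; rewrite fpsNE cnN. Qed.

Lemma convB f g : conv f -> conv g -> conv (f - g).
Proof. by move=> cf cg; apply: convD => //; apply: convN. Qed.

Lemma conv_fin f (N : nat) : (forall m, f m != 0 -> (deg m < N)%N) -> conv f.
Proof.
move=> H; exists 1, (\sum_(x : {ffun L -> 'I_N}) cn (f (ofbox x))); split=> // m.
rewrite expr1n mulr1.
have [->|nz] := eqVneq (f m) 0.
  by rewrite cn0; apply: sumr_ge0 => x _; apply: cn_ge0.
have [|x ->] := @ofboxP _ N m.
  by move=> l; apply: leq_ltn_trans (H m nz); apply: leq_deg.
by rewrite (bigD1 x) //= lerDl; apply: sumr_ge0 => y _; apply: cn_ge0.
Qed.

Lemma conv_fmon b : conv (fmon b).
Proof.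
apply: (@conv_fin _ (deg b).+1) => m; rewrite /fmon.
by case: (eqVneq m b) => [->|_] //; rewrite eqxx.
Qed.

Lemma conv_fcst c : conv (fcst c).
Proof.
apply: (@conv_fin _ 1) => m; rewrite /fcst.
by case: (eqVneq m 0) => [->|_]; rewrite ?deg0 ?eqxx.
Qed.

Lemma conv1 : conv 1. Proof. exact: conv_fmon. Qed.
Lemma conv0 : conv 0. Proof. by apply: (@conv_fin _ 0) => m /eqP. Qed.

Lemma conv_sum (I : Type) (r : seq I) (P : pred I) (F : I -> fps L) :
  (forall i, P i -> conv (F i)) -> conv (\sum_(i <- r | P i) F i).
Proof. by move=> H; elim/big_ind: _ => //; [exact: conv0 | exact: convD]. Qed.

Lemma sumr_const_seq (R : nmodType) (T : Type) (s : seq T) (c : R) :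
  \sum_(a <- s) c = c *+ size s.
Proof. by elim: s => [|a s IH]; rewrite ?big_nil ?big_cons ?IH ?mulrS. Qed.

Lemma size_lower m : (size (lower m) <= 2 ^ deg m)%N.
Proof.
rewrite -(ler_nat RR) natrX.
have -> : (size (lower m))%:R = \sum_(a <- lower m) \prod_(l : L) (1 : RR).
  by rewrite sumr_const_seq big1.
rewrite (lower_prod (fun _ _ => 1)) /deg -prodrXr; apply: ler_prod => l _.
rewrite sumr_const card_ord ler0n -natrX ler_nat /=; exact: ltn_expl.
Qed.

Lemma degB m a : mle a m -> (deg m = deg a + deg (msub m a))%N.
Proof. by move=> am; rewrite -{1}(msubK am) degD addnC. Qed.

(** A coefficient of the product in degree [k] has at most [2 ^ k] summands, each at most
    [M * N / r ^ k]; halving the radius absorbs their number. *)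
Lemma convM f g : conv f -> conv g -> conv (f * g).
Proof.
move=> cf cg; have [r [M [N [r0 B C]]]] := conv2 cf cg.
exists (r / 2), (M * N); split=> [|m]; first by rewrite divr_gt0.
have P k : 0 <= r ^+ k by rewrite exprn_ge0 // ltW.
rewrite expr_div_n mulrA ler_pdivrMr ?exprn_gt0 //.
apply: (@le_trans _ _ (\sum_(a <- lower m) M * N)).
  apply: (@le_trans _ _ (\sum_(a <- lower m) cn (f a * g (msub m a)) * r ^+ deg m)).
    by rewrite -mulr_suml ler_wpM2r // fpsME cn_sum.
  rewrite big_seq [leRHS]big_seq; apply: ler_sum => a; rewrite mem_lower => am.
  rewrite cnM (degB am) exprD mulrACA.
  by apply: ler_pM => //; rewrite mulr_ge0 // cn_ge0.
rewrite sumr_const_seq -[leLHS]mulr_natr ler_wpM2l //.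
  by rewrite mulr_ge0 ?(bounded_ge0 B) ?(bounded_ge0 C).
by rewrite -natrX ler_nat size_lower.
Qed.

Lemma conv_shift f b : conv f -> conv (fun m => f (m + b)).
Proof.
move=> [r [M [r0 B]]]; exists r, (M / r ^+ deg b); split=> // m.
by rewrite ler_pdivlMr ?exprn_gt0 // -mulrA -exprD -degD.
Qed.

(** The product of the geometric series in all variables, truncated at [a0] and written without
    division. *)
Lemma geom_le (q : RR) (a0 : {ffun L -> nat}) : 0 <= q -> q < 1 ->
  (1 - q) ^+ #|L| * \sum_(a <- lower a0) q ^+ deg a <= 1.
Proof.
move=> q0 q1.
have -> : \sum_(a <- lower a0) q ^+ deg a = \sum_(a <- lower a0) \prod_l q ^+ a l.
  by apply: eq_bigr => a _; rewrite prodrXr.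
rewrite (lower_prod (fun _ k => q ^+ k)) -prodr_const -big_split /=.
apply: prodr_ile1 => l _.
have -> : (1 - q) * \sum_(k < (a0 l).+1) q ^+ k = 1 - q ^+ (a0 l).+1.
  by rewrite -[1 - q]opprB mulNr -subrX1 opprB.
have : 0 <= q ^+ (a0 l).+1 <= 1 by rewrite exprn_ge0 //= exprn_ile1 // ltW.
lra.
Qed.

Lemma bernoulli (q : RR) n : 0 <= q -> q <= 1 -> 1 - n%:R * q <= (1 - q) ^+ n.
Proof.
move=> q0 q1; elim: n => [|n IH]; first by rewrite expr0 mul0r subr0.
rewrite exprS; apply: le_trans (_ : (1 - q) * (1 - n%:R * q) <= _); last first.
  by rewrite ler_wpM2l // subr_ge0.
have : 0 <= n%:R * (q * q) by rewrite mulr_ge0 // mulr_ge0.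
rewrite -[n.+1%:R]natr1; lra.
Qed.

(* The Neumann series: [neumann h k] agrees with the inverse of [1 - h] in degrees <= k. *)
Definition neumann h (k : nat) : fps L := iter k (fun g => 1 + h * g) 1.

Lemma neumann_stable h k m : h 0 = 0 -> (deg m <= k)%N ->
  neumann h k.+1 m = neumann h k m.
Proof.
move=> h0; elim: k m => [|k IH] m.
  rewrite leqn0 deg_eq0 => /eqP ->; rewrite /= fpsDE fpsME (perm_big _ (lower0 L)).
  by rewrite big_seq1 h0 mul0r addr0.
move=> mk; rewrite [LHS]/= [RHS]/= !fpsDE; congr (_ + _); rewrite !fpsME.
rewrite big_seq [RHS]big_seq; apply: eq_bigr => a; rewrite mem_lower => am.
have [->|na] := eqVneq a 0; first by rewrite h0 !mul0r.
congr (_ * _); apply: IH; rewrite -ltnS; apply: leq_trans mk.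
by rewrite [X in (_ < X)%N](degB am) -[X in (X < _)%N]add0n ltn_add2r lt0n deg_eq0.
Qed.

Lemma neumann_stable_leq h k m : h 0 = 0 -> (deg m <= k)%N ->
  neumann h k m = neumann h (deg m) m.
Proof.
move=> h0 /subnKC <-; elim: (k - deg m)%N => [|j IH]; first by rewrite addn0.
by rewrite addnS neumann_stable // leq_addr.
Qed.

(** On a small enough polydisc the coefficients of [h] have absolute sum at most 1/2, so the Neumann
    iterates are bounded uniformly in [k]; every coefficient of the inverse is a coefficient of one
    of them. *)
Lemma fps_inv h : conv h -> h 0 = 0 -> exists2 g, conv g & (1 - h) * g = 1.
Proof.
move=> [r [M [r0 B]]] h0; exists (fun m => neumann h (deg m) m); last first.
  apply: funext => m; set g := (fun m => _) : fps L.
  have -> : (1 - h) * g = g - h * g by ring.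
  rewrite fpsBE /g -(neumann_stable h0 (leqnn _)) /= fpsDE.
  suff -> : (h * neumann h (deg m)) m = (h * g) m by rewrite addrK.
  rewrite !fpsME big_seq [RHS]big_seq; apply: eq_bigr => a; rewrite mem_lower => am.
  by rewrite neumann_stable_leq // mle_deg // mle_sub.
have M0 := bounded_ge0 B.
(* By Bernoulli [(1 - q) ^ #|L|] is at least [1 - dl], so the powers of [q] over all nonzero
   multi-indices sum to at most [dl / (1 - dl) = 1 / (2 * M + 2)]; times [M] this is at most 1/2. *)
pose dl : RR := (2 * M + 3)^-1; pose q : RR := dl / (#|L|.+1)%:R.
have dl0 : 0 < dl by rewrite invr_gt0; lra.
have dlM : dl * (2 * M + 3) = 1 by rewrite mulVf //; lra.
have n0 : 0 < (#|L|.+1)%:R :> RR by rewrite ltr0n.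
have q0 : 0 < q by rewrite divr_gt0.
have qn : q * #|L|%:R <= dl.
  rewrite /q -mulrA -[leRHS]mulr1 ler_pM2l // mulrC ler_pdivrMr // mul1r ler_nat //.
have dl1 : dl <= 1 / 3.
  have : 0 <= dl * M by rewrite mulr_ge0 // ltW.
  lra.
have qdl : q <= dl.
  by rewrite /q ler_pdivrMr // -[leLHS]mulr1 ler_pM2l // ler1n.
have small m : \sum_(a <- lower m | a != 0) cn (h a) * (r * q) ^+ deg a <= 1 / 2.
  apply: (@le_trans _ _ (M * \sum_(a <- lower m | a != 0) q ^+ deg a)).
    rewrite mulr_sumr; apply: ler_sum => a _.
    by rewrite exprMn mulrA ler_wpM2r // exprn_ge0 // ltW.
  have q1 : q < 1 by lra.
  have := geom_le m (ltW q0) q1; rewrite (bigD1_seq 0) ?lower_uniq ?mem_lower //=; last first.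
    by apply/mleP => l; rewrite mzeroE.
  rewrite deg0 expr0; set S := \sum_(a <- _ | _) _ => le1.
  have S0 : 0 <= S by apply: sumr_ge0 => a _; rewrite exprn_ge0 // ltW.
  have b1 := @bernoulli q #|L| (ltW q0) (ltW q1).
  have le2 : (1 - dl) * (1 + S) <= 1.
    apply: le_trans le1; apply: ler_wpM2r; first lra.
    apply: le_trans b1; rewrite mulrC; lra.
  have le3 : (2 * M + 3) * ((1 - dl) * (1 + S)) <= 2 * M + 3.
    by rewrite -[leRHS]mulr1; apply: ler_wpM2l => //; lra.
  have E : (2 * M + 3) * ((1 - dl) * (1 + S)) = (2 * M + 3 - dl * (2 * M + 3)) * (1 + S).
    ring.
  rewrite E dlM in le3; nra.
exists (r * q), 2; split; first by rewrite mulr_gt0.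
(* The bound 2 reproduces itself under [g |-> 1 + h * g], because [1 + 2 / 2 = 2]. *)
move=> m; have : forall k, bounded (neumann h k) (r * q) 2.
  elim=> [|k IH] b.
    rewrite /= fps1E; case: eqP => [->|_]; first by rewrite cn1 deg0 expr0 mulr1 ler1n.
    by rewrite cn0 mul0r.
  rewrite /= fpsDE; set p := (r * q) ^+ deg b.
  have p0 : 0 <= p by rewrite exprn_ge0 // mulr_ge0 // ltW.
  apply: (@le_trans _ _ (cn ((1 : fps L) b) * p + cn ((h * neumann h k) b) * p)).
    by rewrite -mulrDl ler_wpM2r // cnD.
  have A1 : cn ((1 : fps L) b) * p <= 1.
    rewrite fps1E /p; case: eqP => [->|_]; first by rewrite cn1 deg0 expr0 mulr1.
    by rewrite cn0 mul0r.
  suff : cn ((h * neumann h k) b) * p <= 1 by lra.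
  apply: (@le_trans _ _ (2 * \sum_(a <- lower b | a != 0) cn (h a) * (r * q) ^+ deg a)).
    rewrite fpsME (bigD1_seq 0) ?lower_uniq ?mem_lower //=; last first.
      by apply/mleP => l; rewrite mzeroE.
    rewrite h0 mul0r add0r; apply: (@le_trans _ _ ((\sum_(a <- lower b | a != 0)
       cn (h a * neumann h k (msub b a))) * p)).
      by rewrite ler_wpM2r // cn_sum.
    rewrite mulr_suml mulr_sumr big_seq_cond [leRHS]big_seq_cond.
    apply: ler_sum => a /andP[]; rewrite mem_lower => am _.
    rewrite cnM /p (degB am) exprD mulrACA mulrC; apply: ler_wpM2r; last exact: IH.
    by rewrite mulr_ge0 ?cn_ge0 // exprn_ge0 // mulr_ge0 // ltW.
  by have := small b; lra.
by apply.
Qed.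

End SeriesTheory.

(** * Consequences of the minors condition *)

Section Minors.
Variables (V : finType) (e : rel V) (c : V -> V -> nat -> CC).
Hypothesis minors : minors_cond e c.

Lemma set_enum_ord (A : {set V}) n : #|A| = n -> exists s : 'I_n -> V,
  [/\ injective s, forall a, s a \in A, forall u, u \in A -> exists a, u = s a &
      forall phi : V -> CC, \sum_(u in A) phi u = \sum_a phi (s a)].
Proof.
move=> <-; exists enum_val; split.
- exact: enum_val_inj.
- exact: enum_valP.
- by move=> u uA; exists (enum_rank_in uA u); rewrite enum_rankK_in.
- by move=> phi; rewrite big_enum_val.
Qed.

Section Node.
Variables (v : V).
Hypothesis nv : is_node e v.
Local Notation I := 'I_(valency e v - 2).

Lemma minors_unit u0 u2 : e v u0 -> e v u2 -> u0 != u2 ->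
  exists s : I -> V, [/\ forall a, [&& e v (s a), s a != u0 & s a != u2],
   forall u, e v u -> u != u0 -> u != u2 -> exists a, u = s a,
   forall phi : V -> CC, \sum_(u | [&& e v u, u != u0 & u != u2]) phi u =
     \sum_a phi (s a),
   injective s &
   (\matrix_(a, b) c v (s a) (nat_of_ord b) : 'M_(valency e v - 2)) \in unitmx].
Proof.
move=> e0 e2 n02; pose A := [set u | [&& e v u, u != u0 & u != u2]].
have cA : #|A| = (valency e v - 2)%N.
  have := cardsD1 u0 [set u | e v u]; have := cardsD1 u2 ([set u | e v u] :\ u0).
  rewrite !inE e0 e2 eq_sym n02 /= /valency.
  have -> : [set u | e v u] :\ u0 :\ u2 = A; last by lia.
  by apply/setP => u; rewrite !inE; case: (e v u); case: (u != u0); case: (u != u2).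
have [s [si sA sE sS]] := set_enum_ord cA; exists s; split => //.
- by move=> a; have := sA a; rewrite inE.
- by move=> u eu n0 n2; apply: sE; rewrite inE eu n0.
- by move=> phi; rewrite -sS; apply: eq_bigl => u; rewrite inE.
- by rewrite unitmxE unitfE; apply: minors => // a; have := sA a; rewrite inE => /and3P[].
Qed.

Lemma minors_row u0 u2 (y : V -> CC) : e v u0 -> e v u2 -> u0 != u2 ->
  exists b : I -> CC, forall u, e v u -> u != u0 -> u != u2 ->
    \sum_i b i * c v u i = y u.
Proof.
move=> e0 e2 n02; have [s [_ sE _ _]] := minors_unit e0 e2 n02.
set M := \matrix_(_, _) _ => Mu.
exists (fun i => (invmx M *m \col_a y (s a)) i 0) => u eu n0 n2.
have [a ->] := sE u eu n0 n2.
have := congr1 (fun N : 'cV_ _ => N a 0) (mulKVmx Mu (\col_a y (s a))).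
by rewrite !mxE => <-; apply: eq_bigr => i _; rewrite !mxE mulrC.
Qed.

Lemma minors_col u0 u2 (b : I -> CC) : e v u0 -> e v u2 -> u0 != u2 ->
  exists y : V -> CC,
    forall i : I, \sum_(u | [&& e v u, u != u0 & u != u2]) c v u i * y u = b i.
Proof.
move=> e0 e2 n02; have [s [_ _ sS si]] := minors_unit e0 e2 n02.
set M := \matrix_(_, _) _ => Mu.
pose x := (\row_i b i) *m invmx M.
pose y u := if [pick a | s a == u] is Some a then x 0 a else 0.
exists y => i; rewrite sS.
have := congr1 (fun N : 'rV_ _ => N 0 i) (mulmxKV Mu (\row_i b i)).
rewrite !mxE => <-; apply: eq_bigr => a _; rewrite /M [(\matrix_(_, _) _) _ _]mxE mulrC.
congr (_ * _); rewrite /y; case: pickP => [a' /eqP /si -> //|/(_ a)].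
by rewrite eqxx.
Qed.

Lemma minors_inj u0 u2 (y : V -> CC) : e v u0 -> e v u2 -> u0 != u2 ->
  (forall i : I, \sum_(u | [&& e v u, u != u0 & u != u2]) c v u i * y u = 0) ->
  forall u, e v u -> u != u0 -> u != u2 -> y u = 0.
Proof.
move=> e0 e2 n02; have [s [_ sE sS si]] := minors_unit e0 e2 n02.
set M := \matrix_(_, _) _ => Mu y0 u eu n0 n2.
have [a ->] := sE u eu n0 n2.
have E : (\row_a y (s a)) *m M = 0.
  apply/rowP => i; rewrite !mxE -[RHS](y0 i) sS; apply: eq_bigr => j _.
  by rewrite !mxE mulrC.
have := mulmxK Mu (\row_a y (s a)); rewrite E mul0mx => /rowP/(_ a).
by rewrite !mxE => <-.
Qed.

Lemma other_neighbour u0 : exists2 u2, e v u2 & u2 != u0.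
Proof.
have : (0 < #|[set u | e v u] :\ u0|)%N.
  have := cardsD1 u0 [set u | e v u]; move: nv; rewrite /is_node /valency.
  by case: (_ \in _) => /=; lia.
by case/card_gt0P => u; rewrite !inE => /andP[n eu]; exists u.
Qed.

Lemma minors_surj u0 (b : I -> CC) : e v u0 -> exists y : V -> CC,
  forall i : I, \sum_(u | e v u && (u != u0)) c v u i * y u = b i.
Proof.
move=> e0; have [u2 e2 n20] := other_neighbour u0.
have n02 : u0 != u2 by rewrite eq_sym.
have [y yE] := minors_col b e0 e2 n02.
exists (fun u => if u == u2 then 0 else y u) => i.
rewrite (bigD1 u2) ?e2 //= eqxx mulr0 add0r -yE.
apply: eq_big => [u|u /andP[_ /negbTE ->] //]; first by rewrite andbA.
Qed.

(** Normalise one coordinate to 1 and solve for the others with the minor omitting it and [u0]. If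
    another coordinate vanished, the vector would be killed by the minor omitting that one and [u0],
    and the coordinate 1 would be 0. *)
Lemma minors_kernel u0 : e v u0 -> exists k : V -> CC,
  (forall u, e v u -> u != u0 -> k u != 0) /\
  forall i : I, \sum_(u | e v u && (u != u0)) c v u i * k u = 0.
Proof.
move=> e0; have [u2 e2 n20] := other_neighbour u0.
have n02 : u0 != u2 by rewrite eq_sym.
have [y yE] := minors_col (fun i => - c v u2 i) e0 e2 n02.
pose k u := if u == u2 then 1 else y u.
have kE (i : I) : \sum_(u | e v u && (u != u0)) c v u i * k u = 0.
  rewrite (bigD1 u2) ?e2 //= /k eqxx mulr1; apply/eqP; rewrite addrC addr_eq0.
  apply/eqP; rewrite -(yE i); apply: eq_big => [u|u /andP[_ /negbTE ->] //]; first by rewrite andbA.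
exists k; split=> // u eu nu0; apply/eqP => ku.
have nu2 : u2 != u.
  by apply: contraNneq (oner_neq0 CC) => E; rewrite -ku /k -E eqxx.
have n0u : u0 != u by rewrite eq_sym.
have k0 (i : I) : \sum_(x | [&& e v x, x != u0 & x != u]) c v x i * k x = 0.
  rewrite -[RHS](kE i) [in RHS](bigD1 u) ?eu //= ku mulr0 add0r.
  by apply: eq_bigl => x; rewrite andbA.
have := minors_inj e0 eu n0u k0 e2 n20 nu2.
by rewrite /k eqxx => /eqP; rewrite oner_eq0.
Qed.

End Node.
End Minors.

(** * Ideals and Nakayama's lemma *)

Section Ideals.
Variable L : finType.
Implicit Types (f g h : fps L) (a b m : {ffun L -> nat}).

Definition ideal (J : fps L -> Prop) := [/\ J 0,
  forall f g, J f -> J g -> J (f + g) & forall h f, conv h -> J f -> J (h * f)].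

Section IdealTheory.
Variable J : fps L -> Prop.
Hypothesis Jid : ideal J.

Lemma ideal0 : J 0. Proof. by case: Jid. Qed.
Lemma idealD f g : J f -> J g -> J (f + g). Proof. by case: Jid => _ H _; apply: H. Qed.
Lemma idealM h f : conv h -> J f -> J (h * f). Proof. by case: Jid => _ _; apply. Qed.
Lemma idealN f : J f -> J (- f).
Proof. by move=> Jf; rewrite -mulN1r; apply: idealM => //; apply: convN; apply: conv1. Qed.
Lemma idealB f g : J f -> J g -> J (f - g).
Proof. by move=> Jf Jg; apply: idealD => //; apply: idealN. Qed.
Lemma ideal_sum (I : Type) (r : seq I) (P : pred I) (F : I -> fps L) :
  (forall i, P i -> J (F i)) -> J (\sum_(i <- r | P i) F i).
Proof. by move=> H; elim/big_ind: _ => //; [exact: ideal0 | exact: idealD]. Qed.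

Lemma coefM0 f g : (f * g) 0 = f 0 * g 0.
Proof.
rewrite fpsME (perm_big _ (lower0 L)) big_seq1; congr (_ * g _).
by apply/ffunP => l; rewrite !ffunE.
Qed.

(* Nakayama's lemma: eliminate the generators one after the other, dividing by
   [1 - A k] whose constant term is 1; the grading keeps the system triangular
   modulo the maximal ideal. *)
Lemma nakayama (s : seq {ffun L -> nat}) (wt : {ffun L -> nat} -> nat) :
  (forall i, i \in s -> exists A : {ffun L -> nat} -> fps L,
     (forall l, l \in s -> conv (A l) /\ (A l 0 != 0 -> (wt i < wt l)%N)) /\
     J (fmon i - \sum_(l <- s) A l * fmon l)) ->
  forall i, i \in s -> J (fmon i).
Proof.
elim: s => // k s IH H.
have [A [Ac JA]] := H k (mem_head _ _).
have [cAk Ak] := Ac k (mem_head _ _).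
have Ak0 : A k 0 = 0 by apply/eqP; apply: contraFT (ltnn (wt k)).
have [U cU UE] := fps_inv cAk Ak0.
have JU : J (fmon k - \sum_(l <- s) (U * A l) * fmon l).
  have -> : fmon k - \sum_(l <- s) (U * A l) * fmon l =
      U * (fmon k - \sum_(l <- k :: s) A l * fmon l).
    rewrite big_cons -[X in X - _ = _]mul1r -UE.
    rewrite (_ : \sum_(l <- s) _ = U * \sum_(l <- s) A l * fmon l); first ring.
    by rewrite mulr_sumr; apply: eq_bigr => l _; rewrite mulrA.
  exact: idealM.
have Js : forall i, i \in s -> J (fmon i).
  apply: IH => i si; have sik : i \in k :: s by rewrite inE si orbT.
  have [B [Bc JB]] := H i sik; exists (fun l => B l + B k * (U * A l)).
  have [cBk Bk] := Bc k (mem_head _ _); split=> [l sl|].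
    have slk : l \in k :: s by rewrite inE sl orbT.
    have [cBl Bl] := Bc l slk; have [cAl Al] := Ac l slk; split.
      by apply: convD => //; apply: convM => //; apply: convM.
    rewrite fpsDE !coefM0; have [B0|/Bl //] := eqVneq (B l 0) 0.
    rewrite B0 add0r !mulf_eq0 !negb_or => /and3P[/Bk H1 _ /Al H2].
    exact: ltn_trans H2.
  have -> : fmon i - \sum_(l <- s) (B l + B k * (U * A l)) * fmon l =
     (fmon i - \sum_(l <- k :: s) B l * fmon l) +
     B k * (fmon k - \sum_(l <- s) (U * A l) * fmon l).
    rewrite big_cons (_ : \sum_(l <- s) (B l + _) * _ =
      \sum_(l <- s) B l * fmon l + B k * \sum_(l <- s) (U * A l) * fmon l); first ring.
    rewrite mulr_sumr -big_split /=; apply: eq_bigr => l _; ring.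
  by apply: idealD => //; apply: idealM.
move=> i; rewrite inE => /orP[/eqP ->|/Js //].
rewrite -[fmon k](subrK (\sum_(l <- s) (U * A l) * fmon l)); apply: idealD => //.
rewrite big_seq; apply: ideal_sum => l sl; apply: idealM; last exact: Js.
by apply: convM => //; case: (Ac l); rewrite // inE sl orbT.
Qed.

End IdealTheory.

Definition pw (p : L -> nat) m : nat := (\sum_l p l * m l)%N.

Lemma pwD p a b : pw p (a + b) = (pw p a + pw p b)%N.
Proof. by rewrite /pw -big_split; apply: eq_bigr => l _; rewrite maddE mulnDr. Qed.

Definition unitm (l : L) : {ffun L -> nat} := [ffun l' => (l' == l) : nat].

Lemma natrMn (x k : nat) : x *+ k = (x * k)%N.
Proof. by elim: k => [|k IH]; rewrite ?muln0 // mulrS IH mulnS. Qed.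

Lemma pw_unitm p l k : pw p (unitm l *+ k) = (p l * k)%N.
Proof.
rewrite /pw (bigD1 l) //= big1 ?addn0 => [|l' /negbTE nl].
  by rewrite ffunMnE ffunE eqxx natrMn mul1n.
by rewrite ffunMnE ffunE nl natrMn mul0n muln0.
Qed.

Lemma unitmE l k l' : (unitm l *+ k) l' = (if l' == l then k else 0)%N.
Proof.
by rewrite ffunMnE ffunE natrMn; case: eqP; rewrite ?mul1n.
Qed.

Lemma mle_unitm l k m : mle (unitm l *+ k) m = (k <= m l)%N.
Proof.
apply/mleP/idP => [/(_ l)|H l']; first by rewrite unitmE eqxx.
by rewrite unitmE; case: eqP => [->|].
Qed.

Section Weights.
Variable p : L -> nat.
Hypothesis p0 : forall l, (0 < p l)%N.

Lemma leq_pw m l : (m l <= pw p m)%N.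
Proof.
by rewrite /pw (bigD1 l) //= (leq_trans _ (leq_addr _ _)) // leq_pmull.
Qed.

(** Finite because all weights are positive: exponents are bounded by the weight. With [D = 0] it
    lists the monomials kept when truncating at order [P - 1]. *)
Definition slice (D P : nat) : seq {ffun L -> nat} :=
  [seq ofbox x | x <- enum [pred x : {ffun L -> 'I_(D + P)} | (D <= pw p (ofbox x) < D + P)%N]].

Lemma mem_slice D P m : (m \in slice D P) = (D <= pw p m < D + P)%N.
Proof.
apply/mapP/idP => [[x + ->]|H]; first by rewrite mem_enum.
have [|x E] := @ofboxP _ (D + P) m.
  by move=> l; case/andP: H => _; apply: leq_ltn_trans; apply: leq_pw.
by exists x => //; rewrite mem_enum inE -E.
Qed.

Lemma slice_uniq D P : uniq (slice D P).
Proof. by rewrite map_inj_uniq ?enum_uniq //; apply: ofbox_inj. Qed.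

(** Removing one variable at a time lowers the weight by at most [P], so the window from [D] to
    [D + P] cannot be jumped over. *)
Lemma slice_below D P m : (0 < P)%N -> (forall l, (p l <= P)%N) -> (D <= pw p m)%N ->
  exists2 a, a \in slice D P & mle a m.
Proof.
move=> P0 pP; have [n] := ubnP (deg m); elim: n m => // n IH m mn Dm.
have [lt|ge] := ltnP (pw p m) (D + P).
  by exists m; rewrite ?mle_refl // mem_slice Dm.
have /existsP[l ml] : [exists l, (0 < m l)%N].
  apply: contraTT (ge) => /existsPn H; rewrite -ltnNge /pw big1 ?addn_gt0 ?P0 ?orbT // => l _.
  by have := H l; rewrite -eqn0Ngt => /eqP ->; rewrite muln0.
have lm : mle (unitm l *+ 1) m by rewrite mle_unitm.
have pwE : (pw p (msub m (unitm l *+ 1)) + p l = pw p m)%N.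
  by rewrite -[in RHS](msubK lm) pwD pw_unitm muln1.
have [||a sa am] := IH (msub m (unitm l *+ 1)).
- rewrite -ltnS; apply: leq_trans mn; rewrite ltnS [X in (_ < X)%N](degB lm).
  by rewrite -[X in (X < _)%N]add0n ltn_add2r (leq_trans _ (leq_deg _ l)) // unitmE eqxx.
- by have := pP l; lia.
by exists a => //; apply: mle_trans am _; apply: mle_sub.
Qed.

(* A monomial of large weight is divisible by one of the given powers, hence lies in [J] up to
   terms of larger weight, which are combinations of finitely many such monomials. *)
Lemma powers_monomials (J : fps L -> Prop) (K : L -> nat) (F : L -> fps L) : ideal J ->
  (forall l, [/\ J (F l), conv (F l), F l (unitm l *+ K l) = 1 &
     forall m, F l m != 0 -> m != unitm l *+ K l -> (pw p (unitm l *+ K l) < pw p m)%N]) ->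
  exists D, forall m, (D <= pw p m)%N -> J (fmon m).
Proof.
(* Weight at least [D] forces [K l <= m l] for some [l]; the window width [P] is positive and bounds
   every single weight. *)
move=> Jid HF; pose D := (\sum_l p l * K l).+1; pose P := (\sum_l p l).+1.
have pP l : (p l <= P)%N by rewrite /P (bigD1 l) //= -addnS leq_addr.
have sb m := @slice_below D P m isT pP.
pose ch m := head 0 [seq a <- slice D P | mle a m].
have chP m : (D <= pw p m)%N -> ch m \in slice D P /\ mle (ch m) m.
  move=> /sb[a sa am]; have : ch m \in [seq a <- slice D P | mle a m].
    rewrite /ch; have : a \in [seq a <- slice D P | mle a m] by rewrite mem_filter am.
    by case: [seq _ <- _ | _] => // x s _; rewrite mem_head.
  by rewrite mem_filter => /andP[].
have Js : forall i, i \in slice D P -> J (fmon i).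
  apply: (nakayama Jid (wt := pw p)) => i; rewrite mem_slice => /andP[Di _].
  have /existsP[l Kl] : [exists l, (K l <= i l)%N].
    apply: contraTT (Di) => /existsPn H; rewrite -ltnNge ltnS; apply: leq_sum => l _.
    by rewrite leq_mul2l ltnW ?orbT // ltnNge.
  have [JF cF F1 Fm] := HF l; pose b := unitm l *+ K l.
  have bi : mle b i by rewrite mle_unitm.
  pose R := fmon i - fmon (msub i b) * F l.
  have cR : conv R.
    by apply: convB; [|apply: convM]; rewrite ?cF //; apply: conv_fmon.
  have Rm m : R m != 0 -> (pw p i < pw p m)%N.
    rewrite /R fpsBE fmonME /fmon; case: ifP => im; last first.
      rewrite subr0; case: (eqVneq m i) im => [->|]; last by rewrite eqxx.
      by rewrite mle_sub.
    have [E|nE] := eqVneq (msub m (msub i b)) b.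
      have mi : m = i by rewrite -(msubK im) E addrC msubK.
      by rewrite E F1 mi eqxx subrr eqxx.
    have -> : (m == i) = false.
      by apply/negbTE; apply: contra nE => /eqP ->; rewrite msub_sub.
    rewrite sub0r oppr_eq0 => /Fm/(_ nE) lt.
    have Em : (pw p (msub m (msub i b)) + pw p (msub i b) = pw p m)%N by rewrite -pwD msubK.
    have Ei : (pw p (msub i b) + pw p b = pw p i)%N by rewrite -pwD msubK.
    by rewrite -/b in lt; lia.
  (* Every monomial of [R] is assigned to the one divisor in the window chosen by [ch]; [A a]
     collects those assigned to [a], divided by [z^a]. It is dominated by a shift of [R], hence
     converges. *)
  pose A a : fps L := fun m => if ch (m + a) == a then R (m + a) else 0.
  exists A; rewrite /A; split=> [a sa|].
    split; first by apply: conv_dom (conv_shift a cR) _ => m; case: ifP => // _;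
      rewrite cn0 cn_ge0.
    by rewrite add0r; case: ifP => [_|]; [exact: Rm | rewrite eqxx].
  suff -> : \sum_(a <- slice D P) A a * fmon a = R.
    rewrite /R opprB addrC subrK; apply: (idealM Jid) => //; exact: conv_fmon.
  apply: funext => m; rewrite fps_sumE.
  have E a : (A a * fmon a) m =
      if mle a m && (ch m == a) then R m else 0.
    by rewrite mulrC fmonME /A; case: ifP => //= am; rewrite msubK.
  rewrite (eq_bigr _ (fun a _ => E a)).
  have [Dm|mD] := leqP D (pw p m).
    have [sc cm] := chP m Dm.
    rewrite (bigD1_seq (ch m)) ?slice_uniq //= cm eqxx big1 ?addr0 // => a na.
    by rewrite [ch m == a]eq_sym (negbTE na) andbF.
  rewrite big1 => [|a _].
    by apply/esym/eqP; apply: contraTT (mD) => /Rm; rewrite -leqNgt; lia.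
  by case: ifP => // _; apply/eqP; apply: contraTT (mD) => /Rm; rewrite -leqNgt; lia.
exists D => m Dm; have [sc cm] := chP m Dm.
by rewrite -(msubK cm) -fmonM; apply: (idealM Jid); [apply: conv_fmon | apply: Js].
Qed.

End Weights.
End Ideals.

(** * Initial monomials *)

Section Link.
Variables (V : finType) (e : rel V).
Local Notation L := (leaf_t e).
Implicit Types (f g h : fps L) (m : {ffun L -> nat}) (w : L -> RR) (P : fps L -> Prop).

Lemma smulE f g : smul f g = f * g.
Proof.
apply: funext => m; rewrite /smul fpsME big_map big_enum /=.
apply: eq_big => [x|x _].
  by rewrite inE /mle; apply: eq_forallb => l; rewrite ffunE.
by congr (_ * g _); apply/ffunP => l; rewrite !ffunE.
Qed.

Lemma convE f : convergent f <-> conv f.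
Proof.
have E r m : (`|f m| * r%:C%C ^+ msize m)= (cn (f m) * r ^+ deg m)%:C%C.
  by rewrite rmorphM rmorphXn /= cnE.
by split=> -[r [M [r0 B]]]; exists r, M; split=> // m; have := B m; rewrite E lecR.
Qed.

Lemma monomialE m : monomial m = fmon m.
Proof. by apply: funext => a; rewrite /monomial /fmon; case: eqP. Qed.

Lemma in_ideal_genP P f : in_ideal_gen P f <->
  exists k (h g : 'I_k -> fps L), (forall j, conv (h j) /\ P (g j)) /\
    f = \sum_(j < k) h j * g j.
Proof.
split=> -[k [h [g [H fE]]]]; exists k, h, g; split.
- by move=> j; have [/convE] := H j.
- apply: funext => m; rewrite fE fps_sumE; apply: eq_bigr => j _; by rewrite smulE.
- by move=> j; have [/convE] := H j.
- move=> m; rewrite fE fps_sumE; apply: eq_bigr => j _; by rewrite smulE.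
Qed.

Lemma in_ideal_gen_mem P f : P f -> in_ideal_gen P f.
Proof.
move=> Pf; apply/in_ideal_genP; exists 1%N, (fun=> 1), (fun=> f); split=> [j|].
  by split=> //; apply: conv1.
by rewrite big_ord1 mul1r.
Qed.

Lemma in_ideal_gen_ideal P : ideal (in_ideal_gen P).
Proof.
split.
- apply/in_ideal_genP; exists 0%N, (fun=> 0), (fun=> 0).
  by split=> [[]//|]; rewrite big_ord0.
- move=> f f' /in_ideal_genP[k [h [g [H ->]]]] /in_ideal_genP[k' [h' [g' [H' ->]]]].
  pose cat (u : 'I_k -> fps L) u' (i : 'I_(k + k')) : fps L :=
    match split i with inl j => u j | inr j => u' j end.
  apply/in_ideal_genP; exists (k + k')%N, (cat h h'), (cat g g'); split=> [i|].
    by rewrite /cat; case: (split i).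
  rewrite big_split_ord /=; congr (_ + _); apply: eq_bigr => j _; rewrite /cat.
    by rewrite (unsplitK (inl _ j)).
  by rewrite (unsplitK (inr _ j)).
- move=> h0 f ch0 /in_ideal_genP[k [h [g [H ->]]]].
  apply/in_ideal_genP; exists k, (fun j => h0 * h j), g; split=> [j|].
    by have [ch Pg] := H j; split=> //; apply: convM.
  by rewrite mulr_sumr; apply: eq_bigr => j _; rewrite mulrA.
Qed.

Lemma in_ideal_gen_conv P f : (forall g, P g -> conv g) -> in_ideal_gen P f -> conv f.
Proof.
move=> cP /in_ideal_genP[k [h [g [H ->]]]]; apply: conv_sum => j _.
by have [ch /cP cg] := H j; apply: convM.
Qed.

Lemma wdotD w m m' : wdot w (m + m') = wdot w m + wdot w m'.
Proof.
by rewrite /wdot -big_split; apply: eq_bigr => l _; rewrite maddE natrD mulrDr.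
Qed.

Lemma not_local_trop P w f m : in_ideal_gen P f -> f m != 0 ->
  (forall m', f m' != 0 -> m' != m -> wdot w m < wdot w m') -> ~ local_trop e P w.
Proof.
move=> Jf fm fmin [_ H]; apply: H; exists m; rewrite monomialE.
have -> : fmon m = fcst (f m)^-1 * (initial_form w f : fps L).
  apply: funext => a; rewrite fcstME /initial_form /fmon; case: asboolP => [ha|na].
    have [->|nam] := eqVneq a m; first by rewrite mulVf.
    have [->|fa] := eqVneq (f a) 0; first by rewrite mulr0.
    by have := fmin a fa nam; rewrite ltNge ha.
  case: eqVneq => [am|_]; last by rewrite mulr0.
  case: na => m' fm'; have [->|nm] := eqVneq m' m; first by rewrite am.
  by rewrite am ltW // fmin.
apply: (idealM (in_ideal_gen_ideal _)); first exact: conv_fcst.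
by apply: in_ideal_gen_mem; exists f.
Qed.

(** Write the monomial as a combination of initial forms of [F j] with coefficients [h j], and keep
    in [h j] only the terms whose weight complements that of the initial form to the weight of [m].
    The resulting combination of the [F j] has no term of smaller weight, and those of equal weight
    add up to the monomial. *)
Lemma initial_ideal_monomial P w m :
  in_ideal_gen (fun g => exists f, in_ideal_gen P f /\ forall a, g a = initial_form w f a)
    (monomial m) ->
  exists f, [/\ in_ideal_gen P f, f m != 0 &
    forall m', f m' != 0 -> m' != m -> wdot w m < wdot w m'].
Proof.
move=> /in_ideal_genP[k [h [g [H ME]]]].
have /choice[F FP] : forall j, exists f : fps L, in_ideal_gen P f /\
    forall a, g j a = initial_form w f a by move=> j; case: (H j).
pose h' j : fps L := fun a =>
  if `[< exists2 m0, g j m0 != 0 & wdot w a + wdot w m0 = wdot w m >] then h j a else 0.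
have ginit j a : g j a != 0 -> F j a = g j a /\
    forall m', F j m' != 0 -> wdot w a <= wdot w m'.
  by rewrite (FP j).2 /initial_form; case: asboolP => // _; rewrite eqxx.
have ginit2 j a b : g j a != 0 -> wdot w b = wdot w a -> g j b = F j b.
  move=> /ginit[_ mn] E; rewrite (FP j).2 /initial_form; case: asboolP => // -[m'].
  by rewrite E; apply: mn.
have lowT j x : wdot w x < wdot w m -> (h' j * F j) x = 0.
  move=> lt; rewrite fpsME big1_seq // => a /andP[_]; rewrite mem_lower => ax.
  rewrite /h'; case: asboolP => [[m0 gm0 E]|_]; last by rewrite mul0r.
  apply/eqP; rewrite mulf_eq0 orbC; apply/orP; left; apply/eqP.
  apply: contraTeq lt => nz; rewrite -leNgt -E -(msubK ax) wdotD addrC lerD2r.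
  by have [_ ->] := ginit _ _ gm0.
have eqT j x : wdot w x = wdot w m -> (h' j * F j) x = (h j * g j) x.
  move=> Ex; rewrite !fpsME big_seq [RHS]big_seq; apply: eq_bigr => a.
  rewrite mem_lower => ax; have Ea := wdotD w (msub x a) a; rewrite msubK // in Ea.
  rewrite /h'; case: asboolP => [[m0 gm0 E]|N].
    by rewrite (@ginit2 _ m0) //; move: Ea; rewrite Ex -E; lra.
  rewrite mul0r; have [->|gn] := eqVneq (g j (msub x a)) 0; first by rewrite mulr0.
  by case: N; exists (msub x a) => //; rewrite addrC -Ea.
have Feq x : wdot w x = wdot w m -> (\sum_j h' j * F j) x = (x == m)%:R.
  move=> Ex; rewrite fps_sumE (eq_bigr (fun j => (h j * g j) x)) => [|j _]; last exact: eqT.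
  by rewrite -(fps_sumE _ xpredT (fun j => h j * g j)) -ME monomialE.
exists (\sum_j h' j * F j); split.
- apply: (ideal_sum (in_ideal_gen_ideal P)) => j _.
  apply: (idealM (in_ideal_gen_ideal P)); last by case: (FP j).
  have [ch _] := H j; apply: conv_dom ch _ => a; rewrite /h'.
  by case: ifP => // _; rewrite cn0 cn_ge0.
- by rewrite Feq // eqxx oner_eq0.
- move=> x; case: (ltgtP (wdot w x) (wdot w m)) => // [lt|E].
    by rewrite fps_sumE big1 ?eqxx // => j _; rewrite lowT.
  by rewrite Feq //; case: (eqVneq x m) => // _; rewrite eqxx.
Qed.

End Link.

(** * Weights of the monomials of the equations *)

Section Weights.
Variables (V : finType) (e : rel V) (d : V -> V -> nat)
  (alpha : V -> V -> leaf_t e -> nat) (c : V -> V -> nat -> CC)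
  (g : V -> nat -> series e).
Local Notation L := (leaf_t e).

Hypothesis tree : is_tree e.
Hypothesis node_ex : exists x, is_node e x.
Hypothesis val2 : forall x, valency e x != 2%N.
Hypothesis dpos : forall v u, is_node e v -> e v u -> (0 < d v u)%N.
Hypothesis edc : edge_determinant_cond e d.
Hypothesis alphaP : admissible_alpha e d alpha.
Hypothesis minors : minors_cond e c.
Hypothesis gP : g_cond e d g.

(* [w_u], and the [w_u]-weight common to the leading monomials at [v] that point away
   from [u]. *)
Definition fan_weight (u : V) (l : L) : nat :=
  if is_leaf e u then (val l == u) : nat else ell e d u (val l).
Definition fan_degree (u v : V) : nat := if is_leaf e u then 0%N else ell e d u v.

Local Notation mexp := (m_exp alpha).

Lemma lw_node u l : is_node e u -> fan_weight u l = ell e d u (val l).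
Proof. by rewrite /fan_weight (leaf_node tree val2 node_ex) => ->. Qed.

Lemma lD_node u v : is_node e u -> fan_degree u v = ell e d u v.
Proof. by rewrite /fan_degree (leaf_node tree val2 node_ex) => ->. Qed.

Lemma wnatE u m : is_node e u -> wnat d u m = pw (fan_weight u) m.
Proof. by move=> nu; rewrite /wnat /pw; apply: eq_bigr => l _; rewrite lw_node. Qed.

Lemma alpha_side v z l : is_node e v -> e v z -> alpha v z l <> 0%N ->
  side e v z (val l).
Proof.
move=> nv evz /((alphaP nv evz).1 l) /asboolT; rewrite /beyond (edge_on_geodE tree) evz /sep.
by rewrite (side_bridge tree evz); case: (side _ _ _ _).
Qed.

Lemma alpha_sum v z : is_node e v -> e v z ->
  (\sum_l alpha v z l * ell e d v (val l))%N = dv e d v.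
Proof. by move=> nv evz; rewrite (alphaP nv evz).2. Qed.

Lemma alpha_ex v z : is_node e v -> e v z ->
  exists l, (0 < alpha v z l)%N /\ side e v z (val l).
Proof.
move=> nv evz; have := dv_gt0 dpos nv; rewrite -(alpha_sum nv evz) lt0n sum_nat_eq0.
rewrite negb_forall => /existsP[l]; rewrite /= muln_eq0 negb_or => /andP[al _].
by exists l; rewrite lt0n al; split=> //; apply: alpha_side => //; apply/eqP.
Qed.

Lemma pw_mexp p v z : pw p (mexp v z) = (\sum_l alpha v z l * p l)%N.
Proof. by rewrite /pw; apply: eq_bigr => l _; rewrite ffunE mulnC. Qed.

(** Multiply by [dv e d v] and compare leaf by leaf: [v] lies between [u] and every leaf occurring
    in the monomial, so each term is [ell e d u v] times a term of the admissibility sum. For a leaf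
    [u] both sides are 0. *)
Lemma pw_away u v z : is_node e v -> e v z -> ~~ side e v z u ->
  pw (fan_weight u) (mexp v z) = fan_degree u v.
Proof.
move=> nv evz nsu; rewrite pw_mexp.
have [lu|nu] := boolP (is_leaf e u).
  rewrite /fan_degree lu big1 // => l _; rewrite /fan_weight lu.
  have [->|/alpha_side sl] := alpha v z l =P 0%N; first by rewrite mul0n.
  case: eqP => [E|]; last by rewrite muln0.
  by rewrite -E (sl nv evz) in nsu.
rewrite (leaf_node tree val2 node_ex) negbK in nu.
have dv0 := dv_gt0 dpos nv.
apply/eqP; rewrite lD_node // -(eqn_pmul2r dv0) big_distrl /=.
rewrite -[X in _ == (_ * X)%N](alpha_sum nv evz) big_distrr /=; apply/eqP.
apply: eq_bigr => l _; rewrite lw_node //.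
have [->|/alpha_side sl] := alpha v z l =P 0%N; first by rewrite !mul0n muln0.
by rewrite -mulnA (ell_mult d tree nv evz nsu (sl nv evz)) mulnCA.
Qed.

(** The same comparison leaf by leaf, now with the strict inequality for [u] and the leaf behind a
    common edge; it remains strict in the sum because some exponent is nonzero. *)
Lemma pw_toward u v z : is_node e v -> e v z -> side e v z u -> is_node e u ->
  (fan_degree u v < pw (fan_weight u) (mexp v z))%N.
Proof.
move=> nv evz su nu; rewrite pw_mexp lD_node //.
have dv0 := dv_gt0 dpos nv.
rewrite -(ltn_pmul2r dv0) big_distrl /=.
rewrite -[X in (_ * X < _)%N](alpha_sum nv evz) big_distrr /=.
have [l0 [al0 _]] := alpha_ex nv evz.
(* The successor records strictness in a form that also holds for zero exponents; summed up, it
   gains the total exponent, which is at least 1. *)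
have lt l : (alpha v z l * (ell e d u v * ell e d v (val l)).+1 <=
   alpha v z l * fan_weight u l * dv e d v)%N.
  have [->|al] := alpha v z l =P 0%N; first by rewrite !mul0n.
  rewrite -mulnA leq_mul2l lw_node //; apply/orP; right.
  apply: (ell_strict tree dpos edc val2 node_ex nv evz nu su); first exact: alpha_side.
  apply: contraTneq nu => <-; rewrite -(leaf_node tree val2 node_ex); exact: valP.
rewrite (bigD1 l0) //= [X in (_ < X)%N](bigD1 l0) //= -addSn; apply: leq_add.
  by apply: leq_trans (lt l0); rewrite mulnS mulnCA -add1n leq_add2r.
by apply: leq_sum => l _; apply: leq_trans (lt l); rewrite mulnS mulnCA leq_addl.
Qed.

Lemma pw_leaf u v : is_node e v -> e v u -> is_leaf e u ->
  (0 < pw (fan_weight u) (mexp v u))%N.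
Proof.
move=> nv evu lu; have [l [al sl]] := alpha_ex nv evu.
rewrite (side_leaf tree) // in sl.
by rewrite pw_mexp (bigD1 l) //= /fan_weight lu sl muln1 addn_gt0 al.
Qed.

Lemma g_weight v i m u : is_node e v -> (i < valency e v - 2)%N -> g v i m != 0 ->
  is_node e u -> (fan_degree u v < pw (fan_weight u) m)%N.
Proof.
move=> nv iv gm nu; have [_ /(_ m gm)[H1 H2]] := gP nv iv.
rewrite lD_node // -wnatE //; have [->|nuv] := eqVneq u v; first by rewrite ell_diag.
exact: H2.
Qed.

Definition splice_eq v i : fps L := F_sys alpha c g v i.

Local Notation I := (in_ideal_gen (splice_gens e alpha c g)).

Lemma splice_eq_in v i : is_node e v -> (i < valency e v - 2)%N -> I (splice_eq v i).
Proof. by move=> nv iv; apply: in_ideal_gen_mem; exists v, i. Qed.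

Lemma splice_eqE v i :
  splice_eq v i = \sum_(z | e v z) fcst (c v z i) * fmon (mexp v z) + (g v i : fps L).
Proof.
apply: funext => m; rewrite fpsDE fps_sumE; congr (_ + _).
rewrite /f_lead big_mkcondr /=; apply: eq_bigr => z _.
by rewrite fcstME /fmon eq_sym; case: eqP; rewrite ?mulr1 ?mulr0.
Qed.

Lemma splice_eq_conv v i : is_node e v -> (i < valency e v - 2)%N -> conv (splice_eq v i).
Proof.
move=> nv iv; rewrite splice_eqE; apply: convD; last by apply/convE; case: (gP nv iv).
by apply: conv_sum => z _; apply: convM; [apply: conv_fcst | apply: conv_fmon].
Qed.

Lemma gens_conv f : splice_gens e alpha c g f -> conv (f : fps L).
Proof.
by move=> [v [i [nv iv /funext ->]]]; apply: splice_eq_conv.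
Qed.

(** A maximal minor is invertible, so the coefficients of a combination of the equations at [v] can
    be prescribed on all edges but [z0] and [z2]: 1 at [z1] and 0 elsewhere. *)
Lemma three_terms v z0 z1 z2 : is_node e v -> e v z0 -> e v z1 -> e v z2 ->
  z1 != z0 -> z1 != z2 -> z0 != z2 ->
  exists x0 x2 (r : fps L),
    I (fmon (mexp v z1) + fcst x0 * fmon (mexp v z0) + fcst x2 * fmon (mexp v z2) + r)
    /\ forall m u, r m != 0 -> is_node e u -> (fan_degree u v < pw (fan_weight u) m)%N.
Proof.
move=> nv e0 e1 e2 n10 n12 n02.
have [b bE] := minors_row minors nv (fun z => (z == z1)%:R) e0 e2 n02.
pose x z : CC := \sum_(i < valency e v - 2) b i * c v z i.
exists (x z0), (x z2), (\sum_(i < valency e v - 2) fcst (b i) * (g v i : fps L)); split.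
  suff -> : fmon (mexp v z1) + fcst (x z0) * fmon (mexp v z0) +
      fcst (x z2) * fmon (mexp v z2) + \sum_(i < valency e v - 2) fcst (b i) * (g v i : fps L) =
      \sum_(i < valency e v - 2) fcst (b i) * splice_eq v i.
    apply: (ideal_sum (in_ideal_gen_ideal _)) => i _.
    by apply: (idealM (in_ideal_gen_ideal _)); [apply: conv_fcst | apply: splice_eq_in].
  under [RHS]eq_bigr do rewrite splice_eqE mulrDr mulr_sumr.
  rewrite big_split /=; congr (_ + _); rewrite exchange_big /=.
  have E z : \sum_(i < valency e v - 2) fcst (b i) * (fcst (c v z i) * fmon (mexp v z)) =
      fcst (x z) * fmon (mexp v z).
    apply: funext => m; rewrite fps_sumE fcstME /x mulr_suml; apply: eq_bigr => i _.
    by rewrite !fcstME mulrA.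
  rewrite (eq_bigr _ (fun z _ => E z)) (bigD1 z1) //= (bigD1 z0) /=; last first.
    by rewrite e0 eq_sym.
  rewrite (bigD1 z2) /=; last by rewrite e2 eq_sym n12 eq_sym.
  rewrite big1 ?addr0 => [|z /andP[/andP[/andP[ez nz1] nz0] nz2]]; last first.
    by rewrite /x bE // (negbTE nz1) fcst0 mul0r.
  have -> : x z1 = 1 by rewrite /x bE // eqxx.
  by rewrite fcst1 mul1r addrA.
move=> m u; rewrite fps_sumE => nz nu.
have [i nzi] : exists i : 'I_(valency e v - 2), g v i m != 0.
  apply/existsP; apply: contraNT nz => /existsPn H; rewrite big1 // => i _.
  by rewrite fcstME; have := H i; rewrite negbK => /eqP ->; rewrite mulr0.
exact: (g_weight nv (ltn_ord i) nzi nu).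
Qed.

End Weights.

(** * The splice fan *)

Section Fan.
Variables (V : finType) (e : rel V) (d : V -> V -> nat).
Local Notation L := (leaf_t e).
Hypothesis tree : is_tree e.
Hypothesis node_ex : exists x, is_node e x.
Hypothesis val2 : forall x, valency e x != 2%N.
Hypothesis dpos : forall v u, is_node e v -> e v u -> (0 < d v u)%N.
Local Notation lw := (@fan_weight V e d).

Lemma wvecE u (l : L) : wvec d u l = (lw u l)%:R.
Proof. by rewrite /wvec /fan_weight; case: ifP => // _; case: ifP. Qed.

Lemma leaf_ex : exists l : L, True.
Proof.
have step x y : e x y -> exists l : L, True.
  move: {2}#|side e x y| (leqnn #|side e x y|) => n.
  elim: n x y => [|n IH] x y.
    by rewrite leqn0 => /eqP/card0_eq/(_ y); rewrite [_ \in _]side_refl.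
  move=> cn exy; have [ly|] := boolP (is_leaf e y); first by exists (exist _ y ly).
  rewrite (leaf_node tree val2 node_ex) negbK => ny.
  have [z eyz nz] := other_neighbour ny x.
  apply: (IH y z) => //; rewrite -ltnS; apply: leq_trans cn.
  exact: (card_side tree exy eyz nz).
have [u _] := node_ex; have [y euy] := has_edge tree node_ex u; exact: step euy.
Qed.

Lemma lw_norm_gt0 u : 0 < \sum_(l : L) `|wvec d u l|.
Proof.
have H (l : L) : 0 <= `|wvec d u l| by exact: normr_ge0.
suff [l0 ll] : exists l : L, 0 < wvec d u l.
  rewrite (bigD1 l0) //= ltr_pwDl // ?normr_gt0 ?gt_eqF //.
  by apply: sumr_ge0.
have [lu|nu] := boolP (is_leaf e u).
  exists (exist _ u lu); rewrite wvecE /fan_weight lu /= eqxx; exact: ltr01.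
rewrite (leaf_node tree val2 node_ex) negbK in nu.
have [l _] := leaf_ex; exists l.
by rewrite wvecE (lw_node d tree node_ex val2) // ltr0n; apply: ell_gt0.
Qed.

(** The cone over a segment does not depend on the normalisation of its ends, so the 1-norms are
    absorbed into the coefficients. *)
Lemma splice_fanP (w : L -> RR) : splice_fan e d w <->
  exists u v s t, [/\ e u v, 0 <= s, 0 <= t &
    forall l, w l = s * (lw u l)%:R + t * (lw v l)%:R].
Proof.
pose N u := \sum_(l : L) `|wvec d u l|.
have rhoE u (l : L) : rho d u l * N u = (lw u l)%:R.
  by rewrite /rho divfK ?gt_eqF ?lw_norm_gt0 // wvecE.
have N0 u : 0 < N u by apply: lw_norm_gt0.
split.
  move=> [u [v [euv [s [t [s0 t0 t1 wE]]]]]].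
  exists u, v, (s * (1 - t) / N u), (s * t / N v); split=> //.
  - by rewrite divr_ge0 ?(ltW (N0 _)) // mulr_ge0 // subr_ge0.
  - by rewrite divr_ge0 ?(ltW (N0 _)) // mulr_ge0.
  - move=> l; rewrite wE -!rhoE.
    have := N0 u; have := N0 v; move: (N u) (N v) => x y x0 y0.
    by field; rewrite !gt_eqF.
move=> [u [v [s [t [euv s0 t0 wE]]]]]; exists u, v; split=> //.
pose S := s * N u + t * N v.
have sN : 0 <= s * N u by rewrite mulr_ge0 // ltW.
have tN : 0 <= t * N v by rewrite mulr_ge0 // ltW.
have [S0|SN] := eqVneq S 0.
  exists 0, 0; split=> // l; rewrite mul0r wE.
  have z1 : s * N u = 0 by move: S0; rewrite /S; lra.
  have z2 : t * N v = 0 by move: S0; rewrite /S; lra.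
  move/eqP: z1; move/eqP: z2; rewrite !mulf_eq0 !(gt_eqF (N0 _)) !orbF => /eqP -> /eqP ->.
  by rewrite !mul0r addr0.
have SP : 0 < S by rewrite lt_neqAle eq_sym SN /S; lra.
exists S, (t * N v / S); split.
- exact: ltW.
- by rewrite divr_ge0 // ltW.
- by rewrite ler_pdivrMr // mul1r /S; lra.
- move=> l; rewrite wE -!rhoE.
  have -> : S * ((1 - t * N v / S) * rho d u l + t * N v / S * rho d v l) =
     (S - t * N v) * rho d u l + t * N v * rho d v l by field.
  rewrite /S; ring.
Qed.
End Fan.

(** * The tropicalization lies in the fan: positive weights *)

Section TropInFan.
Variables (V : finType) (e : rel V) (d : V -> V -> nat)
  (alpha : V -> V -> leaf_t e -> nat) (c : V -> V -> nat -> CC)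
  (g : V -> nat -> series e).
Local Notation L := (leaf_t e).
Hypothesis tree : is_tree e.
Hypothesis node_ex : exists x, is_node e x.
Hypothesis val2 : forall x, valency e x != 2%N.
Hypothesis dpos : forall v u, is_node e v -> e v u -> (0 < d v u)%N.
Hypothesis edc : edge_determinant_cond e d.
Hypothesis alphaP : admissible_alpha e d alpha.
Hypothesis minors : minors_cond e c.
Hypothesis gP : g_cond e d g.
Local Notation lw := (@fan_weight V e d).
Local Notation lD := (@fan_degree V e d).
Local Notation mexp := (m_exp alpha).
Local Notation I := (in_ideal_gen (splice_gens e alpha c g)).

Let leafN := leaf_node tree val2 node_ex.

Lemma three_terms_no_trop w v z0 z1 z2 : is_node e v -> e v z0 -> e v z1 -> e v z2 ->
  z1 != z0 -> z1 != z2 -> z0 != z2 ->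
  wdot w (mexp v z1) < wdot w (mexp v z0) ->
  wdot w (mexp v z1) < wdot w (mexp v z2) ->
  (forall m, (forall u, is_node e u -> (lD u v < pw (lw u) m)%N) ->
     wdot w (mexp v z1) < wdot w m) ->
  ~ local_trop e (splice_gens e alpha c g) w.
Proof.
move=> nv e0 e1 e2 n10 n12 n02 lt0 lt2 ltr.
have [x0 [x2 [r [If rP]]]] :=
  three_terms alpha tree node_ex val2 minors gP nv e0 e1 e2 n10 n12 n02.
apply: (not_local_trop (m := mexp v z1) If).
  rewrite !fpsDE !fcstME /fmon eqxx.
  case: (mexp v z1 =P mexp v z0) => [E|_]; first by rewrite E ltxx in lt0.
  case: (mexp v z1 =P mexp v z2) => [E|_]; first by rewrite E ltxx in lt2.
  have -> : r (mexp v z1) = 0.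
    apply: contrapT => /eqP rn; have := ltr (mexp v z1) (fun u => rP _ u rn).
    by rewrite ltxx.
  by rewrite !mulr0 !addr0 oner_eq0.
move=> m fm nm.
have [->//|n0] := eqVneq m (mexp v z0).
have [->//|n2] := eqVneq m (mexp v z2).
apply: ltr => u; apply: rP; apply: contraNneq fm => rm.
by rewrite !fpsDE !fcstME /fmon (negbTE nm) (negbTE n0) (negbTE n2) rm !mulr0 !addr0.
Qed.

Section Positive.
Variable w : L -> RR.
Hypothesis trop : local_trop e (splice_gens e alpha c g) w.

Section Root.
Variables (u : V) (a : RR).
Hypothesis nu : is_node e u.
Hypothesis a0 : 0 < a.
Hypothesis aw : forall l, a * (lw u l)%:R <= w l.

Let b l := w l - a * (lw u l)%:R.

Lemma wdot_split m : wdot w m = a * (pw (lw u) m)%:R + wdot b m.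
Proof.
rewrite /wdot /pw natr_sum mulr_sumr -big_split; apply: eq_bigr => l _.
by rewrite /b natrM /=; ring.
Qed.

Let b0 l : 0 <= b l. Proof. by rewrite subr_ge0. Qed.

Let wb0 m : 0 <= wdot b m.
Proof. by apply: sumr_ge0 => l _; rewrite mulr_ge0. Qed.

Lemma wdot_zero v z : is_node e v -> e v z ->
  (forall l, side e v z (val l) -> b l = 0) -> wdot b (mexp v z) = 0.
Proof.
move=> nv evz bz; rewrite /wdot big1 // => l _; rewrite ffunE.
have [->|/(alpha_side tree alphaP nv evz)/bz ->] := alpha v z l =P 0%N; first by rewrite mulr0.
by rewrite mul0r.
Qed.

Lemma wdot_pos v z : is_node e v -> e v z ->
  (forall l, side e v z (val l) -> 0 < b l) -> 0 < wdot b (mexp v z).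
Proof.
move=> nv evz bz; have [l [al sl]] := alpha_ex tree dpos alphaP nv evz.
rewrite /wdot (bigD1 l) //= ltr_pwDl //.
  by rewrite ffunE mulr_gt0 ?ltr0n // bz.
by apply: sumr_ge0 => l' _; rewrite mulr_ge0.
Qed.

Lemma tail_weight v m : (forall u', is_node e u' -> (lD u' v < pw (lw u') m)%N) ->
  a * (lD u v)%:R < wdot w m.
Proof.
move=> H; rewrite wdot_split; apply: ltr_wpDr => //.
by rewrite ltr_pM2l // ltr_nat; apply: H.
Qed.

Lemma branch x y : e x y -> ~~ side e x y u ->
  (forall l, side e x y (val l) -> b l = 0) \/ (forall l, side e x y (val l) -> 0 < b l).
Proof.
move: {2}#|side e x y| (leqnn #|side e x y|) => n.
elim: n x y => [|n IH] x y.
  by rewrite leqn0 => /eqP/card0_eq/(_ y); rewrite [_ \in _]side_refl.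
move=> cn exy nsu; have [ly|] := boolP (is_leaf e y).
  pose ll : L := exist _ y ly.
  have E l : side e x y (val l) -> l = ll.
    by rewrite (side_leaf tree) // => /eqP E; apply: val_inj.
  have [bl|bl] := eqVneq (b ll) 0; [left|right] => l /E -> //.
  by rewrite lt_neqAle eq_sym bl b0.
rewrite leafN negbK => ny.
have eyx : e y x by rewrite (tree_sym tree).
have sxu : side e y x u by rewrite (sideN tree).
have nyz z : e y z -> z != x -> ~~ side e y z u.
  by move=> eyz nz; rewrite (side_uniq tree eyx eyz sxu).
have IHz z : e y z -> z != x ->
    (forall l, side e y z (val l) -> b l = 0) \/ (forall l, side e y z (val l) -> 0 < b l).
  move=> eyz nz; apply: IH => //; last exact: nyz.
  by rewrite -ltnS; apply: leq_trans cn; apply: (card_side tree exy eyz nz).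
have dec (l : L) : side e x y (val l) -> exists z, [/\ e y z, z != x & side e y z (val l)].
  move=> sl; apply: (side_inv tree exy sl).
  by apply: contraTneq ny => <-; rewrite -leafN; exact: (valP l).
have [Z|/existsNP[z /not_implyP[ez /not_implyP[nz nZ]]]] := pselect (forall z, e y z -> z != x ->
  (forall l, side e y z (val l) -> b l = 0)).
  by left => l /dec[z [ez nz sz]]; apply: (Z z).
have [Q|/existsNP[z' /not_implyP[ez' /not_implyP[nz' nQ]]]] := pselect (forall z, e y z -> z != x ->
  (forall l, side e y z (val l) -> 0 < b l)).
  by right => l /dec[z' [ez' nz' sz']]; apply: (Q z').
have bz : forall l, side e y z (val l) -> 0 < b l by case: (IHz z ez nz) => [/nZ|].
have bz' : forall l, side e y z' (val l) -> b l = 0 by case: (IHz z' ez' nz') => [|/nQ].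
exfalso.
have W1 : wdot w (mexp y z') = a * (lD u y)%:R.
  rewrite wdot_split (wdot_zero ny ez' bz') addr0.
  by rewrite (pw_away tree node_ex val2 dpos alphaP) // nyz.
have nzz' : z' != z.
  by apply: contraPneq bz' => ->; exact: nZ.
(* The monomial towards [z'], where [b] vanishes, is strictly lightest: the one towards [x] points
   to [u] and has larger [w_u]-weight, and the one towards [z] is raised by [b]. *)
apply: (three_terms_no_trop (w := w) ny eyx ez' ez) trop => //.
- by rewrite eq_sym.
- rewrite W1 wdot_split; apply: ltr_wpDr => //.
  rewrite ltr_pM2l // ltr_nat.
  exact: (pw_toward tree node_ex val2 dpos edc alphaP).
- rewrite W1 wdot_split (pw_away tree node_ex val2 dpos alphaP) ?nyz //.
  by rewrite ltrDl; apply: wdot_pos.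
- by move=> m; rewrite W1; apply: tail_weight.
Qed.

End Root.

Hypothesis w0 : forall l, 0 < w l.

Lemma min_scale u : is_node e u -> exists a : RR, [/\ 0 < a,
  forall l, a * (lw u l)%:R <= w l & exists l, w l = a * (lw u l)%:R].
Proof.
move=> nu; have [l0 _] := leaf_ex tree node_ex val2.
have lw0 l : 0 < (lw u l)%:R :> RR.
  by rewrite (lw_node d tree node_ex val2) // ltr0n; apply: ell_gt0.
pose l1 := [arg min_(l < l0) (w l / (lw u l)%:R)]%O.
have l1P l : w l1 / (lw u l1)%:R <= w l / (lw u l)%:R.
  by rewrite /l1; case: arg_minP => // i _; apply.
exists (w l1 / (lw u l1)%:R); split.
- by rewrite divr_gt0.
- by move=> l; rewrite -ler_pdivlMr.
- by exists l1; rewrite divfK // gt_eqF.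
Qed.

(** By minimality of the scale one branch at [u] has zero excess. Two further branches of positive
    excess would leave its monomial strictly lightest in a three-term combination, so at most one
    branch is positive, and it gives the direction. *)
Lemma node_direction u : is_node e u -> exists az : RR * V,
  [/\ 0 < az.1, e u az.2, forall l, ~~ side e u az.2 (val l) -> w l = az.1 * (lw u l)%:R &
      forall l, az.1 * (lw u l)%:R <= w l].
Proof.
move=> nu; have [a [a0 aw [lt wlt]]] := min_scale nu.
have br z (ez : e u z) : (forall l : L, side e u z (val l) -> w l - a * (lw u l)%:R = 0) \/
    (forall l : L, side e u z (val l) -> 0 < w l - a * (lw u l)%:R).
  by apply: (branch nu a0 aw ez); rewrite (side_bridge tree ez).
have dec (l : L) : exists2 z, e u z & side e u z (val l).
  apply: (side_exists tree); apply: contraTneq nu => <-; rewrite -leafN; exact: (valP l).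
have [zt et st] := dec lt.
have zt0 : forall l : L, side e u zt (val l) -> w l - a * (lw u l)%:R = 0.
  by case: (br zt et) => // /(_ _ st); rewrite wlt subrr ltxx.
have [[z [ez zpos]]|N] := pselect (exists z, e u z /\
    forall l : L, side e u z (val l) -> 0 < w l - a * (lw u l)%:R); last first.
  (* Here [w] is the multiple [a w_u] itself and any direction would do. *)
  exists (a, zt); split=> //= l _; have [z ez sz] := dec l.
  case: (br z ez) => [/(_ _ sz)/eqP|P]; first by rewrite subr_eq0 => /eqP.
  by case: N; exists z.
exists (a, z); split=> //= l nsz; have [z' ez' sz'] := dec l.
have nzz' : z' != z by apply: contraNneq nsz => <-.
case: (br z' ez') => [/(_ _ sz')/eqP|P]; first by rewrite subr_eq0 => /eqP.
exfalso; apply: (three_terms_no_trop (w := w) nu ez' et ez) trop => //.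
- apply/eqP => E; have := P l sz'; have [l2 [_ s2]] := alpha_ex tree dpos alphaP nu et.
  by have := zt0 _ s2; rewrite E in s2; have := P _ s2; rewrite lt0r => /andP[/eqP].
- apply/eqP => E; have [l2 [_ s2]] := alpha_ex tree dpos alphaP nu et.
  by have := zt0 _ s2; rewrite E in s2; have := zpos _ s2; rewrite lt0r => /andP[/eqP].
- rewrite !(wdot_split u a) (wdot_zero nu et zt0).
  rewrite !(pw_away tree node_ex val2 dpos alphaP) ?side_bridge // addr0 ltrDl.
  exact: (wdot_pos aw nu ez' P).
- rewrite !(wdot_split u a) (wdot_zero nu et zt0).
  rewrite !(pw_away tree node_ex val2 dpos alphaP) ?side_bridge // addr0 ltrDl.
  exact: (wdot_pos aw nu ez zpos).
- move=> m H; rewrite (wdot_split u a (mexp u zt)) (wdot_zero nu et zt0) addr0.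
  rewrite (pw_away tree node_ex val2 dpos alphaP) ?side_bridge //.
  exact: (tail_weight nu a0 aw).
Qed.

Lemma positive_in_fan : splice_fan e d w.
Proof.
apply/(splice_fanP tree node_ex val2 dpos).
have [u0 nu0] := node_ex.
(* A node whose direction has the smallest branch: if the neighbour in that direction is a node, its
   own direction must point back, as any other would have a smaller branch. *)
pose Q n := exists u az, [/\ is_node e u, 0 < az.1 /\ e u az.2, #|side e u az.2| = n,
  forall l : L, ~~ side e u az.2 (val l) -> w l = az.1 * (lw u l)%:R &
      forall l, az.1 * (lw u l)%:R <= w l].
have [n [Qn Qmin]] : exists n, Q n /\ forall k, (k < n)%N -> ~ Q k.
  have ex : exists n, `[< Q n >].
    have [az [H0 H1 H2 H3]] := node_direction nu0.
    by exists #|side e u0 az.2|; apply/asboolP; exists u0, az.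
  exists (ex_minn ex); case: ex_minnP => m /asboolP Qm mP; split=> // k km Qk.
  by have := mP k (asboolT Qk); rewrite leqNgt km.
have [u [[a z] /= [nu [a0 euz] cn wa aw]]] := Qn.
have [lz|] := boolP (is_leaf e z).
  have ez' l : val l != z -> w l = a * (lw u l)%:R.
    by move=> nl; apply: wa; rewrite (side_leaf tree).
  pose lz' : L := exist _ z lz.
  exists u, z, a, (w lz' - a * (lw u lz')%:R); split=> //.
  - exact: ltW.
  - by rewrite subr_ge0.
  - move=> l; rewrite [lw z l]/fan_weight lz; have [E|nl] := eqVneq (val l) z.
      have -> : l = lz' by apply: val_inj.
      by rewrite mulr1 addrC subrK.
    by rewrite mulr0 addr0 ez'.
rewrite leafN negbK => nz.
have [[a' z'] /= [a'0 ezz' wa' aw']] := node_direction nz.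
have [E|nz'u] := eqVneq z' u; last first.
  have := Qmin #|side e z z'|; rewrite -cn (card_side tree euz ezz' nz'u) => /(_ isT).
  by case; exists z, (a', z').
subst z'.
pose q : RR := (ell e d u z)%:R; pose du : RR := (dv e d u)%:R; pose dz : RR := (dv e d z)%:R.
have q0 : 0 < q by rewrite ltr0n ell_gt0.
have du0 : 0 < du by rewrite ltr0n (dv_gt0 dpos).
have dz0 : 0 < dz by rewrite ltr0n (dv_gt0 dpos).
have D : q * q < du * dz by rewrite -!natrM ltr_nat; apply: ell_adj_lt.
have suz (l : L) : side e u z (val l) -> (lw u l)%:R * dz = q * (lw z l)%:R.
  move=> sl; rewrite !(lw_node d tree node_ex val2) // -!natrM; congr (_%:R).
  have [z2 [ez2 nz2 sz2]] : exists z2, [/\ e z z2, z2 != u & side e z z2 (val l)].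
    apply: (side_inv tree euz sl); apply: contraTneq nz => <-.
    by rewrite -leafN; exact: (valP l).
  by apply: (ell_mult d tree nz ez2 _ sz2); rewrite (side_uniq tree ezz' ez2) // side_refl.
have szu (l : L) : side e z u (val l) -> (lw z l)%:R * du = q * (lw u l)%:R.
  move=> sl; rewrite !(lw_node d tree node_ex val2) // -!natrM; congr (_%:R).
  have [z2 [ez2 nz2 sz2]] : exists z2, [/\ e u z2, z2 != z & side e u z2 (val l)].
    apply: (side_inv tree ezz' sl); apply: contraTneq nu => <-.
    by rewrite -leafN; exact: (valP l).
  rewrite [ell e d u z]ell_sym //.
  by apply: (ell_mult d tree nu ez2 _ sz2); rewrite (side_uniq tree euz ez2) // side_refl.
have lw0 v (l : L) : is_node e v -> 0 < (lw v l)%:R :> RR.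
  by move=> nv; rewrite (lw_node d tree node_ex val2) // ltr0n; apply: ell_gt0.
have le1 : a * q <= a' * dz.
  have [l [_ sl]] := alpha_ex tree dpos alphaP nu euz.
  have := aw l; rewrite (wa' l); last by rewrite -(sideN tree).
  rewrite -(ler_pM2r dz0) -mulrA suz // => H.
  by rewrite -(ler_pM2r (lw0 z l nz)) -mulrA (le_trans H) // mulrAC.
have le2 : a' * q <= a * du.
  have [l [_ sl]] := alpha_ex tree dpos alphaP nz ezz'.
  have := aw' l; rewrite (wa l); last by rewrite -(sideN tree).
  rewrite -(ler_pM2r du0) -mulrA szu // => H.
  by rewrite -(ler_pM2r (lw0 u l nu)) -mulrA (le_trans H) // mulrAC.
have Dp : 0 < du * dz - q * q by rewrite subr_gt0.
(* Cramer's rule. The two vectors are proportional on either side of the edge, so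
   [w = s w_u + t w_z] amounts to [s du + t q = a du] and [s q + t dz = a' dz]; the signs come from
   [le1] and [le2]. *)
exists u, z, (dz * (a * du - a' * q) / (du * dz - q * q)),
  (du * (a' * dz - a * q) / (du * dz - q * q)); split=> //.
- by rewrite divr_ge0 ?(ltW Dp) // mulr_ge0 ?subr_ge0 // ltW.
- by rewrite divr_ge0 ?(ltW Dp) // mulr_ge0 ?subr_ge0 // ltW.
- move=> l; have [sl|nsl] := boolP (side e u z (val l)).
    rewrite (wa' l); last by rewrite -(sideN tree).
    have -> : (lw u l)%:R = q * (lw z l)%:R / dz by rewrite -(suz l sl) mulfK ?gt_eqF.
    by field; rewrite !gt_eqF.
  rewrite (wa l nsl).
  have -> : (lw z l)%:R = q * (lw u l)%:R / du.
    by rewrite -(szu l) ?mulfK ?gt_eqF // (sideN tree).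
  by field; rewrite !gt_eqF.
Qed.
End Positive.

End TropInFan.

(** * The tropicalization lies in the fan: weights on the boundary *)

Section Reduction.
Variables (L : finType) (J : fps L -> Prop) (p : L -> nat).
Hypothesis Jid : ideal J.
Hypothesis Jconv : forall f, J f -> conv f.
Implicit Types (m b : {ffun L -> nat}) (f r : fps L).

Definition higher (n : nat) r := forall a, r a != 0 -> (n < pw p a)%N.

Lemma higher0 n : higher n 0.
Proof. by move=> a; rewrite eqxx. Qed.

Lemma higherD n r r' : higher n r -> higher n r' -> higher n (r + r').
Proof.
move=> H H' a; rewrite fpsDE; have [->|/H //] := eqVneq (r a) 0.
by rewrite add0r; apply: H'.
Qed.

Lemma higherZ n x r : higher n r -> higher n (fcst x * r).
Proof. by move=> H a; rewrite fcstME mulf_eq0 negb_or => /andP[_ /H]. Qed.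

Lemma higherM n r b : higher n r -> higher (n + pw p b) (fmon b * r).
Proof.
move=> H a; rewrite fmonME; case: ifP => [ba /H|]; last by rewrite eqxx.
by rewrite -{2}(msubK ba) pwD ltn_add2r.
Qed.

Lemma higher_fmon n b : (n < pw p b)%N -> higher n (fmon b).
Proof. by move=> H a; rewrite /fmon; case: (eqVneq a b) => [->|_] //; rewrite eqxx. Qed.

(* [red m m']: modulo [p]-initial forms of [J], [z^m] is a multiple of [z^m']. *)
Definition red m m' := pw p m' = pw p m /\ exists x r,
  J (fmon m + fcst x * fmon m' + r) /\ higher (pw p m) r.

Lemma red_refl m : red m m.
Proof.
split=> //; exists (-1), 0; split; last exact: higher0.
by rewrite fcstN fcst1 mulN1r addrN addr0; apply: ideal0.
Qed.

Lemma red_trans m1 m2 m3 : red m1 m2 -> red m2 m3 -> red m1 m3.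
Proof.
move=> [E1 [x [r [J1 H1]]]] [E2 [x' [r' [J2 H2]]]]; split; first by rewrite E2.
exists (- (x * x')), (r + - (fcst x * r')); split; last first.
  apply: higherD => //; rewrite -mulNr -fcstN; apply: higherZ; by rewrite -E1.
have -> : fmon m1 + fcst (- (x * x')) * fmon m3 + (r - fcst x * r') =
  (fmon m1 + fcst x * fmon m2 + r) - fcst x * (fmon m2 + fcst x' * fmon m3 + r').
  by rewrite fcstN -fcstM; ring.
by apply: (idealB Jid) => //; apply: (idealM Jid) => //; apply: conv_fcst.
Qed.

Lemma redM m m' b : red m m' -> red (m + b) (m' + b).
Proof.
move=> [E [x [r [Jr H]]]]; split; first by rewrite !pwD E.
exists x, (fmon b * r); split; last by rewrite pwD; apply: higherM.
have -> : fmon (m + b) + fcst x * fmon (m' + b) + fmon b * r =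
   fmon b * (fmon m + fcst x * fmon m' + r) by rewrite -!fmonM; ring.
by apply: (idealM Jid) => //; apply: conv_fmon.
Qed.

Lemma redD m1 m2 m3 m4 : red m1 m2 -> red m3 m4 -> red (m1 + m3) (m2 + m4).
Proof.
move=> H12 H34; apply: red_trans (redM m3 H12) _.
by rewrite (addrC m2 m3) (addrC m2 m4); apply: redM.
Qed.

(** Some power of [z_l] reduces to a multiple of [z^m]: membership of [z_l] in the radical of the
    monomial, on the level of initial forms. *)
Definition powred l m := exists k b, red (unitm l *+ k) (m + b).

Lemma powred0 l : powred l 0.
Proof. by exists 0%N, 0; rewrite addr0; apply: red_refl. Qed.

Lemma powredD l m m' : powred l m -> powred l m' -> powred l (m + m').
Proof.
move=> [k [b H]] [k' [b' H']]; exists (k + k')%N, (b + b'); rewrite mulrnDr.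
by rewrite addrACA; apply: redD.
Qed.

Lemma powred_red l m m' b : powred l m -> red m (m' + b) -> powred l m'.
Proof.
move=> [k [b' H]] H'; exists k, (b + b'); apply: red_trans H _.
by rewrite addrA; apply: redM.
Qed.

Lemma powred_mle l m m' : mle m' m -> powred l m -> powred l m'.
Proof.
move=> mm' H; apply: (powred_red (b := msub m m') H).
by rewrite addrC msubK //; apply: red_refl.
Qed.

Lemma powred_refl l : powred l (unitm l).
Proof. by exists 1%N, 0; rewrite addr0; apply: red_refl. Qed.

Lemma powredMn l m k : powred l m -> powred l (m *+ k).
Proof.
by move=> H; elim: k => [|k IH]; [exact: powred0 | rewrite mulrS; apply: powredD].
Qed.

Lemma powred_trans l l' m : powred l (unitm l') -> powred l' m -> powred l m.
Proof. by move=> H [k [b H']]; apply: powred_red (powredMn k H) H'. Qed.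

Lemma mon_sum m : m = \sum_l unitm l *+ m l.
Proof.
apply/ffunP => l; rewrite sum_ffunE (bigD1 l) //= unitmE eqxx big1 ?addr0 // => l' n.
by rewrite unitmE eq_sym (negbTE n).
Qed.

Lemma powred_supp l m : (forall l', (0 < m l')%N -> powred l (unitm l')) -> powred l m.
Proof.
move=> H; rewrite [m]mon_sum; elim/big_ind: _ => [||l' _]; [exact: powred0|exact: powredD|].
by case: (posnP (m l')) => [->|/H]; [exact: powred0 | exact: powredMn].
Qed.

Lemma powred_killed l m : powred l m -> J (fmon m) -> exists k r,
  J (fmon (unitm l *+ k) + r) /\ higher (pw p (unitm l *+ k)) r.
Proof.
move=> [k [b [E [x [r [Jr H]]]]]] Jm; exists k, r; split=> //.
rewrite (_ : _ + r = (fmon (unitm l *+ k) + fcst x * fmon (m + b) + r) -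
   (fcst x * fmon b) * fmon m); last by rewrite -fmonM; ring.
apply: (idealB Jid) => //; apply: (idealM Jid) => //.
by apply: convM; [apply: conv_fcst | apply: conv_fmon].
Qed.

Lemma all_killed : (forall l, (0 < p l)%N) ->
  (forall l, exists k r, J (fmon (unitm l *+ k) + r) /\ higher (pw p (unitm l *+ k)) r) ->
  exists D, forall m, (D <= pw p m)%N -> J (fmon m).
Proof.
move=> p0 /choice[K /choice[r H]].
apply: (powers_monomials p0 (K := K) (F := fun l => fmon (unitm l *+ K l) + r l) Jid) => l.
have [JF hr] := H l.
have r0 : r l (unitm l *+ K l) = 0.
  by apply/eqP; apply: contraT => /hr; rewrite ltnn.
split=> // [||m]; first exact: Jconv.
  by rewrite fpsDE /fmon eqxx r0 addr0.
by rewrite fpsDE /fmon => + /negbTE nm; rewrite nm add0r => /hr.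
Qed.

End Reduction.

Section Boundary.
Variables (V : finType) (e : rel V) (d : V -> V -> nat)
  (alpha : V -> V -> leaf_t e -> nat) (c : V -> V -> nat -> CC)
  (g : V -> nat -> series e).
Local Notation L := (leaf_t e).
Hypothesis tree : is_tree e.
Hypothesis node_ex : exists x, is_node e x.
Hypothesis val2 : forall x, valency e x != 2%N.
Hypothesis dpos : forall v u, is_node e v -> e v u -> (0 < d v u)%N.
Hypothesis edc : edge_determinant_cond e d.
Hypothesis alphaP : admissible_alpha e d alpha.
Hypothesis minors : minors_cond e c.
Hypothesis gP : g_cond e d g.
Local Notation lw := (@fan_weight V e d).
Local Notation lD := (@fan_degree V e d).
Local Notation mexp := (m_exp alpha).
Local Notation I := (in_ideal_gen (splice_gens e alpha c g)).

Let leafN := leaf_node tree val2 node_ex.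

(** * Reductions between the variables of a branch *)

Section Root.
Variables (J : fps L -> Prop) (u : V).
Hypothesis Jid : ideal J.
Hypothesis IJ : forall f : fps L, I f -> J f.
Hypothesis nu : is_node e u.
Local Notation p := (lw u).
Local Notation red := (red J p).
Local Notation powred := (powred J p).

(** In the three-term combination the term of [z0] disappears, being either of larger [w_u]-weight
    because it points to [u], or already in [J]. What remains relates two monomials of equal
    weight. *)
Lemma red_step v z z' z0 : is_node e v -> e v z -> e v z' -> e v z0 ->
  z != z0 -> z != z' -> z0 != z' -> ~~ side e v z u -> ~~ side e v z' u ->
  side e v z0 u \/ J (fmon (mexp v z0)) -> red (mexp v z) (mexp v z').
Proof.
move=> nv ez ez' ez0 n0 n1 n2 su su' H0.
have pE y : e v y -> ~~ side e v y u -> pw p (mexp v y) = lD u v.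
  exact: (pw_away tree node_ex val2 dpos alphaP).
split; first by rewrite !pE.
have [x0 [x2 [r [If rP]]]] :=
  three_terms alpha tree node_ex val2 minors gP nv ez0 ez ez' n0 n1 n2.
rewrite pE //; case: H0 => [sz0|J0].
  exists x2, (fcst x0 * fmon (mexp v z0) + r); split.
    rewrite (_ : _ + (_ + r) = fmon (mexp v z) + fcst x0 * fmon (mexp v z0) +
      fcst x2 * fmon (mexp v z') + r); [exact: IJ | ring].
  apply: higherD; last by move=> m rm; apply: rP.
  apply/higherZ/higher_fmon; exact: (pw_toward tree node_ex val2 dpos edc alphaP).
exists x2, r; split; last by move=> m rm; apply: rP.
rewrite (_ : _ + r = (fmon (mexp v z) + fcst x0 * fmon (mexp v z0) +
  fcst x2 * fmon (mexp v z') + r) - fcst x0 * fmon (mexp v z0)); last by ring.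
apply: (idealB Jid); first exact: IJ.
by apply: (idealM Jid) => //; apply: conv_fcst.
Qed.

(** A power of [z_l] is a multiple of the monomial towards [z], which reduces to the one towards
    [z']; the latter contains some variable behind [z'], and a power of that reaches [z_l']. *)
Lemma powred_step v z z' z0 l l' : is_node e v -> e v z -> e v z' -> e v z0 ->
  z != z0 -> z != z' -> z0 != z' -> ~~ side e v z u -> ~~ side e v z' u ->
  side e v z0 u \/ J (fmon (mexp v z0)) ->
  (forall l'' : L, side e v z (val l'') -> powred l (unitm l'')) ->
  (forall l'' : L, side e v z' (val l'') -> powred l'' (unitm l')) ->
  powred l (unitm l').
Proof.
move=> nv ez ez' ez0 n0 n1 n2 su su' H0 H H'.
have R := red_step nv ez ez' ez0 n0 n1 n2 su su' H0.
have P : powred l (mexp v z).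
  apply: powred_supp => // l'' al; apply: H; apply: (alpha_side tree alphaP) => //.
  by move: al; rewrite ffunE; case: (alpha v z l'').
have [l'' [al sl]] := alpha_ex tree dpos alphaP nv ez'.
have P' : powred l (mexp v z').
  by apply: (powred_red (b := 0) Jid P); rewrite addr0.
apply: (powred_trans Jid (l' := l'')); last exact: H'.
by apply: (powred_mle Jid _ P'); rewrite -[unitm _]mulr1n mle_unitm ffunE.
Qed.

(** By induction on the branch; two leaves in different branches at [y] are linked by the equations
    at [y], where the direction [x] leads to [u] and plays the part of [z0]. *)
Lemma powred_branch x y (l l' : L) : e x y -> ~~ side e x y u ->
  side e x y (val l) -> side e x y (val l') -> powred l (unitm l').
Proof.
move: {2}#|side e x y| (leqnn #|side e x y|) => n.
elim: n x y l l' => [|n IH] x y l l'.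
  by rewrite leqn0 => /eqP/card0_eq/(_ y); rewrite [_ \in _]side_refl.
move=> cn exy nsu sl sl'; have [ly|] := boolP (is_leaf e y).
  rewrite (side_leaf tree) // in sl; rewrite (side_leaf tree) // in sl'.
  have -> : l = l' by apply: val_inj; rewrite (eqP sl) (eqP sl').
  exact: powred_refl.
rewrite leafN negbK => ny.
have eyx : e y x by rewrite (tree_sym tree).
have sxu : side e y x u by rewrite (sideN tree).
have nyz z : e y z -> z != x -> ~~ side e y z u.
  by move=> eyz nz; rewrite (side_uniq tree eyx eyz sxu).
have dec (l1 : L) : side e x y (val l1) -> exists z, [/\ e y z, z != x & side e y z (val l1)].
  move=> sl1; apply: (side_inv tree exy sl1).
  by apply: contraTneq ny => <-; rewrite -leafN; exact: (valP l1).
have IHz z (l1 l2 : L) : e y z -> z != x -> side e y z (val l1) -> side e y z (val l2) ->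
    powred l1 (unitm l2).
  move=> eyz nz; apply: IH => //; last exact: nyz.
  by rewrite -ltnS; apply: leq_trans cn; apply: (card_side tree exy eyz nz).
have [z [ez nz sz]] := dec l sl; have [z' [ez' nz' sz']] := dec l' sl'.
have [E|nzz'] := eqVneq z z'; first by apply: (IHz z) => //; rewrite E.
apply: (powred_step ny ez ez' eyx nz nzz' _ (nyz z ez nz) (nyz z' ez' nz')).
- by rewrite eq_sym.
- by left.
- by move=> l''; apply: (IHz z).
- by move=> l''; move/(IHz z' l'' l' ez' nz'); apply.
Qed.
End Root.

(** Root the tree at the node [u] next to the leaf [l1], and let [J] be the ideal enlarged by the
    variables of positive weight. The monomial at [u] towards [l1] lies in [J], which links the
    other branches at [u]: a power of every variable reduces to a multiple of the variable of [l1]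
    or of [l2], both in [J]. *)
Lemma boundary_no_trop (w : L -> RR) (l0 l1 l2 : L) : (forall l, 0 <= w l) ->
  w l0 = 0 -> 0 < w l1 -> 0 < w l2 -> l1 != l2 ->
  ~ local_trop e (splice_gens e alpha c g) w.
Proof.
move=> w0 wl0 wl1 wl2 n12.
have [u elu] := has_edge tree node_ex (val l1).
have nu := leaf_edge_node tree val2 node_ex (valP l1) elu.
have eul : e u (val l1) by rewrite (tree_sym tree).
pose T (f : fps L) := exists h : L -> fps L, (forall l, conv (h l)) /\
  f = \sum_(l | 0 < w l) h l * fmon (unitm l).
pose J (f : fps L) := exists f1 f2 : fps L, [/\ I f1, T f2 & f = f1 + f2].
have Iid := in_ideal_gen_ideal (splice_gens e alpha c g).
have Tid : ideal T.
  split.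
  - exists (fun=> 0); split=> [l|]; first exact: conv0.
    by rewrite big1 // => l _; rewrite mul0r.
  - move=> f f' [h [ch ->]] [h' [ch' ->]]; exists (fun l => h l + h' l).
    split=> [l|]; first exact: convD.
    by rewrite -big_split /=; apply: eq_bigr => l _; rewrite mulrDl.
  - move=> h0 f ch0 [h [ch ->]]; exists (fun l => h0 * h l).
    split=> [l|]; first exact: convM.
    by rewrite mulr_sumr; apply: eq_bigr => l _; rewrite mulrA.
have Jid : ideal J.
  split.
  - exists 0, 0; split; [exact: ideal0 Iid|exact: ideal0 Tid|by rewrite addr0].
  - move=> f f' [f1 [f2 [I1 T2 ->]]] [f3 [f4 [I3 T4 ->]]].
    exists (f1 + f3), (f2 + f4); split; [exact: idealD|exact: idealD|by rewrite addrACA].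
  - move=> h f ch [f1 [f2 [I1 T2 ->]]]; exists (h * f1), (h * f2).
    by split; [exact: idealM|exact: idealM|rewrite mulrDr].
have IJ (f : fps L) : I f -> J f.
  by move=> If; exists f, 0; split=> //; [exact: ideal0 Tid|rewrite addr0].
have Jconv f : J f -> conv f.
  move=> [f1 [f2 [I1 [h [ch ->]] ->]]]; apply: convD.
    by apply: in_ideal_gen_conv I1 => f'; apply: (gens_conv gP).
  by apply: conv_sum => l _; apply: convM => //; apply: conv_fmon.
have Jpos (m : {ffun L -> nat}) l : 0 < w l -> (0 < m l)%N -> J (fmon m).
  move=> wl ml; have -> : fmon m = fmon (msub m (unitm l)) * fmon (unitm l).
    by rewrite fmonM msubK // -[unitm l]mulr1n mle_unitm.
  apply: (idealM Jid); first exact: conv_fmon.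
  exists 0, (fmon (unitm l)); split; rewrite ?add0r //; first exact: ideal0 Iid.
  exists (fun l' => (l' == l)%:R); split=> [l'|].
    by case: eqP => _; [exact: conv1 | exact: conv0].
  rewrite (bigD1 l) //= eqxx mul1r big1 ?addr0 // => l' /andP[_ /negbTE ->].
  by rewrite mul0r.
have p0 l : (0 < lw u l)%N.
  by rewrite (lw_node d tree node_ex val2) //; apply: ell_gt0.
have pr l : powred J (lw u) l (unitm l1) \/ powred J (lw u) l (unitm l2).
  have [->|nl] := eqVneq l l1; first by left; apply: powred_refl.
  right.
  have dec (l' : L) : exists2 z, e u z & side e u z (val l').
    by apply: (side_exists tree); apply: contraTneq nu => <-; rewrite -leafN; exact: (valP l').
  have nsu z : e u z -> ~~ side e u z u by move=> ez; rewrite side_bridge.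
  have nz1 (l' : L) z : l' != l1 -> side e u z (val l') -> z != val l1.
    move=> nl' sz; apply/eqP => E; move: sz; rewrite E (side_leaf tree) //; last exact: (valP l1).
    by move/eqP/val_inj/eqP; rewrite (negbTE nl').
  have [z ez sz] := dec l; have [z2 ez2 sz2] := dec l2.
  have nz := nz1 _ _ nl sz; have nz2 : z2 != val l1 by apply: nz1 sz2; rewrite eq_sym.
  have [E|nzz] := eqVneq z z2.
    by apply: (powred_branch Jid IJ nu ez (nsu _ ez)) => //; rewrite E.
  apply: (powred_step Jid IJ nu nu ez ez2 eul nz nzz _ (nsu _ ez) (nsu _ ez2)).
  - by rewrite eq_sym.
  - right; apply: (Jpos _ l1) => //.
    have [l3 [al sl]] := alpha_ex tree dpos alphaP nu eul.
    have E : l3 = l1.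
      by apply: val_inj; apply/eqP; rewrite -(side_leaf tree _ eul) //; exact: (valP l1).
    by rewrite ffunE; rewrite E in al.
  - by move=> l'' sl''; apply: (powred_branch Jid IJ nu ez (nsu _ ez)).
  - by move=> l'' sl''; apply: (powred_branch Jid IJ nu ez2 (nsu _ ez2)).
have [|D HD] := all_killed Jid Jconv p0.
  move=> l; case: (pr l) => /powred_killed; apply=> //.
    by apply: (Jpos _ l1) => //; rewrite ffunE eqxx.
  by apply: (Jpos _ l2) => //; rewrite ffunE eqxx.
(* A power of the variable of weight 0 is in [J]; the part [f1] of it in the original ideal differs
   from it only by terms of positive weight, so this power is its initial form. *)
pose m := unitm l0 *+ D.
have [|f1 [f2 [If1 [h [ch f2E]] mE]]] := HD m.
  by rewrite pw_unitm leq_pmull.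
have f1E a : f1 a = (a == m)%:R - f2 a.
  by rewrite -[(a == m)%:R]/(fmon m a) mE fpsDE addrK.
have f2z (a : {ffun L -> nat}) : (forall l, 0 < w l -> a l = 0%N) -> f2 a = 0.
  move=> H; rewrite f2E fps_sumE big1 // => l wl.
  by rewrite mulrC fmonME -[unitm l]mulr1n mle_unitm (H l wl).
have mz l : 0 < w l -> m l = 0%N.
  by move=> wl; rewrite unitmE; case: eqP => // E; rewrite E wl0 ltxx in wl.
have wm : wdot w m = 0.
  rewrite /wdot big1 // => l _; have := w0 l; rewrite le_eqVlt => /orP[/eqP <-|/mz ->].
    by rewrite mul0r.
  by rewrite mulr0.
apply: (not_local_trop If1 (m := m)); first by rewrite f1E f2z // eqxx subr0 oner_eq0.
move=> a; rewrite f1E; case: (eqVneq a m) => // _; rewrite sub0r oppr_eq0 => fa _.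
have [l [wl al]] : exists l, 0 < w l /\ a l <> 0%N.
  apply: contrapT => N; move/eqP: fa; apply; apply: f2z => l wl.
  by apply: contrapT => al; apply: N; exists l.
rewrite wm /wdot (bigD1 l) //= ltr_pwDl //.
  by rewrite mulr_gt0 // ltr0n lt0n; apply/eqP.
by apply: sumr_ge0 => l' _; rewrite mulr_ge0.
Qed.

Lemma trop_in_fan w : local_trop e (splice_gens e alpha c g) w -> splice_fan e d w.
Proof.
move=> trop; have w0 := trop.1.
have [wpos|/existsNP[l0 nl0]] := pselect (forall l, 0 < w l).
  exact: (positive_in_fan tree node_ex val2 dpos edc alphaP minors gP trop).
have wl0 : w l0 = 0.
  by apply/eqP; have := w0 l0; rewrite le_eqVlt eq_sym => /orP[|/nl0].
apply/(splice_fanP tree node_ex val2 dpos).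
have [l1 H1] : exists l1, forall l, l != l1 -> w l = 0.
  have [[l1 wl1]|N] := pselect (exists l, 0 < w l); last first.
    exists l0 => l _; apply/eqP; have := w0 l; rewrite le_eqVlt eq_sym => /orP[//|wl].
    by case: N; exists l.
  exists l1 => l nl; apply/eqP; have := w0 l; rewrite le_eqVlt eq_sym => /orP[//|wl].
  by exfalso; apply: (boundary_no_trop w0 wl0 wl1 wl _ trop); rewrite eq_sym.
have [u elu] := has_edge tree node_ex (val l1).
exists (val l1), u, (w l1), 0; split=> // l.
rewrite mul0r addr0 /fan_weight [is_leaf e (val l1)](valP l1).
have [->|nl] := eqVneq l l1; first by rewrite eqxx mulr1.
by rewrite (inj_eq val_inj) (negbTE nl) mulr0 H1.
Qed.

End Boundary.

(** * Arcs by Newton's method *)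

Section Arcs.
Variables (L : finType) (W : L -> nat).
Hypothesis W0 : forall l, (0 < W l)%N.
Implicit Types (m a b : {ffun L -> nat}) (f g h : fps L) (p : L -> {poly CC}).

Definition mono (R : comNzRingType) (z : L -> R) m : R := \prod_l z l ^+ m l.

Lemma monoD (R : comNzRingType) (z : L -> R) a b : mono z (a + b) = mono z a * mono z b.
Proof. by rewrite /mono -big_split; apply: eq_bigr => l _; rewrite maddE exprD. Qed.

Variable K : nat.
Local Notation B := (slice W 0 K.+1).

Lemma mem_B m : (m \in B) = (pw W m <= K)%N.
Proof. by rewrite mem_slice. Qed.

Definition term p m : {poly CC} := 'X^(pw W m) * mono p m.

Lemma termD p a b : term p (a + b) = term p a * term p b.
Proof. by rewrite /term pwD monoD exprD; ring. Qed.

(* The substitution [z_l = X^(W l) * p l] in [f], truncated at order [K]. *)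
Definition ev p f : {poly CC} := \sum_(m <- B) f m *: term p m.

Lemma ev_sum (I : Type) (r : seq I) (F : I -> fps L) p :
  ev p (\sum_(i <- r) F i) = \sum_(i <- r) ev p (F i).
Proof.
rewrite /ev exchange_big /=; apply: eq_bigr => m _.
by rewrite fps_sumE scaler_suml.
Qed.

Lemma dvdp_sum (I : eqType) (r : seq I) (P : pred I) (F : I -> {poly CC}) q :
  (forall i, i \in r -> P i -> q %| F i) -> q %| \sum_(i <- r | P i) F i.
Proof.
move=> H; rewrite big_seq_cond; elim/big_ind: _ => [||i /andP[]]; first exact: dvdp0.
  by move=> x y; apply: dvdp_add.
exact: H.
Qed.

Lemma dvdp_scale (q r : {poly CC}) x : q %| r -> q %| x *: r.
Proof. by move=> H; rewrite -mul_polyC dvdp_mull. Qed.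

Lemma slice_filter a : (pw W a <= K)%N ->
  perm_eq [seq x <- B | mle a x] [seq b + a | b <- [seq b <- B | (b + a) \in B]].
Proof.
move=> aK; apply: uniq_perm; rewrite ?filter_uniq ?slice_uniq //.
  rewrite map_inj_uniq ?filter_uniq ?slice_uniq // => x y E.
  by rewrite -(maddK x a) -(maddK y a) E.
move=> x; rewrite mem_filter mem_B; apply/andP/mapP => [[ax xK]|[b]].
  have E : (pw W (msub x a) + pw W a = pw W x)%N by rewrite -pwD msubK.
  exists (msub x a); last by rewrite msubK.
  by rewrite mem_filter msubK // !mem_B xK; lia.
by rewrite mem_filter !mem_B => /andP[baK _] ->; rewrite mle_addr.
Qed.

(** The difference consists of products of retained terms whose total weight exceeds [K], each
    divisible by [X^(K+1)]. *)
Lemma ev_mul p f g : 'X^(K.+1) %| ev p (f * g) - ev p f * ev p g.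
Proof.
have E1 : ev p (f * g) = \sum_(a <- B) \sum_(b <- B | (b + a) \in B)
    (f a *: term p a) * (g b *: term p b).
  transitivity (\sum_(x <- B) \sum_(a <- B | mle a x)
     (f a *: term p a) * (g (msub x a) *: term p (msub x a))).
    rewrite /ev big_seq [RHS]big_seq; apply: eq_bigr => x xB.
    rewrite fpsME scaler_suml -[RHS]big_filter; apply: etrans (perm_big _ _) _.
      apply: (lower_perm (s := [seq a <- B | mle a x])).
        by rewrite filter_uniq ?slice_uniq.
      move=> a; rewrite mem_filter mem_B; case: (boolP (mle a x)) => //= ax.
      by move: xB; rewrite mem_B; apply: leq_trans; rewrite -(msubK ax) pwD leq_addl.
    rewrite big_seq [RHS]big_seq; apply: eq_bigr => a.
    rewrite mem_filter => /andP[ax _].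
    by rewrite -scalerAl -scalerAr scalerA -termD addrC msubK.
  rewrite (exchange_big_dep predT) //= big_seq [RHS]big_seq; apply: eq_bigr => a aB.
  rewrite -big_filter (perm_big _ (slice_filter _)) -?mem_B // big_map big_filter.
  by apply: eq_bigr => b _; rewrite maddK.
have E2 : ev p f * ev p g = \sum_(a <- B) \sum_(b <- B)
    (f a *: term p a) * (g b *: term p b).
  by rewrite /ev mulr_suml; apply: eq_bigr => a _; rewrite mulr_sumr.
have -> : ev p (f * g) - ev p f * ev p g = - \sum_(a <- B) \sum_(b <- B | (b + a) \notin B)
    (f a *: term p a) * (g b *: term p b).
  rewrite E1 E2 -sumrB -sumrN; apply: eq_bigr => a _.
  by rewrite [X in _ - X](bigID (fun b => b + a \in B)) /= opprD addrA subrr add0r.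
rewrite dvdpNr; apply: dvdp_sum => a _ _; apply: dvdp_sum => b _.
rewrite mem_B -ltnNge => lt.
rewrite -scalerAl -scalerAr scalerA -termD addrC; apply: dvdp_scale.
by rewrite /term; apply: dvdp_mulr; apply: dvdp_exp2l.
Qed.

Lemma term_coef p m k : (k < pw W m)%N -> (term p m)`_k = 0.
Proof. by move=> lt; rewrite /term coefXnM lt. Qed.

Lemma mono_horner0 p m : (mono p m).[0] = mono (fun l => (p l).[0]) m.
Proof.
by rewrite /mono horner_prod; apply: eq_bigr => l _; rewrite horner_exp.
Qed.

Lemma term_lead p m : (term p m)`_(pw W m) = mono (fun l => (p l).[0]) m.
Proof.
by rewrite /term coefXnM ltnn subnn -horner_coef0 mono_horner0.
Qed.

Lemma ev_lead p f m : (pw W m <= K)%N ->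
  (forall a, f a != 0 -> a != m -> (pw W m < pw W a)%N) ->
  (ev p f)`_(pw W m) = f m * mono (fun l => (p l).[0]) m.
Proof.
move=> mK H; rewrite /ev (bigD1_seq m) ?slice_uniq ?mem_B //= coefD coefZ term_lead.
rewrite coef_sum big1 ?addr0 // => a na; rewrite coefZ.
by have [->|fa] := eqVneq (f a) 0; rewrite ?mul0r // term_coef ?mulr0 // H.
Qed.

(** Corrections are multiplicative, so that a monomial changes to first order by the factor given by
    the linear form [\sum_l xi l *+ m l]: its logarithmic derivative. *)
Lemma first_order (xi : L -> CC) N m : exists r : {poly CC},
  mono (fun l => 1 + (xi l)%:P * 'X^(N.+1)) m =
  1 + (\sum_l xi l *+ m l)%:P * 'X^(N.+1) + 'X^(N.+2) * r.
Proof.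
pose P (t : {poly CC}) (x : CC) := exists r : {poly CC},
  t = 1 + x%:P * 'X^(N.+1) + 'X^(N.+2) * r.
have PM t x t' x' : P t x -> P t' x' -> P (t * t') (x + x').
  move=> [r ->] [r' ->]; exists (r + r' + x%:P * x'%:P * 'X^N + x%:P * 'X^(N.+1) * r' +
    x'%:P * 'X^(N.+1) * r + 'X^(N.+2) * r * r').
  rewrite polyCD !exprS; ring.
have P1 : P 1 0 by exists 0; rewrite polyC0 mul0r mulr0 !addr0.
rewrite -/(P _ _) /mono; elim/big_rec2: _ => // l y1 y2 _ IH.
apply: (PM _ _ _ _ _ IH); elim: (m l) => [|k IH']; first by rewrite expr0 mulr0n.
by rewrite exprS mulrS; apply: (PM _ _ _ _ _ IH'); exists 0; rewrite mulr0 addr0.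
Qed.

Section Hensel.
Variables (T : Type) (Q : T -> Prop) (F : T -> fps L) (D : T -> nat) (zeta : L -> CC).
Hypothesis FD : forall q m, Q q -> F q m != 0 -> (D q <= pw W m)%N.
Hypothesis F0 : forall q, Q q ->
  \sum_(m <- B | pw W m == D q) F q m * mono zeta m = 0.
Hypothesis Fsurj : forall b : T -> CC, exists xi : L -> CC, forall q, Q q ->
  \sum_(m <- B | pw W m == D q) F q m * (mono zeta m * \sum_l xi l *+ m l) = b q.

Lemma split0 (p : {poly CC}) : exists r, p = (p.[0])%:P + 'X * r.
Proof.
have : root (p - (p.[0])%:P) 0 by rewrite /root !hornerE subrr.
move/factor_theorem => [r E]; exists r.
by rewrite mulrC -[X in _ * X]subr0 -polyC0 -E addrC subrK.
Qed.

(** With [x = 1] this isolates the initial form at the arc, with [x m = \sum_l xi l *+ m l] its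
    logarithmic derivative in the direction [xi]. *)
Lemma lead_split p q (x : {ffun L -> nat} -> CC) : Q q ->
  (forall l, (p l).[0] = zeta l) ->
  exists r, \sum_(m <- B) (F q m * x m) *: term p m =
   'X^(D q) * ((\sum_(m <- B | pw W m == D q) F q m * (mono zeta m * x m))%:P + 'X * r).
Proof.
move=> Qq pz.
have H m : exists r, (F q m * x m) *: term p m =
   'X^(D q) * ((if pw W m == D q then F q m * (mono zeta m * x m) else 0)%:P + 'X * r).
  have [->|Fm] := eqVneq (F q m) 0.
    exists 0; rewrite mul0r scale0r; case: ifP => _; rewrite ?mul0r polyC0; ring.
  have le := FD Qq Fm; case: eqP => [E|/eqP ne].
    have [r rE] := split0 (mono p m); exists ((F q m * x m) *: r).
    rewrite /term E -scalerAr rE mono_horner0.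
    have -> : mono (fun l => (p l).[0]) m = mono zeta m.
      by rewrite /mono; apply: eq_bigr => l _; rewrite pz.
    rewrite -!mul_polyC !polyCM; ring.
  exists ((F q m * x m) *: ('X^(pw W m - (D q).+1) * mono p m)).
  have lt : (D q < pw W m)%N by rewrite ltn_neqAle eq_sym ne le.
  rewrite /term -{1}(subnKC lt) exprD exprS -!mul_polyC polyC0; ring.
have [r rE] := choice H; exists (\sum_(m <- B) r m).
rewrite (eq_bigr _ (fun m _ => rE m)) -mulr_sumr big_split /= -mulr_sumr.
by rewrite [X in _ = _ * (X%:P + _)]big_mkcond rmorph_sum.
Qed.

(* Newton's method: a correction of order [N+1] changes [F q] in order [D q + N + 1] by the
   logarithmic Jacobian of its initial form, which is onto. *)
Lemma hensel N : exists p : L -> {poly CC}, (forall l, (p l).[0] = zeta l) /\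
  forall q, Q q -> 'X^(D q + N.+1) %| ev p (F q).
Proof.
elim: N => [|N [p [pz pF]]].
  exists (fun l => (zeta l)%:P); split=> [l|q Qq]; first by rewrite hornerC.
  have [|r rE] := @lead_split (fun l => (zeta l)%:P) q (fun=> 1) Qq.
    by move=> l; rewrite hornerC.
  rewrite /ev (eq_bigr (fun m => (F q m * 1) *: term (fun l => (zeta l)%:P) m)); last first.
    by move=> m _; rewrite mulr1.
  rewrite rE; under eq_bigr do rewrite mulr1.
  by rewrite F0 // polyC0 add0r mulrA -exprSr addn1; apply: dvdp_mulr.
have /choice[R RE] : forall q, exists R, Q q -> ev p (F q) = 'X^(D q + N.+1) * R.
  move=> q; have [Qq|nQ] := pselect (Q q); last by exists 0.
  by have /dvdpP[R RE] := pF q Qq; exists R; rewrite mulrC.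
(* The correction is chosen to cancel the leading coefficient of the present error in all equations
   at once. *)
have [xi xiE] := Fsurj (fun q => - (R q).[0]).
pose p' l := p l * (1 + (xi l)%:P * 'X^(N.+1)).
exists p'; split=> [l|q Qq].
  by rewrite /p' !hornerE pz expr0n /= !mulr0 addr0 mulr1.
have H m : exists r, term p' m = term p m + 'X^(N.+1) * ((\sum_l xi l *+ m l) *: term p m) +
    'X^(N.+2) * (term p m * r).
  have [r rE] := first_order xi N m; exists r.
  have -> : term p' m = term p m * mono (fun l => 1 + (xi l)%:P * 'X^(N.+1)) m.
    rewrite /term -mulrA; congr (_ * _); rewrite /mono -big_split /=.
    by apply: eq_bigr => l _; rewrite exprMn.
  rewrite rE -mul_polyC; ring.
have [r rE] := choice H.
have [r1 r1E] := lead_split (fun m => \sum_l xi l *+ m l) Qq pz.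
rewrite xiE // in r1E.
have -> : ev p' (F q) = ev p (F q) +
   'X^(N.+1) * (\sum_(m <- B) (F q m * \sum_l xi l *+ m l) *: term p m) +
   'X^(N.+2) * (\sum_(m <- B) F q m *: (term p m * r m)).
  rewrite /ev !mulr_sumr -!big_split /=; apply: eq_bigr => m _.
  rewrite rE !scalerDr -!scalerAr scalerA; congr (_ + _ + _).
have [r2 r2E] := split0 (R q).
rewrite r1E RE // {1}r2E; apply: dvdp_add.
  have -> : 'X^(D q + N.+1) * ((R q).[0]%:P + 'X * r2) +
     'X^(N.+1) * ('X^(D q) * ((- (R q).[0])%:P + 'X * r1)) = 'X^(D q + N.+2) * (r2 + r1).
    by rewrite polyCN !exprD !exprS; ring.
  exact: dvdp_mulr.
rewrite addnC exprD; apply: dvdp_mul => //.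
apply: dvdp_sum => m _ _.
have [->|Fm] := eqVneq (F q m) 0; first by rewrite scale0r dvdp0.
apply: dvdp_scale; apply: dvdp_mulr; rewrite /term; apply: dvdp_mulr.
by apply: dvdp_exp2l; apply: FD.
Qed.

End Hensel.
End Arcs.

(** * Divisible groups and systems along a tree *)

(* The multiplicative group of the complex numbers, written additively, so that the
   torus equations and their logarithmic derivatives are instances of one lemma. *)
Record ctorus := CTorus { ctorus_val : CC; ctorus_neq0 : ctorus_val != 0 }.
HB.instance Definition _ := [isSub for ctorus_val].
HB.instance Definition _ := [Choice of ctorus by <:].

Lemma ctorus_mul_subproof (x y : ctorus) : ctorus_val x * ctorus_val y != 0.
Proof. by rewrite mulf_neq0 //; apply: ctorus_neq0. Qed.
Lemma ctorus_inv_subproof (x : ctorus) : (ctorus_val x)^-1 != 0.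
Proof. by rewrite invr_neq0 //; apply: ctorus_neq0. Qed.

Definition ctorus_one : ctorus := CTorus (oner_neq0 CC).
Definition ctorus_mul (x y : ctorus) : ctorus := CTorus (ctorus_mul_subproof x y).
Definition ctorus_inv (x : ctorus) : ctorus := CTorus (ctorus_inv_subproof x).

Lemma ctorus_mulA : associative ctorus_mul.
Proof. by move=> x y z; apply: val_inj; apply: mulrA. Qed.
Lemma ctorus_mulC : commutative ctorus_mul.
Proof. by move=> x y; apply: val_inj; apply: mulrC. Qed.
Lemma ctorus_mul1 : left_id ctorus_one ctorus_mul.
Proof. by move=> x; apply: val_inj; apply: mul1r. Qed.
Lemma ctorus_mulV : left_inverse ctorus_one ctorus_inv ctorus_mul.
Proof. by move=> x; apply: val_inj; apply: mulVf; apply: ctorus_neq0. Qed.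

HB.instance Definition _ := GRing.isZmodule.Build ctorus
  ctorus_mulA ctorus_mulC ctorus_mul1 ctorus_mulV.

Lemma val_ctorusD (x y : ctorus) : val (x + y) = val x * val y. Proof. by []. Qed.
Lemma val_ctorusMn (x : ctorus) n : val (x *+ n) = val x ^+ n.
Proof. by elim: n => // n IH; rewrite mulrS val_ctorusD IH exprS. Qed.
Lemma val_ctorus_sum (I : Type) (r : seq I) (F : I -> ctorus) :
  val (\sum_(i <- r) F i) = \prod_(i <- r) val (F i).
Proof.
elim: r => [|i r IH]; first by rewrite !big_nil.
by rewrite !big_cons val_ctorusD IH.
Qed.

Definition divisible (A : zmodType) := forall n (a : A), (0 < n)%N -> exists b, b *+ n = a.

Lemma ctorus_divisible : divisible ctorus.
Proof.
move=> n a n0; have n0' : n.-root (val a) != 0.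
  by rewrite rootC_eq0 //; apply: ctorus_neq0.
exists (CTorus n0'); apply: val_inj; rewrite val_ctorusMn /=; exact: rootCK.
Qed.

Lemma CC_divisible : divisible CC.
Proof.
by move=> n a n0; exists (a / n%:R); rewrite -[LHS]mulr_natr divfK // pnatr_eq0 -lt0n.
Qed.

Section Solve.
Variables (V : finType) (e : rel V) (d : V -> V -> nat)
  (alpha : V -> V -> leaf_t e -> nat).
Local Notation L := (leaf_t e).
Hypothesis tree : is_tree e.
Hypothesis node_ex : exists x, is_node e x.
Hypothesis val2 : forall x, valency e x != 2%N.
Hypothesis dpos : forall v u, is_node e v -> e v u -> (0 < d v u)%N.
Hypothesis alphaP : admissible_alpha e d alpha.
Local Notation lw := (@fan_weight V e d).
Local Notation lD := (@fan_degree V e d).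
Local Notation mexp := (m_exp alpha).
Let leafN := leaf_node tree val2 node_ex.

Lemma side_away x y v z l : e x y -> side e x y v -> e v z -> ~~ side e v z x ->
  side e v z l -> side e x y l.
Proof.
move=> exy sv evz nsx sl.
have nxv : x != v by apply: contraTneq sv => <-; rewrite side_bridge.
have [q evq sq] := side_exists tree nxv.
apply: (side_nest tree evq exy sq sv).
by apply: contra nsx => sql; rewrite (side_uniq tree evz evq sl) in sql; rewrite -(eqP sql).
Qed.

Variable A : zmodType.
Hypothesis divA : divisible A.
Variable Y : V -> V -> A.

(* Solve the subtrees behind [y] separately; multiplying the solution of the subtree behind
   [z] by the one-parameter subgroup [w_y] preserves its equations up to the constants [s]
   and adjusts the value of the monomial [m_{y,z}] freely. *)
Lemma branch_solve x y : e x y -> exists (xi : L -> A) (s : V -> A),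
  forall v z, is_node e v -> side e x y v -> e v z -> ~~ side e v z x ->
    \sum_l xi l *+ alpha v z l = Y v z + s v.
Proof.
move: {2}#|side e x y| (leqnn #|side e x y|) => n.
elim: n x y => [|n IH] x y.
  by rewrite leqn0 => /eqP/card0_eq/(_ y); rewrite [_ \in _]side_refl.
move=> cn exy; have [ly|] := boolP (is_leaf e y).
  exists (fun=> 0), (fun=> 0) => v z nv; rewrite (side_leaf tree) // => /eqP E.
  by move: nv; rewrite E -[is_node e y]negbK -leafN ly.
rewrite leafN negbK => ny.
have eyx : e y x by rewrite (tree_sym tree).
have /choice[sol solP] : forall z, exists p : (L -> A) * (V -> A), e y z -> z != x ->
    \sum_l p.1 l *+ alpha y z l = Y y z /\
    forall v z', is_node e v -> side e y z v -> e v z' -> ~~ side e v z' y ->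
      \sum_l p.1 l *+ alpha v z' l = Y v z' + p.2 v.
  move=> z; have [eyz|ne] := boolP (e y z); last by exists (fun=> 0, fun=> 0).
  have [->|nz] := eqVneq z x; first by exists (fun=> 0, fun=> 0).
  have [||xi0 [s0 H0]] := IH y z => //.
    by rewrite -ltnS; apply: leq_trans cn; apply: (card_side tree exy eyz nz).
  (* The monomial at [y] towards [z] has [w_y]-weight [dv e d y], so its value is adjusted by a
     [dv e d y]-th part; divisibility of the group enters here. *)
  have [t tE] := divA (Y y z - \sum_l xi0 l *+ alpha y z l) (dv_gt0 dpos ny).
  have shift v z' : is_node e v -> e v z' -> ~~ side e v z' y ->
      \sum_l (xi0 l + t *+ lw y l) *+ alpha v z' l =
      \sum_l xi0 l *+ alpha v z' l + t *+ lD y v.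
    move=> nv ez' ns; rewrite -(pw_away tree node_ex val2 dpos alphaP nv ez' ns).
    rewrite pw_mexp -sumrMnr -big_split /=; apply: eq_bigr => l _.
    by rewrite mulrnDl -mulrnA mulnC.
  exists (fun l => xi0 l + t *+ lw y l, fun v => s0 v + t *+ lD y v) => _ _ /=; split.
    rewrite shift ?side_bridge // lD_node // ell_diag tE addrC subrK //.
  by move=> v z' nv sv ez' ns; rewrite shift // H0 // addrA.
pose dir t := odflt y [pick z | e y z && side e y z t].
have dirE z t : e y z -> side e y z t -> dir t = z.
  move=> ez sz; rewrite /dir; case: pickP => [z' /andP[ez' sz']|/(_ z)]; last by rewrite ez sz.
  by apply/eqP; rewrite -(side_uniq tree ez ez' sz).
exists (fun l => (sol (dir (val l))).1 l), (fun v => if v == y then 0 else (sol (dir v)).2 v).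
move=> v z nv sv evz nsx; case: eqVneq => [vy|nvy].
  subst v; have nz : z != x by apply: contraNneq nsx => ->; apply: side_refl.
  have [H1 _] := solP z evz nz; rewrite -H1 addr0; apply: eq_bigr => l _.
  have [->|/(alpha_side tree alphaP ny evz) sl] := alpha y z l =P 0%N; first by rewrite !mulr0n.
  by rewrite (dirE z).
have [z1 [ez1 nz1 sz1]] := side_inv tree exy sv nvy.
have nvx : v != x by apply: contraTneq sv => ->; rewrite side_bridge.
have nsy : ~~ side e v z y.
  have := sep_adj tree exy evz; rewrite !xpair_eqE (negbTE nvy) (negbTE nvx) /= /sep.
  by rewrite (negbTE nsx); case: (side e v z y).
have [_ H2] := solP z1 ez1 nz1; rewrite (dirE z1) // -H2 //; apply: eq_bigr => l _.
have [->|/(alpha_side tree alphaP nv evz) sl] := alpha v z l =P 0%N; first by rewrite !mulr0n.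
by rewrite (dirE z1) //; apply: (side_away ez1 sz1 evz nsy sl).
Qed.

(** A monomial pointing away from the edge involves only leaves on its own side, so the two sides
    are solved separately and glued. *)
Lemma edge_solve x y : e x y -> exists (xi : L -> A) (s : V -> A),
  forall v z, is_node e v -> e v z ->
    ~~ (if side e x y v then side e v z x else side e v z y) ->
    \sum_l xi l *+ alpha v z l = Y v z + s v.
Proof.
move=> exy; have eyx : e y x by rewrite (tree_sym tree).
have [xi1 [s1 H1]] := branch_solve exy; have [xi2 [s2 H2]] := branch_solve eyx.
exists (fun l => if side e x y (val l) then xi1 l else xi2 l),
  (fun v => if side e x y v then s1 v else s2 v) => v z nv evz.
case: ifP => sv ns.
  rewrite -H1 //; apply: eq_bigr => l _.
  have [->|/(alpha_side tree alphaP nv evz) sl] := alpha v z l =P 0%N; first by rewrite !mulr0n.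
  by rewrite (side_away exy sv evz ns sl).
have sv' : side e y x v by rewrite (sideN tree) // sv.
rewrite -H2 //; apply: eq_bigr => l _.
have [->|/(alpha_side tree alphaP nv evz) sl] := alpha v z l =P 0%N; first by rewrite !mulr0n.
by rewrite (sideN tree) // (side_away eyx sv' evz ns sl).
Qed.
End Solve.

(** * The fan lies in the tropicalization *)

Section FanInTrop.
Variables (V : finType) (e : rel V) (d : V -> V -> nat)
  (alpha : V -> V -> leaf_t e -> nat) (c : V -> V -> nat -> CC)
  (g : V -> nat -> series e).
Local Notation L := (leaf_t e).
Hypothesis tree : is_tree e.
Hypothesis node_ex : exists x, is_node e x.
Hypothesis val2 : forall x, valency e x != 2%N.
Hypothesis dpos : forall v u, is_node e v -> e v u -> (0 < d v u)%N.
Hypothesis edc : edge_determinant_cond e d.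
Hypothesis alphaP : admissible_alpha e d alpha.
Hypothesis minors : minors_cond e c.
Hypothesis gP : g_cond e d g.
Local Notation lw := (@fan_weight V e d).
Local Notation lD := (@fan_degree V e d).
Local Notation mexp := (m_exp alpha).
Local Notation I := (in_ideal_gen (splice_gens e alpha c g)).
Local Notation Fs := (@splice_eq V e alpha c g).
Let leafN := leaf_node tree val2 node_ex.

Lemma pw_ge u v z : is_node e v -> e v z -> (lD u v <= pw (lw u) (mexp v z))%N.
Proof.
move=> nv evz; have [lu|nu] := boolP (is_leaf e u); first by rewrite /fan_degree lu.
rewrite leafN negbK in nu; have [su|nsu] := boolP (side e v z u).
  exact: ltnW (pw_toward tree node_ex val2 dpos edc alphaP nv evz su nu).
by rewrite (pw_away tree node_ex val2 dpos alphaP nv evz nsu).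
Qed.

Lemma side_same x y v z : e x y -> side e x y v -> e v z ->
  ~~ side e v z x -> ~~ side e v z y.
Proof.
move=> exy sv evz nsx; have [E|nvy] := eqVneq v y; first by rewrite -E side_bridge.
have nvx : v != x by apply: contraTneq sv => ->; rewrite side_bridge.
have := sep_adj tree exy evz; rewrite !xpair_eqE (negbTE nvy) (negbTE nvx) /= /sep.
by rewrite (negbTE nsx); case: (side e v z y).
Qed.

(** If [x] is a node, the monomial points to it. If [x] is a leaf, either [v = y] and the monomial
    contains the variable of [x], or it points to the node [y]. *)
Lemma edge_toward x y v z : e x y -> side e x y v -> is_node e v -> e v z ->
  side e v z x -> (lD x v < pw (lw x) (mexp v z))%N \/ (lD y v < pw (lw y) (mexp v z))%N.
Proof.
move=> exy sv nv evz sx; have eyx : e y x by rewrite (tree_sym tree).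
have [lx|nx] := boolP (is_leaf e x); last first.
  left; apply: (pw_toward tree node_ex val2 dpos edc alphaP) => //.
  by rewrite -[is_node e x]negbK -leafN.
have [vy|nvy] := eqVneq v y.
  subst v; left.
  have := side_refl e y x; rewrite (side_uniq tree evz eyx sx) => /eqP <-.
  by rewrite {1}/fan_degree lx; apply: (pw_leaf tree dpos alphaP).
right; apply: (pw_toward tree node_ex val2 dpos edc alphaP) => //.
  have nvx : v != x by apply: contraTneq sv => ->; rewrite side_bridge.
  have := sep_adj tree exy evz; rewrite !xpair_eqE (negbTE nvy) (negbTE nvx) /= /sep.
  by rewrite sx; case: (side e v z y).
exact: (leaf_edge_node tree val2 node_ex lx exy).
Qed.

Section Edge.
Variables (x y : V) (A B : nat).
Definition ew (l : L) : nat := (A * lw x l + B * lw y l)%N.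
Definition eD (v : V) : nat := (A * lD x v + B * lD y v)%N.
(** The far end serves as target, so that at an end of the edge the chosen direction is the edge
    itself. *)
Definition toward (v z : V) : bool := if side e x y v then side e v z x else side e v z y.

Lemma pw_ew m : pw ew m = (A * pw (lw x) m + B * pw (lw y) m)%N.
Proof.
by rewrite /pw !big_distrr -big_split; apply: eq_bigr => l _ /=; rewrite /ew; lia.
Qed.

Hypothesis exy : e x y.
Hypothesis A0 : (0 < A)%N.
Hypothesis B0 : (0 < B)%N.

Let eyx : e y x. Proof. by rewrite (tree_sym tree). Qed.

Lemma edge_node : is_node e x \/ is_node e y.
Proof.
have [lx|] := boolP (is_leaf e x); last by rewrite leafN negbK; left.
by right; apply: (leaf_edge_node tree val2 node_ex lx exy).
Qed.

Lemma ew_gt0 l : (0 < ew l)%N.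
Proof.
rewrite /ew addn_gt0 !muln_gt0 A0 B0 /=.
by case: edge_node => n; rewrite (lw_node d tree node_ex val2 l n) ell_gt0 ?orbT.
Qed.

Lemma ew_away v z : is_node e v -> e v z -> ~~ toward v z -> pw ew (mexp v z) = eD v.
Proof.
move=> nv evz; rewrite /toward pw_ew /eD; case: ifP => sv ns.
  have ns' := side_same exy sv evz ns.
  by rewrite !(pw_away tree node_ex val2 dpos alphaP nv evz).
have sv' : side e y x v by rewrite (sideN tree) // sv.
have ns' := side_same eyx sv' evz ns.
by rewrite !(pw_away tree node_ex val2 dpos alphaP nv evz).
Qed.

Lemma ew_toward v z : is_node e v -> e v z -> toward v z -> (eD v < pw ew (mexp v z))%N.
Proof.
move=> nv evz; rewrite /toward pw_ew /eD.
have gx := pw_ge x nv evz; have gy := pw_ge y nv evz.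
have mx k k' : (k <= k')%N -> (A * k <= A * k')%N by rewrite leq_pmul2l.
have my k k' : (k <= k')%N -> (B * k <= B * k')%N by rewrite leq_pmul2l.
have mx' k k' : (k < k')%N -> (A * k < A * k')%N by rewrite ltn_pmul2l.
have my' k k' : (k < k')%N -> (B * k < B * k')%N by rewrite ltn_pmul2l.
have gx' := mx _ _ gx; have gy' := my _ _ gy.
case: ifP => sv ts.
  by case: (edge_toward exy sv nv evz ts) => [/mx'|/my']; lia.
have sv' : side e y x v by rewrite (sideN tree) // sv.
by case: (edge_toward eyx sv' nv evz ts) => [/my'|/mx']; lia.
Qed.

Lemma toward_uniq v : is_node e v -> exists2 z0, e v z0 &
  forall z, e v z -> toward v z = (z == z0).
Proof.
move=> nv; rewrite /toward; case sv : (side e x y v).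
  have nxv : x != v by apply/eqP => E; move: sv; rewrite -E side_bridge.
  have [z0 e0 s0] := side_exists tree nxv; exists z0 => // z ez.
  exact: (side_uniq tree e0 ez s0).
have nyv : y != v by apply/eqP => E; move: sv; rewrite -E side_refl.
have [z0 e0 s0] := side_exists tree nyv; exists z0 => // z ez.
exact: (side_uniq tree e0 ez s0).
Qed.

Lemma ew_tail v i m : is_node e v -> (i < valency e v - 2)%N -> g v i m != 0 ->
  (eD v < pw ew m)%N.
Proof.
move=> nv iv gm; rewrite pw_ew /eD.
have H u : is_node e u -> (lD u v < pw (lw u) m)%N.
  exact: (g_weight tree node_ex val2 gP nv iv gm).
have H' u : (lD u v <= pw (lw u) m)%N.
  have [lu|] := boolP (is_leaf e u); first by rewrite /fan_degree lu.
  by rewrite leafN negbK => /H /ltnW.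
have gx : (A * lD x v <= A * pw (lw x) m)%N by rewrite leq_pmul2l.
have gy : (B * lD y v <= B * pw (lw y) m)%N by rewrite leq_pmul2l.
case: edge_node => /H lt.
  have : (A * lD x v < A * pw (lw x) m)%N by rewrite ltn_pmul2l.
  lia.
have : (B * lD y v < B * pw (lw y) m)%N by rewrite ltn_pmul2l.
lia.
Qed.

Lemma splice_eq_coef v i m :
  Fs v i m = \sum_(z | e v z) c v z i * (m == mexp v z)%:R + g v i m.
Proof.
rewrite splice_eqE fpsDE fps_sumE; congr (_ + _); apply: eq_bigr => z _.
by rewrite fcstME.
Qed.

Lemma Fs_weight v i m : is_node e v -> (i < valency e v - 2)%N -> Fs v i m != 0 ->
  (eD v <= pw ew m)%N.
Proof.
move=> nv iv; rewrite splice_eq_coef; have [/(ew_tail nv iv)/ltnW //|] := boolP (g v i m != 0).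
rewrite negbK => /eqP ->; rewrite addr0 => nz.
have /existsP[z /andP[evz /eqP ->]] : [exists z, e v z && (m == mexp v z)].
  apply: contraNT nz => /existsPn N; rewrite big1 // => z evz.
  by have := N z; rewrite evz /= => /negbTE ->; rewrite mulr0.
have [t|nt] := boolP (toward v z); first exact: ltnW (ew_toward nv evz t).
by rewrite (ew_away nv evz nt).
Qed.

(** The arbitrary [phi] covers both evaluation of the initial form at a torus point and its
    logarithmic derivative. *)
Lemma Fs_initial (K : nat) v i (phi : {ffun L -> nat} -> CC) z0 :
  is_node e v -> (i < valency e v - 2)%N -> (eD v <= K)%N ->
  (forall z, e v z -> toward v z = (z == z0)) ->
  \sum_(m <- slice ew 0 K.+1 | pw ew m == eD v) Fs v i m * phi m =
  \sum_(z | e v z && (z != z0)) c v z i * phi (mexp v z).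
Proof.
move=> nv iv vK tz.
rewrite (eq_bigr (fun m => \sum_(z | e v z) c v z i * ((m == mexp v z)%:R * phi m))); last first.
  move=> m /eqP E; rewrite splice_eq_coef.
  have -> : g v i m = 0.
    by apply/eqP; apply: contraT => /(ew_tail nv iv); rewrite E ltnn.
  by rewrite addr0 mulr_suml; apply: eq_bigr => z _; rewrite mulrA.
rewrite exchange_big /= [RHS]big_mkcondr /=; apply: eq_bigr => z evz.
rewrite -mulr_sumr -tz //; case: (boolP (toward v z)) => [t|nt] /=.
  have lt := ew_toward nv evz t; rewrite big1 ?mulr0 // => m /eqP E.
  by case: eqP => [mE|_]; [rewrite -mE E ltnn in lt | rewrite mul0r].
have E := ew_away nv evz nt; congr (_ * _).
rewrite big_mkcond (bigD1_seq (mexp v z)) ?slice_uniq //=; last first.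
  by rewrite (mem_slice ew_gt0) E.
rewrite E !eqxx mul1r big1 ?addr0 // => m nm.
by case: ifP => // _; rewrite (negbTE nm) mul0r.
Qed.

(** Kernel vectors prescribe the monomials at each node up to a factor. Solving in the torus gives
    the starting point of Newton's method, and solving in the additive group of [CC] shows that the
    logarithmic Jacobian is onto. *)
Lemma arc (K : nat) : (forall v, (eD v <= K)%N) ->
  exists p : L -> {poly CC}, (forall l, (p l).[0] != 0) /\
  forall v i, is_node e v -> (i < valency e v - 2)%N ->
    'X^(K.+1) %| ev ew K p (Fs v i).
Proof.
move=> eDK.
have /choice[z0 z0P] : forall v, exists z0, is_node e v -> e v z0 /\
    forall z, e v z -> toward v z = (z == z0).
  move=> v; have [nv|] := boolP (is_node e v); last by exists v.
  by have [z ez tz] := toward_uniq nv; exists z.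
have /choice[k kP] : forall v, exists k : V -> CC, (forall z, k z != 0) /\
    (is_node e v -> forall i, (i < valency e v - 2)%N ->
      \sum_(z | e v z && (z != z0 v)) c v z i * k z = 0).
  move=> v; have [nv|] := boolP (is_node e v); last first.
    by exists (fun=> 1); split=> // z; apply: oner_neq0.
  have [e0 _] := z0P v nv; have [k [k0 kE]] := minors_kernel minors nv e0.
  exists (fun z => if e v z && (z != z0 v) then k z else 1); split=> [z|_ i iv].
    by case: ifP => [/andP[ez nz]|_]; [apply: k0 | apply: oner_neq0].
  rewrite -[RHS](kE (Ordinal iv)); apply: eq_bigr => z -> //.
pose Y v z : ctorus := CTorus ((kP v).1 z).
have [xi [s xiE]] := edge_solve tree node_ex val2 dpos alphaP ctorus_divisible Y exy.
pose zeta l := val (xi l).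
have monoE v z : is_node e v -> e v z -> ~~ toward v z ->
    mono zeta (mexp v z) = k v z * val (s v).
  move=> nv evz nt; have := congr1 val (xiE v z nv evz nt).
  rewrite val_ctorusD /= val_ctorus_sum => <-.
  by apply: eq_bigr => l _; rewrite val_ctorusMn ffunE.
have zeta0 l : zeta l != 0 by apply: ctorus_neq0.
pose Q (q : V * nat) := is_node e q.1 /\ (q.2 < valency e q.1 - 2)%N.
pose F q := Fs q.1 q.2; pose D (q : V * nat) := eD q.1.
have FD q m : Q q -> F q m != 0 -> (D q <= pw ew m)%N.
  by move=> [nv iv]; apply: Fs_weight.
have kz v i : is_node e v -> (i < valency e v - 2)%N ->
    \sum_(z | e v z && (z != z0 v)) c v z i * mono zeta (mexp v z) = 0.
  move=> nv iv; rewrite (eq_bigr (fun z => c v z i * k v z * val (s v))).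
    by rewrite -mulr_suml (kP v).2 // mul0r.
  move=> z /andP[evz nz]; rewrite monoE ?mulrA //.
  by have [_ ->] := z0P v nv.
have F0 q : Q q -> \sum_(m <- slice ew 0 K.+1 | pw ew m == D q) F q m * mono zeta m = 0.
  move=> [nv iv]; have [e0 tz] := z0P q.1 nv.
  by rewrite (Fs_initial _ nv iv (eDK _) tz) kz.
have Fsurj (b : V * nat -> CC) : exists xi : L -> CC, forall q, Q q ->
    \sum_(m <- slice ew 0 K.+1 | pw ew m == D q)
      F q m * (mono zeta m * \sum_l xi l *+ m l) = b q.
  have /choice[eta etaP] : forall v, exists t : V -> CC, is_node e v ->
      forall i, (i < valency e v - 2)%N ->
      \sum_(z | e v z && (z != z0 v)) c v z i * t z = b (v, i).
    move=> v; have [nv|] := boolP (is_node e v); last by exists (fun=> 0).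
    have [e0 _] := z0P v nv.
    have [t tE] := minors_surj minors nv (fun i => b (v, nat_of_ord i)) e0.
    by exists t => _ i iv; apply: (tE (Ordinal iv)).
  have [xi' [s' E]] := edge_solve tree node_ex val2 dpos alphaP CC_divisible
    (fun v z => eta v z / mono zeta (mexp v z)) exy.
  exists xi' => -[v i] [/= nv iv]; have [e0 tz] := z0P v nv.
  rewrite (Fs_initial _ nv iv (eDK _) tz) /=.
  (* The undetermined [s' v] contributes a multiple of the initial form at [zeta], which is 0. *)
  rewrite (eq_bigr (fun z => c v z i * eta v z + c v z i * mono zeta (mexp v z) * s' v)).
    by rewrite big_split /= -mulr_suml kz // mul0r addr0 etaP.
  move=> z /andP[evz nz].
  have -> : \sum_l xi' l *+ mexp v z l = \sum_l xi' l *+ alpha v z l.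
    by apply: eq_bigr => l _; rewrite ffunE.
  rewrite E //; last by rewrite -/(toward v z) tz.
  have M0 : mono zeta (mexp v z) != 0.
    by rewrite /mono; apply/prodf_neq0 => l _; rewrite expf_neq0.
  by rewrite /=; field.
have [p [pz pF]] := hensel FD F0 Fsurj K.
exists p; split=> [l|v i nv iv]; first by rewrite pz.
apply: dvdp_trans (pF (v, i) (conj nv iv)).
by apply: dvdp_exp2l; apply: leq_addl.
Qed.

Lemma edge_no_monomial f m : I f -> f m != 0 ->
  ~ (forall a, f a != 0 -> a != m -> (pw ew m < pw ew a)%N).
Proof.
move=> If fm H.
(* The order must exceed the weight of [m], where a nonzero coefficient is read off, and the weights
   of all initial forms, so that none is truncated. *)
pose K := (pw ew m + \sum_v eD v)%N.
have eDK v : (eD v <= K)%N by rewrite /K (bigD1 v) //= addnCA leq_addr.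
have [p [p0 pF]] := arc eDK.
have [k [h [G [HG fE]]]] := (in_ideal_genP _ _).1 If.
have div : 'X^(K.+1) %| ev ew K p f.
  rewrite fE ev_sum; apply: dvdp_sum => j _ _.
  have [_ [v [i [nv iv /funext GE]]]] := HG j.
  rewrite -(subrK (ev ew K p (h j) * ev ew K p (G j)) (ev ew K p (h j * G j))).
  apply: dvdp_add; first exact: (ev_mul ew_gt0).
  by apply: dvdp_mull; rewrite GE; apply: pF.
have mK : (pw ew m <= K)%N by apply: leq_addr.
have := ev_lead ew_gt0 p mK H.
have /dvdpP[q ->] := div; rewrite mulrC coefXnM ltnS mK => /esym/eqP.
rewrite mulf_eq0 (negbTE fm) /= /mono => /prodf_eq0[l _].
by rewrite expf_eq0 (negbTE (p0 l)) andbF.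
Qed.

End Edge.

(** Below [wdot w m + 1] the weight takes finitely many values, since the exponents of variables of
    positive weight are bounded there. *)
Lemma gap (w : L -> RR) m : (forall l, 0 <= w l) -> exists2 dl : RR, 0 < dl &
  forall a, wdot w m < wdot w a -> wdot w m + dl <= wdot w a.
Proof.
move=> w0.
have wd0 a : 0 <= wdot w a by apply: sumr_ge0 => l _; rewrite mulr_ge0.
pose N := (\sum_l Num.bound ((wdot w m + 1) / w l)).+1.
have big (a : mindex e) l : 0 < w l -> (N <= a l)%N -> wdot w m + 1 <= wdot w a.
  move=> wl Na; have x0 : 0 <= (wdot w m + 1) / w l.
    by rewrite divr_ge0 // addr_ge0.
  apply: (@le_trans _ _ (w l * (a l)%:R)); last first.
    by rewrite /wdot (bigD1 l) //= lerDl; apply: sumr_ge0 => l' _; rewrite mulr_ge0.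
  rewrite mulrC -ler_pdivrMr //; apply: ltW; apply: lt_le_trans (archi_boundP x0) _.
  by rewrite ler_nat (leq_trans _ Na) // /N (bigD1 l) //= -addnS leq_addr.
have pos (s : seq RR) : exists2 dl : RR, 0 < dl & forall x, x \in s -> 0 < x -> dl <= x.
  elim: s => [|x s [dl dl0 H]]; first by exists 1.
  have [x0|nx0] := boolP (0 < x); last first.
    by exists dl => // y; rewrite inE => /orP[/eqP ->|/H //]; rewrite (negbTE nx0).
  exists (Num.min x dl); first by rewrite lt_min x0.
  move=> y; rewrite inE => /orP[/eqP -> _|ys y0]; first by rewrite ge_min lexx.
  by rewrite ge_min (H y ys y0) orbT.
have [dl dl0 dlP] := pos [seq wdot w (ofbox x) - wdot w m | x <- enum {ffun L -> 'I_N}].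
exists (Num.min 1 dl) => [|a lt]; first by rewrite lt_min ltr01.
(* Exponents at coordinates of weight 0 are unbounded but do not change the weight; erasing them
   allows a finite box. *)
pose b : {ffun L -> nat} := [ffun l => if w l == 0 then 0%N else a l].
have ab : wdot w b = wdot w a.
  by apply: eq_bigr => l _; rewrite ffunE; case: eqP => // ->; rewrite !mul0r.
have [/existsP[l Nl]|/existsPn Nb] := boolP [exists l, (N <= b l)%N].
  have wl : 0 < w l.
    rewrite lt0r w0 andbT; move: Nl; rewrite ffunE; case: eqP => // _; by rewrite /N.
  by rewrite -ab; apply: (le_trans _ (big b l wl Nl)); rewrite lerD2l ge_min lexx.
have [|x E] := @ofboxP _ N b; first by move=> l; rewrite ltnNge Nb.
have /dlP : wdot w (ofbox x) - wdot w m \in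
    [seq wdot w (ofbox x) - wdot w m | x <- enum {ffun L -> 'I_N}].
  by apply/mapP; exists x => //; rewrite mem_enum.
rewrite -E ab subr_gt0 => /(_ lt); rewrite -lerBrDl; apply: le_trans.
by rewrite ge_min lexx orbT.
Qed.

Lemma fan_in_trop w : splice_fan e d w -> local_trop e (splice_gens e alpha c g) w.
Proof.
move=> /(splice_fanP tree node_ex val2 dpos)[x [y [s [t [exy s0 t0 wE]]]]].
have w0 l : 0 <= w l by rewrite wE addr_ge0 // mulr_ge0.
split=> // -[m /initial_ideal_monomial[f [If fm fmin]]].
have [dl dl0 dlP] := gap m w0.
have wdE a : wdot w a = s * (pw (lw x) a)%:R + t * (pw (lw y) a)%:R.
  rewrite /wdot /pw !natr_sum !mulr_sumr -big_split; apply: eq_bigr => l _ /=.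
  by rewrite wE !natrM; ring.
(* After scaling by [n], rounding both coefficients up to positive integers raises the weight of [m]
   by at most [C], less than the scaled gap [n * dl], and lowers no other weight; thus [C] depends
   on [m] alone. *)
pose C : RR := (pw (lw x) m + pw (lw y) m)%N%:R.
have C0 : 0 <= C / dl by rewrite divr_ge0 // ltW.
pose n := Num.bound (C / dl).
have nC : C < n%:R * dl by rewrite -ltr_pdivrMr // archi_boundP.
have round (r : RR) : 0 <= r -> exists A, [/\ (0 < A)%N, r <= A%:R & A%:R <= r + 1].
  move=> r0; have /andP[r1 r2] := truncn_itv r0.
  by exists (Num.truncn r).+1; rewrite ltW // -natr1 lerD2r.
have [A [A0 ge1 le1]] : exists A, [/\ (0 < A)%N, s * n%:R <= A%:R & A%:R <= s * n%:R + 1].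
  by apply: round; rewrite mulr_ge0.
have [B [B0 ge2 le2]] : exists B, [/\ (0 < B)%N, t * n%:R <= B%:R & B%:R <= t * n%:R + 1].
  by apply: round; rewrite mulr_ge0.
apply: (@edge_no_monomial x y A B exy A0 B0 f m If fm) => a fa na.
have lt := fmin a fa na; have := dlP a lt; rewrite !wdE => H.
rewrite -(ltr_nat RR) !pw_ew !natrD !natrM.
have n0 : 0 <= n%:R :> RR by [].
rewrite /C in nC.
rewrite natrD in nC.
set a1 := (pw (lw x) a)%:R in H *; set a2 := (pw (lw y) a)%:R in H *.
set m1 := (pw (lw x) m)%:R in H nC *; set m2 := (pw (lw y) m)%:R in H nC *.
have m10 : 0 <= m1 by []. have m20 : 0 <= m2 by [].
have a10 : 0 <= a1 by []. have a20 : 0 <= a2 by [].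
have p1 := ler_wpM2r m10 le1; have p2 := ler_wpM2r m20 le2.
have p3 := ler_wpM2r a10 ge1; have p4 := ler_wpM2r a20 ge2.
have p5 := ler_wpM2l n0 H; lra.
Qed.

End FanInTrop.

Theorem theorem6p2 (V : finType) (e : rel V) (d : V -> V -> nat)
  (alpha : V -> V -> leaf_t e -> nat) (c : V -> V -> nat -> CC)
  (g : V -> nat -> series e) :
  splice_tree e ->
  (forall v u, is_node e v -> e v u -> (0 < d v u)%N) ->
  edge_determinant_cond e d ->
  semigroup_cond e d ->
  admissible_alpha e d alpha ->
  minors_cond e c ->
  g_cond e d g ->
  forall w : leaf_t e -> RR,
    local_trop e (splice_gens e alpha c g) w <-> splice_fan e d w.
Proof.
move=> [tree node_ex val2] dpos edc _ alphaP minors gP w; split.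
  exact: trop_in_fan.
exact: fan_in_trop.
Qed.
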